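(* Consider the free discrete inhomogeneous bi-Schrödinger equation on $\mathbb{Z}$, $$i(\partial_tu)(t,n)-(\Delta^2u)(t,n)+F(t,n)=0,$$ with initial value $\{u(0,n)\}_{n\in\mathbb{Z}}\in\ell^2(\mathbb{Z})$. Then: (i) The Strichartz estimates $$\|\{u(t,n)\}\|_{L^q_t\ell^r}\le C\Big(\|\{u(0,n)\}\|_{\ell^2}+\|\{F(t,n)\}\|_{L^{\tilde q'}_t\ell^{\tilde r'}}\Big)$$ hold for all $(q,r),(\tilde q,\tilde r)\in\{(x,y)\ne(2,\infty):\frac1x+\frac1{4y}\le\frac18,\ x,y\ge2\}$, where $\tilde q',\tilde r'$ are the dual exponents of $\tilde q,\tilde r$. (ii) The decay estimate $\|e^{-it\Delta^2}\|_{\ell^1\to\ell^\infty}\lesssim|t|^{-1/4}$ ($t\ne0$) is sharp; that is, $\frac14$ is the supremum of all $\alpha$ for which there exists a constant $C_\alpha$ such that $$\|e^{-it\Delta^2}\phi\|_{\ell^\infty}\le C_\alpha|t|^{-\alpha}\|\phi\|_{\ell^1},\qquad t\ne0,$$ holds for every $\phi\in\ell^1(\mathbb{Z})$.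
   Context: $(\Delta\phi)(n)=\phi(n+1)+\phi(n-1)-2\phi(n)$ on $\mathbb{Z}$ and $\Delta^2=\Delta\circ\Delta$. The mixed norm is $\|\{u(t,n)\}\|_{L^q_t\ell^r}=\Big(\int_{\mathbb{R}}\big(\sum_{n\in\mathbb{Z}}|u(t,n)|^r\big)^{q/r}dt\Big)^{1/q}$ (usual modification for infinite exponents). The constant $C$ does not depend on $u(0,\cdot)$ or $F$. *)

(* Defs.v *)
From HB Require Import structures.
From mathcomp Require Import all_boot all_order all_algebra.
From mathcomp Require Import all_classical all_reals all_analysis.
From mathcomp Require Import complex.

Set Implicit Arguments.
Unset Strict Implicit.
Unset Printing Implicit Defensive.

Import Order.TTheory GRing.Theory Num.Theory.
Import numFieldNormedType.Exports.

Local Open Scope classical_set_scope.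
Local Open Scope ring_scope.
Local Open Scope complex_scope.

(* Every subset of the lattice Z is measurable, as for [nat] in the library,
   so that the l^r norms are the [Lnorm]s of the counting measure. *)
HB.instance Definition _ := isPointed.Build int 0.
HB.instance Definition _ := @isMeasurable.Build default_measure_display
  int discrete_measurable discrete_measurable0
  discrete_measurableC discrete_measurableU.

Definition discrete_laplacian (R : realType) (phi : int -> R[i]) : int -> R[i] :=
  fun n => phi (n + 1) + phi (n - 1) - phi n *+ 2.

Definition bilaplacian (R : realType) (phi : int -> R[i]) : int -> R[i] :=
  discrete_laplacian (discrete_laplacian phi).

Definition lnorm (R : realType) (r : \bar R) (phi : int -> R[i]) : \bar R :=
  Lnorm counting r (fun n : int => (ComplexField.Normc.normc (phi n))%:E).

Definition mixed_norm (R : realType) (q r : \bar R) (u : R -> int -> R[i])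
    : \bar R :=
  Lnorm lebesgue_measure q (fun t : measurableTypeR R => lnorm r (u t)).

(* Real and imaginary parts are taken separately below because R[i] carries no topology as
   a real normed space in the library. *)
Definition re_at (R : realType) (u : R -> int -> R[i]) (n : int) : R -> R :=
  fun t => complex.Re (u t n).

Definition im_at (R : realType) (u : R -> int -> R[i]) (n : int) : R -> R :=
  fun t => complex.Im (u t n).

Definition absolutely_continuous_on (R : realType) (f : R -> R) (a b : R) : Prop :=
  forall e : R, 0 < e -> exists2 d : R, 0 < d &
    forall (m : nat) (I : 'I_m -> R * R),
      (forall k, a <= (I k).1 /\ (I k).1 <= (I k).2 /\ (I k).2 <= b) ->
      trivIset [set: 'I_m] (fun k => [set` `](I k).1, (I k).2[]) ->
      \sum_(k < m) ((I k).2 - (I k).1) < d ->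
      \sum_(k < m) `|f (I k).2 - f (I k).1| < e.

Definition locally_absolutely_continuous (R : realType) (f : R -> R) : Prop :=
  forall a b : R, absolutely_continuous_on f a b.

Definition measurable_source (R : realType) (F : R -> int -> R[i]) : Prop :=
  forall n : int, measurable_fun [set: measurableTypeR R] (re_at F n) /\
                  measurable_fun [set: measurableTypeR R] (im_at F n).

(* The equation i u' - Delta^2 u + F = 0 for u in C(R; l^2), with F only
   measurable in time: each u(., n) is locally absolutely continuous and the
   equation holds almost everywhere. The requirement that u be an l^2-valued
   continuous function selects the usual solution: pointwise in n alone, the
   Cauchy problem has nonzero solutions with zero data. *)
Record bischrodinger_solution (R : realType) (u F : R -> int -> R[i]) : Prop := {
  solution_l2 : forall t : R, (lnorm 2%:E (u t) < +oo)%E ;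
  solution_continuous : forall t0 : R,
    lnorm 2%:E (fun n => u t n - u t0 n) @[t --> t0] --> 0%E ;
  solution_ac : forall n : int,
    locally_absolutely_continuous (re_at u n) /\
    locally_absolutely_continuous (im_at u n) ;
  solution_eq : forall n : int,
    {ae (@lebesgue_measure R), forall t : R,
      derivable (re_at u n) t 1 /\ derivable (im_at u n) t 1 /\
      'i%C * (derive1 (re_at u n) t +i* derive1 (im_at u n) t)
        - bilaplacian (u t) n + F t n = 0}
}.

(* e^{-it Delta^2} phi is the exponential series of the bounded operator
   -it Delta^2, summed at each site n. *)
Definition propagator_term (R : realType) (t : R) (phi : int -> R[i]) (n : int)
    (k : nat) : R[i] :=
  (- ('i%C * t%:C)) ^+ k / (k`!)%:R * iter k (@bilaplacian R) phi n.

Definition propagator (R : realType) (t : R) (phi : int -> R[i]) : int -> R[i] :=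
  fun n => limn (series (fun k => complex.Re (propagator_term t phi n k)))
        +i* limn (series (fun k => complex.Im (propagator_term t phi n k))).

Definition opnorm_l1_linfty (R : realType)
    (T : (int -> R[i]) -> (int -> R[i])) : \bar R :=
  ereal_sup [set lnorm +oo%E (T phi) | phi in [set phi | (lnorm 1%:E phi <= 1)%E]].

Definition decay_rate (R : realType) (alpha : R) : Prop :=
  exists C : R, forall t : R, t != 0 ->
    forall phi : int -> R[i], (lnorm 1%:E phi < +oo)%E ->
      (lnorm +oo (propagator t phi)
         <= (C * `|t| `^ (- alpha))%:E * lnorm 1%:E phi)%E.

(* The inverse in \bar R sends +oo to 0. *)
Definition strichartz_pair (R : realType) (x y : \bar R) : Prop :=
  [/\ (2%:E <= x)%E, (2%:E <= y)%E, (x, y) <> (2%:E, +oo%E) &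
      (x^-1 + (4%:E * y)^-1 <= (8^-1)%:E)%E].

(* Main.v *)
Require Import Defs.
From mathcomp Require Import all_boot all_order all_algebra.
From mathcomp Require Import all_classical all_reals all_analysis.
From mathcomp Require Import measurable_realfun ess_sup_inf complex ring lra zify.
Set Implicit Arguments.
Unset Strict Implicit.
Unset Printing Implicit Defensive.
Import Order.TTheory GRing.Theory Num.Theory.
Import numFieldNormedType.Exports.
Local Open Scope classical_set_scope.
Local Open Scope ring_scope.

(* The kernel of e^{-it Delta^2} is an oscillatory integral with phase
   (2 - 2 cos x)^2, whose second derivative vanishes to first order at x = 2 pi / 3
   and to second order at x = 0. Cutting out neighbourhoods of size |t|^(-1/4) and
   applying van der Corput's second derivative test gives the decay |t|^(-1/4).
   For the sharpness, a Fejer-type average of the kernel at n = 0 over the times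
   j - k with j, k < M^4 sees the frequencies of size 1/M and is too large for any
   better decay rate.

   For the Strichartz estimates, let (q, r) be admissible for the source. A finite
   combination of values of u is paired with F by differentiating
   sum_n u(s, n) K_{t-s}(n - m) in s: the bilaplacians cancel by Green's summation
   by parts, the boundary terms at |n| = N vanish as N tends to infinity, and
   absolute continuity turns the differential inequality into an integral bound.
   The test function that F meets is a superposition of kernels, which the TT*
   identity and a discrete Hardy-Littlewood-Sobolev inequality place in the class
     |w(s)|_{l^2} <= A,  |w(s, n)| <= b_k for k <= s < k + 1,  sum_k b_k^8 <= A^8.
   Hoelder's inequality pairs this class with every dual admissible norm, and the
   mixed norm of every admissible pair is at most A on it. Duality over the
   combinations puts u itself in the class, first with one time (l^2), then with
   one space-time point per unit time interval (the b_k). The lattice makes short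
   times harmless, which is why only the unit time scale occurs and why all the
   pairs below the line 1/q + 1/(4r) = 1/8 are allowed. *)

(** The number 8 comes from convolution: [|t|^(-1/4)] maps l^(8/7) to l^8, since 7/8 + 1/4 = 1 +
    1/8. So (8, oo) is the extreme pair beside (oo, 2), and the b_k are measured by eighth powers.
    The source is merely measurable at each site and the equation holds only almost everywhere.
    Hence no Duhamel integral for u is formed; u is tested against finite combinations only.
    Causality, by which only times between 0 and t act on u(t), enters the test function as a
    coefficient [chi] in {-1, 0, 1}. This cut costs nothing: with a single time it is a common
    factor, and with many times the estimates see only the absolute values of coefficients and
    kernels. So the retarded estimate needs no argument of its own. All bounds on the class are the
    same for every exponent, so one constant serves all pairs. On the Fourier side evenness reduces
    the kernel to real integrals over [0, pi]; these are estimated by comparing primitives through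
    the mean value theorem. *)

Section Calculus.
Context {R : realType}.
Implicit Types (f g : R -> R) (x a b c : R).

Lemma drvD f g x a b : is_derive x 1 f a -> is_derive x 1 g b ->
  is_derive x 1 (fun y => f y + g y) (a + b).
Proof. exact: is_deriveD. Qed.

Lemma drvB f g x a b : is_derive x 1 f a -> is_derive x 1 g b ->
  is_derive x 1 (fun y => f y - g y) (a - b).
Proof. exact: is_deriveB. Qed.

Lemma drvN f x a : is_derive x 1 f a -> is_derive x 1 (fun y => - f y) (- a).
Proof. exact: is_deriveN. Qed.

Lemma drvM f g x a b : is_derive x 1 f a -> is_derive x 1 g b ->
  is_derive x 1 (fun y => f y * g y) (a * g x + f x * b).
Proof.
move=> df dg; apply: (is_derive_eq (is_deriveM df dg)).
by rewrite /GRing.scale /= addrC mulrC.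
Qed.

Lemma drvC c x : is_derive x 1 (fun=> c) 0.
Proof. exact: is_derive_cst. Qed.

Lemma drvI x : is_derive x 1 (fun y : R => y) 1.
Proof. exact: is_derive_id. Qed.

Lemma drvZ c f x a : is_derive x 1 f a -> is_derive x 1 (fun y => c * f y) (c * a).
Proof. exact: is_deriveZ. Qed.

Lemma drvV f x a : f x != 0 -> is_derive x 1 f a ->
  is_derive x 1 (fun y => (f y)^-1) (- a / f x ^+ 2).
Proof.
move=> fx df; apply: (is_derive_eq (is_deriveV fx df)).
by rewrite /GRing.scale /= mulrC mulrN mulNr.
Qed.

Lemma drv_comp f g x a b : is_derive (g x) 1 f a -> is_derive x 1 g b ->
  is_derive x 1 (fun y => f (g y)) (a * b).
Proof. by move=> df dg; exact: (is_derive1_comp df dg). Qed.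

Lemma drv_cos f x a : is_derive x 1 f a ->
  is_derive x 1 (fun y => cos (f y)) (- sin (f x) * a).
Proof. by apply: drv_comp; exact: is_derive_cos. Qed.

Lemma drv_sin f x a : is_derive x 1 f a ->
  is_derive x 1 (fun y => sin (f y)) (cos (f x) * a).
Proof. by apply: drv_comp; exact: is_derive_sin. Qed.

Lemma drv_eq f x a b : is_derive x 1 f a -> a = b -> is_derive x 1 f b.
Proof. exact: is_derive_eq. Qed.

Lemma drv_continuous f x a : is_derive x 1 f a -> {for x, continuous f}.
Proof.
by case=> df _; exact/differentiable_continuous/derivable1_diffP.
Qed.

Lemma drv_within f (f' : R -> R) a b :
  (forall x, a <= x <= b -> is_derive x 1 f (f' x)) ->
  {within `[a, b], continuous f}.
Proof.
move=> df; apply: derivable_within_continuous => x.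
by rewrite in_itv /= => /df [].
Qed.

(** The mean value theorem for [g - f]. Integral estimates below are obtained as comparisons of
    primitives through this lemma. *)
Lemma le_increment f g (f' g' : R -> R) a b : a <= b ->
  (forall x, a <= x <= b -> is_derive x 1 f (f' x)) ->
  (forall x, a <= x <= b -> is_derive x 1 g (g' x)) ->
  (forall x, a <= x <= b -> f' x <= g' x) -> f b - f a <= g b - g a.
Proof.
move=> ab df dg fg.
have dh x : a <= x <= b -> is_derive x 1 (fun y => g y - f y) (g' x - f' x).
  by move=> xab; apply: drvB; [exact: dg|exact: df].
have [||c cab e] := @MVT_segment _ (fun y => g y - f y) (fun x => g' x - f' x) a b ab.
- by move=> x; rewrite in_itv /= => /andP[/ltW ax /ltW xb]; apply: dh; rewrite ax.
- exact: (@drv_within _ (fun x => g' x - f' x)).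
have : 0 <= (g' c - f' c) * (b - a).
  by rewrite mulr_ge0 ?subr_ge0// fg//; move: cab; rewrite in_itv.
rewrite -e; lra.
Qed.

Lemma eq_increment f g (h : R -> R) a b : a <= b ->
  (forall x, a <= x <= b -> is_derive x 1 f (h x)) ->
  (forall x, a <= x <= b -> is_derive x 1 g (h x)) -> f b - f a = g b - g a.
Proof.
move=> ab df dg; apply/eqP; rewrite eq_le.
by rewrite (le_increment ab df dg) ?(le_increment ab dg df).
Qed.

End Calculus.

(** * Integrals of continuous functions over [0, pi] *)

Section Primitive.
Context {R : realType}.
Implicit Types (f g : R -> R) (c x : R).

(** The base point -1 lies to the left of 0, so that the derivative is two-sided on all of [0, pi],
    the endpoint 0 included. *)
Definition prim f (x : R) : R := \int[lebesgue_measure]_(t in `[-1, x]) f t.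

Lemma is_derive_prim f x : continuous f -> -1 < x -> is_derive x 1 (prim f) (f x).
Proof.
move=> cf x1.
have [] := @continuous_FTC1_closed R f (-1) x (x + 1) _ _ x1 (cf x).
- by rewrite ltrDl.
- apply: continuous_compact_integrable; first exact: segment_compact.
  exact: continuous_subspaceT.
by move=> dF; rewrite derive1E => eF; split.
Qed.

Definition ipi f : R := prim f pi - prim f 0.

Lemma ipi_prim f g : continuous f -> (forall x, 0 <= x <= pi -> is_derive x 1 g (f x)) ->
  ipi f = g pi - g 0.
Proof.
move=> cf dg; apply: (@eq_increment _ _ _ f) => //; first exact: pi_ge0.
by move=> x /andP[x0 _]; apply: is_derive_prim => //; lra.
Qed.

Lemma prim_drv f x : continuous f -> 0 <= x -> is_derive x 1 (prim f) (f x).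
Proof. by move=> cf x0; apply: is_derive_prim => //; lra. Qed.

Lemma ipiD f g : continuous f -> continuous g -> ipi (fun x => f x + g x) = ipi f + ipi g.
Proof.
move=> cf cg.
have cfg : continuous (fun x => f x + g x).
  by move=> x; apply: cvgD; [exact: cf|exact: cg].
have d x : 0 <= x <= pi -> is_derive x 1 (fun x => prim f x + prim g x) (f x + g x).
  by move=> /andP[x0 _]; apply: drvD; exact: prim_drv.
by rewrite (ipi_prim cfg d) /ipi; ring.
Qed.

Lemma ipiZ c f : continuous f -> ipi (fun x => c * f x) = c * ipi f.
Proof.
move=> cf.
have ccf : continuous (fun x => c * f x).
  by move=> x; apply: cvgM; [exact: cvg_cst|exact: cf].
have d x : 0 <= x <= pi -> is_derive x 1 (fun x => c * prim f x) (c * f x).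
  by move=> /andP[x0 _]; apply: drvZ; exact: prim_drv.
by rewrite (ipi_prim ccf d) /ipi; ring.
Qed.

Lemma ipiN f : continuous f -> ipi (fun x => - f x) = - ipi f.
Proof.
move=> cf; rewrite -mulN1r -ipiZ//; congr ipi; apply/funext => x; exact/esym/mulN1r.
Qed.

Lemma ipi_le f g : continuous f -> continuous g ->
  (forall x, 0 <= x <= pi -> f x <= g x) -> ipi f <= ipi g.
Proof.
move=> cf cg fg; apply: (@le_increment _ _ _ f g) => //; first exact: pi_ge0.
- by move=> x /andP[x0 _]; exact: prim_drv.
- by move=> x /andP[x0 _]; exact: prim_drv.
Qed.

Lemma ipi_cst c : ipi (fun=> c) = c * pi.
Proof.
have d x : 0 <= x <= pi -> is_derive x 1 (fun x => c * x) c.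
  by move=> _; apply: (drv_eq (drvZ _ (drvI x))); rewrite mulr1.
by rewrite (ipi_prim _ d) ?mulr0 ?subr0// => x; exact: cvg_cst.
Qed.

Lemma ipi_norm_le f c : continuous f -> (forall x, 0 <= x <= pi -> `|f x| <= c) ->
  `|ipi f| <= c * pi.
Proof.
move=> cf fc; rewrite ler_norml -mulNr -!ipi_cst !ipi_le// => x;
  try exact: cvg_cst.
- by move=> /fc; rewrite ler_norml => /andP[].
- by move=> /fc; rewrite ler_norml => /andP[].
Qed.

Lemma continuous_bigsum n (F : 'I_n -> R -> R) : (forall i, continuous (F i)) ->
  continuous (fun x => \sum_(i < n) F i x).
Proof.
elim: n F => [|n IH] F cF.
  by under eq_fun do rewrite big_ord0; move=> x; exact: cvg_cst.
under eq_fun do rewrite big_ord_recr /=.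
by move=> x; apply: cvgD; [exact: IH|exact: cF].
Qed.

Lemma ipi_sum n (F : 'I_n -> R -> R) : (forall i, continuous (F i)) ->
  ipi (fun x => \sum_(i < n) F i x) = \sum_(i < n) ipi (F i).
Proof.
elim: n F => [|n IH] F cF.
  under eq_fun do rewrite big_ord0.
  by rewrite big_ord0 ipi_cst mul0r.
under eq_fun do rewrite big_ord_recr /=.
by rewrite big_ord_recr /= ipiD ?IH//; exact: continuous_bigsum.
Qed.

End Primitive.

(** * Van der Corput's first and second derivative tests *)

Section VanDerCorput.
Context {R : realType}.
Implicit Types (J : R -> R) (a b r x t c d : R).

(** Instead of integrating by parts, [J] is compared with [g = (sin psi - 1) / psi']. Subtracting 1
    from the sine gives the correction term a sign, so that [g' >= cos psi], and [g] itself keeps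
    one sign and is at most [2 * r] in size. Only upper bounds are sought; lower ones follow by
    adding pi to the phase. *)
Lemma vdc_first J (psi psi' psi'' : R -> R) a b r : a <= b -> 0 < r ->
  (forall x, a <= x <= b -> is_derive x 1 J (cos (psi x))) ->
  (forall x, a <= x <= b -> is_derive x 1 psi (psi' x)) ->
  (forall x, a <= x <= b -> is_derive x 1 psi' (psi'' x)) ->
  (forall x, a <= x <= b -> 0 <= psi'' x) ->
  (forall x, a <= x <= b -> r^-1 <= psi' x) \/ (forall x, a <= x <= b -> psi' x <= - r^-1) ->
  J b - J a <= 2 * r.
Proof.
move=> ab r0 dJ dp dp' p0 pr.
have ir0 : 0 < r^-1 by rewrite invr_gt0.
have pN0 x : a <= x <= b -> psi' x != 0.
  by move=> xab; case: pr => /(_ x xab) h; apply/eqP; lra.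
pose g x := (sin (psi x) - 1) * (psi' x)^-1.
pose g' x := cos (psi x) - (sin (psi x) - 1) * psi'' x / psi' x ^+ 2.
have dg x : a <= x <= b -> is_derive x 1 g (g' x).
  move=> xab.
  apply: (drv_eq (drvM (drvB (drv_sin (dp x xab)) (drvC 1 x)) (drvV (pN0 x xab) (dp' x xab)))).
  by rewrite /g' subr0 mulfK ?pN0// mulNr mulrN -mulrA.
apply: (@le_trans _ _ (g b - g a)).
  apply: (@le_increment _ J g _ g') => // x xab.
  rewrite /g' lerBrDl -lerBrDr subrr mulr_le0_ge0 ?invr_ge0 ?sqr_ge0//.
  by rewrite mulr_le0_ge0 ?p0// subr_le0 sin_le1.
have sb (x : R) : -2 <= sin x - 1 <= 0.
  by have := sin_le1 x; have := sin_geN1 x; move=> ? ?; apply/andP; split; lra.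
have ia : a <= a <= b by rewrite lexx.
have ib : a <= b <= b by rewrite lexx andbT.
have bnd x : a <= x <= b -> `|(psi' x)^-1| <= r.
  move=> xab; rewrite normfV -[leRHS]invrK lef_pV2 ?posrE ?normr_gt0 ?pN0//.
  by case: pr => /(_ x xab) h; rewrite ler_normr; apply/orP; [left|right; lra].
case: pr => pr.
  have pos x : a <= x <= b -> 0 <= (psi' x)^-1.
    by move=> /pr h; rewrite invr_ge0 (le_trans _ h)// ltW.
  have ga : - (2 * r) <= g a.
    have := bnd a ia; rewrite ger0_norm ?pos// /g => h.
    have := sb (psi a); have := pos a ia => h0 /andP[h1 h2]; nra.
  have gb : g b <= 0.
    have := pos b ib; have /andP[] := sb (psi b); rewrite /g => h1 h2 h3; nra.
  lra.
have pos x : a <= x <= b -> (psi' x)^-1 <= 0.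
  by move=> /pr h; rewrite invr_le0; lra.
have ga : 0 <= g a.
  have := pos a ia; have /andP[] := sb (psi a); rewrite /g => h1 h2 h3; nra.
have gb : g b <= 2 * r.
  have := bnd b ib; rewrite ler0_norm ?pos// /g => h.
  have := sb (psi b); have := pos b ib => h0 /andP[h1 h2]; nra.
lra.
Qed.

Lemma cos_increment J (psi : R -> R) a b : a <= b ->
  (forall x, a <= x <= b -> is_derive x 1 J (cos (psi x))) -> J b - J a <= b - a.
Proof.
move=> ab dJ; apply: (@le_increment _ J id (cos \o psi) (cst 1)) => //= x _.
Qed.

Lemma sub_itv a b c d : a <= c -> d <= b -> forall x, c <= x <= d -> a <= x <= b.
Proof. by move=> ac db x /andP[cx xd]; rewrite (le_trans ac cx) (le_trans xd db). Qed.

Lemma slope_increment (psi' psi'' : R -> R) a b s : a <= b ->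
  (forall x, a <= x <= b -> is_derive x 1 psi' (psi'' x)) ->
  (forall x, a <= x <= b -> s <= psi'' x) -> s * (b - a) <= psi' b - psi' a.
Proof.
move=> ab dp p0; rewrite mulrBr.
apply: (@le_increment _ (fun x => s * x) psi' (fun=> s) psi'') => // x _.
by apply: (drv_eq (drvZ _ (drvI x))); rewrite mulr1.
Qed.

(** On [[a, a + r]] the cosine is at most 1, which costs [r]; beyond, [psi'] has grown to
    [r ^- 2 * r = r^-1] and the first derivative test costs [2 * r]. *)
Lemma vdc_left J (psi psi' psi'' : R -> R) a b r : a <= b -> 0 < r ->
  (forall x, a <= x <= b -> is_derive x 1 J (cos (psi x))) ->
  (forall x, a <= x <= b -> is_derive x 1 psi (psi' x)) ->
  (forall x, a <= x <= b -> is_derive x 1 psi' (psi'' x)) ->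
  (forall x, a <= x <= b -> r ^- 2 <= psi'' x) ->
  0 <= psi' a -> J b - J a <= 3 * r.
Proof.
move=> ab r0 dJ dp dp' p0 pa.
have [bar|/ltW arb] := leP b (a + r).
  by have := cos_increment ab dJ; lra.
have aar : a <= a + r by rewrite lerDl ltW.
have s1 := sub_itv (lexx a) arb; have s2 := sub_itv aar (lexx b).
have h1 := cos_increment aar (fun x h => dJ x (s1 x h)).
have h2 : J b - J (a + r) <= 2 * r.
  apply: (@vdc_first J psi psi' psi'') => //; try by move=> x /s2; eauto.
    by move=> x /s2 /p0; apply: le_trans; rewrite invr_ge0 sqr_ge0.
  left => x xab; have [ax xb] := andP (s2 x xab).
  have s3 := sub_itv (lexx a) xb.
  have := slope_increment ax (fun y h => dp' y (s3 y h)) (fun y h => p0 y (s3 y h)).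
  have : r ^- 2 * r <= r ^- 2 * (x - a).
    by rewrite ler_wpM2l ?invr_ge0 ?sqr_ge0//; case/andP: xab; lra.
  by rewrite expr2 invfM mulrVK ?unitfE ?gt_eqF//; lra.
lra.
Qed.

Lemma vdc_right J (psi psi' psi'' : R -> R) a b r : a <= b -> 0 < r ->
  (forall x, a <= x <= b -> is_derive x 1 J (cos (psi x))) ->
  (forall x, a <= x <= b -> is_derive x 1 psi (psi' x)) ->
  (forall x, a <= x <= b -> is_derive x 1 psi' (psi'' x)) ->
  (forall x, a <= x <= b -> r ^- 2 <= psi'' x) ->
  psi' b <= 0 -> J b - J a <= 3 * r.
Proof.
move=> ab r0 dJ dp dp' p0 pa.
have [bar|/ltW arb] := leP b (a + r).
  by have := cos_increment ab dJ; lra.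
have aar : b - r <= b by rewrite lerBlDl lerDr ltW.
have abr : a <= b - r by lra.
have s1 := sub_itv abr (lexx b); have s2 := sub_itv (lexx a) aar.
have h1 := cos_increment aar (fun x h => dJ x (s1 x h)).
have h2 : J (b - r) - J a <= 2 * r.
  apply: (@vdc_first J psi psi' psi'') => //; try by move=> x /s2; eauto.
    by move=> x /s2 /p0; apply: le_trans; rewrite invr_ge0 sqr_ge0.
  right => x xab; have [ax xb] := andP (s2 x xab).
  have s3 := sub_itv ax (lexx b).
  have := slope_increment xb (fun y h => dp' y (s3 y h)) (fun y h => p0 y (s3 y h)).
  have : r ^- 2 * r <= r ^- 2 * (b - x).
    by rewrite ler_wpM2l ?invr_ge0 ?sqr_ge0//; case/andP: xab; lra.
  by rewrite expr2 invfM mulrVK ?unitfE ?gt_eqF//; lra.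
lra.
Qed.

(** If [psi'] changes sign, the interval is split at its zero and each half costs [3 * r]. *)
Lemma vdc_second J (psi psi' psi'' : R -> R) a b r : a <= b -> 0 < r ->
  (forall x, a <= x <= b -> is_derive x 1 J (cos (psi x))) ->
  (forall x, a <= x <= b -> is_derive x 1 psi (psi' x)) ->
  (forall x, a <= x <= b -> is_derive x 1 psi' (psi'' x)) ->
  (forall x, a <= x <= b -> r ^- 2 <= psi'' x) -> J b - J a <= 6 * r.
Proof.
move=> ab r0 dJ dp dp' p0.
have [pa|/ltW pa] := leP 0 (psi' a).
  by have := vdc_left ab r0 dJ dp dp' p0 pa; lra.
have [pb|/ltW pb] := leP (psi' b) 0.
  by have := vdc_right ab r0 dJ dp dp' p0 pb; lra.
have [||z zab pz] := @IVT _ psi' a b 0 ab.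
- exact: (@drv_within _ _ psi'').
- by rewrite min_l ?(le_trans pa pb)// max_r ?(le_trans pa pb)// pa pb.
move: zab; rewrite in_itv /= => /andP[az zb].
have s1 := sub_itv (lexx a) zb; have s2 := sub_itv az (lexx b).
have h1 := vdc_right az r0 (fun x h => dJ x (s1 x h)) (fun x h => dp x (s1 x h))
  (fun x h => dp' x (s1 x h)) (fun x h => p0 x (s1 x h)).
have h2 := vdc_left zb r0 (fun x h => dJ x (s2 x h)) (fun x h => dp x (s2 x h))
  (fun x h => dp' x (s2 x h)) (fun x h => p0 x (s2 x h)).
by move: h1 h2; rewrite pz lexx => /(_ isT) h1 /(_ isT) h2; lra.
Qed.

Lemma vdc_secondN J (psi psi' psi'' : R -> R) a b r : a <= b -> 0 < r ->
  (forall x, a <= x <= b -> is_derive x 1 J (cos (psi x))) ->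
  (forall x, a <= x <= b -> is_derive x 1 psi (psi' x)) ->
  (forall x, a <= x <= b -> is_derive x 1 psi' (psi'' x)) ->
  (forall x, a <= x <= b -> psi'' x <= - r ^- 2) -> J b - J a <= 6 * r.
Proof.
move=> ab r0 dJ dp dp' p0.
apply: (@vdc_second J (fun x => - psi x) (fun x => - psi' x) (fun x => - psi'' x)) => //.
- by move=> x /dJ; rewrite cosN.
- by move=> x /dp; exact: drvN.
- by move=> x /dp'; exact: drvN.
- by move=> x /p0; rewrite lerNr.
Qed.

End VanDerCorput.

(** * Polynomial bounds for sine and cosine; the inflection point *)

Section TrigBounds.
Context {R : realType}.
Implicit Types (x : R).

Lemma sin_le x : 0 <= x -> sin x <= x.
Proof.
move=> x0.
suff : sin x - sin 0 <= x - 0 by rewrite sin0 !subr0.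
apply: (@le_increment _ sin (fun x => x) cos (fun=> 1)) => // y _; exact: cos_le1.
Qed.

Lemma cos_ge_quad x : 0 <= x -> 1 - x ^+ 2 / 2 <= cos x.
Proof.
move=> x0.
suff : - (x ^+ 2 / 2) - - (0 ^+ 2 / 2) <= cos x - cos 0.
  by rewrite cos0 expr0n/= mul0r oppr0 subr0; lra.
apply: (@le_increment _ (fun x => - (x ^+ 2 / 2)) cos (fun x => - x) (fun x => - sin x)) => // y.
- move=> _; apply: (drv_eq (drvN (drvM (drvM (drvI y) (drvI y)) (drvC 2^-1 y)))).
  by field.
- by move=> /andP[y0 _]; rewrite lerN2 sin_le.
Qed.

Lemma sin_ge_half x : 0 <= x <= 1 -> x / 2 <= sin x.
Proof.
move=> /andP[x0 x1].
suff : x * 2^-1 - 0 * 2^-1 <= sin x - sin 0 by rewrite sin0 mul0r !subr0.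
apply: (@le_increment _ (fun x => x * 2^-1) sin (fun=> 2^-1) cos) => // y.
- move=> _; apply: (drv_eq (drvM (drvI y) (drvC 2^-1 y))).
  by rewrite mulr0 addr0 mul1r.
- move=> /andP[y0 yx]; apply: le_trans (cos_ge_quad y0).
  by have : y <= 1 by [exact: le_trans yx x1]; move=> ?; nra.
Qed.

Lemma cos_le_quad x : 0 <= x <= 1 -> cos x <= 1 - x ^+ 2 / 4.
Proof.
move=> /andP[x0 x1].
suff : cos x - cos 0 <= - (x ^+ 2 / 4) - - (0 ^+ 2 / 4).
  by rewrite cos0 expr0n/= mul0r oppr0 subr0; lra.
apply: (@le_increment _ cos (fun x => - (x ^+ 2 / 4)) (fun x => - sin x) (fun x => - (x / 2))) => // y.
- move=> _; apply: (drv_eq (drvN (drvM (drvM (drvI y) (drvI y)) (drvC 4^-1 y)))).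
  by field.
- by move=> /andP[y0 yx]; rewrite lerN2 sin_ge_half// y0 (le_trans yx x1).
Qed.

Lemma cos_nincr x y : 0 <= x -> x <= y -> y <= pi -> cos y <= cos x.
Proof.
move=> x0 xy ypi.
suff : cos y - cos x <= (fun=> 0) y - (fun=> 0) x :> R by rewrite subrr subr_le0.
apply: (@le_increment _ cos (fun=> 0) (fun x => - sin x) (fun=> 0)) => // z.
by move=> /andP[xz zy]; rewrite oppr_le0 sin_ge0_pi// (le_trans x0 xz) (le_trans zy ypi).
Qed.

(* [c0] is the interior inflection point 2 pi / 3 of the dispersion relation. *)
Lemma inflection_point : exists c0 : R,
  [/\ pi / 2 + 4^-1 <= c0, c0 + 4^-1 <= pi,
      forall d x, 0 <= d <= 4^-1 -> pi / 2 <= x <= c0 - d -> d / 2 <= 1 + 2 * cos x &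
      forall d x, 0 <= d <= 4^-1 -> c0 + d <= x <= pi -> 1 + 2 * cos x <= - (d / 2)].
Proof.
have h12 : -1 <= - 2^-1 :> R by lra.
have h21 : - 2^-1 <= 1 :> R by lra.
exists (acos (- 2^-1)); set c0 := acos _.
have [/andP[c00 c0pi] cc0] := @acos_def R (- 2^-1) (introT andP (conj h12 h21)).
rewrite -/c0 in c00 c0pi cc0.
have s0 : 0 <= sin c0 by rewrite sin_ge0_pi// c00.
have ss : sin c0 ^+ 2 = 3 / 4 by rewrite sin2cos2 cc0; field.
have s34 : 3 / 4 <= sin c0 by rewrite leNgt; apply/negP => h; nra.
(* Here [sin (c0 - pi / 2) = 1 / 2], so [sin y <= y] keeps [c0] away from [pi / 2]. Below,
   [cos (pi - c0) = 1 / 2] keeps it away from [pi] in the same way. *)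
have p2 : pi / 2 + 2^-1 <= c0.
  have hp : pi / 2 <= c0.
    rewrite leNgt; apply/negP => h.
    have := @cos_nincr c0 (pi / 2) c00 (ltW h); rewrite cos_pihalf cc0 => h1.
    have p0 := @pi_gt0 R; have : (0 : R) <= - 2^-1 by apply: h1; lra.
    lra.
  have : cos (c0 - pi / 2 + pi / 2) = - sin (c0 - pi / 2) by rewrite cosDpihalf.
  rewrite subrK cc0 => /oppr_inj e.
  by have := @sin_le (c0 - pi / 2); rewrite -e subr_ge0 => /(_ hp); lra.
have p1 : c0 + 1 <= pi.
  have : 1 - (pi - c0) ^+ 2 / 2 <= cos (pi - c0) by apply: cos_ge_quad; rewrite subr_ge0.
  rewrite cosB cospi sinpi cc0 mul0r addr0 mulrNN mul1r => h.
  by rewrite leNgt; apply/negP => h'; nra.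
split; [lra|lra| |].
- move=> d x /andP[d0 d4] /andP[px xc].
  have x0 : 0 <= x by have := @pi_gt0 R; lra.
  have := @cos_nincr x (c0 - d) x0 xc; rewrite cosB cc0 => h.
  have {h} : - 2^-1 * cos d + sin c0 * sin d <= cos x by apply: h; lra.
  have := @sin_ge_half d; have := cos_le1 d => h1 h2.
  have {h2} : d / 2 <= sin d by apply: h2; lra.
  nra.
- move=> d x /andP[d0 d4] /andP[px xc].
  have := @cos_nincr (c0 + d) x; rewrite cosD cc0 => h.
  have {h} : cos x <= - 2^-1 * cos d - sin c0 * sin d by apply: h; lra.
  have := @sin_ge_half d; have := cos_ge_quad d0 => h1 h2.
  have {h2} : d / 2 <= sin d by apply: h2; lra.
  nra.
Qed.

End TrigBounds.

(** * The oscillatory integral with the dispersion relation as phase *)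

Section Dispersion.
Context {R : realType}.
Implicit Types (J : R -> R) (x y t c d : R).

Definition omega x : R := (2 - 2 * cos x) ^+ 2.
(** The constant [c] turns cosines into sines and changes signs, so that one upper bound covers all
    the integrals. *)
Definition phase x t c (y : R) : R := x * y + t * omega y + c.

Lemma continuous_omega : continuous omega.
Proof.
move=> y; have d : is_derive y 1 omega _ := drvM (drvB (drvC 2 y) (drvZ 2 (is_derive_cos y)))
  (drvB (drvC 2 y) (drvZ 2 (is_derive_cos y))).
exact: drv_continuous d.
Qed.

Lemma omega_ge0 y : 0 <= omega y. Proof. exact: sqr_ge0. Qed.

Lemma omega_le y : omega y <= 16.
Proof. by rewrite /omega; have := cos_le1 y; have := cos_geN1 y; nra. Qed.

Lemma omega_le_quartic y : 0 <= y -> omega y <= y ^+ 4.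
Proof.
move=> y0; have h1 := cos_ge_quad y0; have h2 := cos_le1 y.
rewrite /omega (_ : 4%N = (2 * 2)%N)// exprM.
by rewrite ler_sqr ?nnegrE ?sqr_ge0//; lra.
Qed.

Lemma drv_omega y : is_derive y 1 omega (8 * (1 - cos y) * sin y).
Proof.
apply: (drv_eq (drvM (drvB (drvC 2 y) (drvZ 2 (is_derive_cos y)))
  (drvB (drvC 2 y) (drvZ 2 (is_derive_cos y))))).
ring.
Qed.

Lemma drv_phase x t c y :
  is_derive y 1 (phase x t c) (x + t * (8 * (1 - cos y) * sin y)).
Proof.
apply: (drv_eq (drvD (drvD (drvZ x (drvI y)) (drvZ t (drv_omega y))) (drvC c y))).
ring.
Qed.

Lemma drv2_phase x t y :
  is_derive y 1 (fun y => x + t * (8 * (1 - cos y) * sin y))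
    (t * (8 * (1 - cos y) * (1 + 2 * cos y))).
Proof.
apply: (drv_eq (drvD (drvC x y) (drvZ t (drvM (drvZ 8 (drvB (drvC 1 y) (is_derive_cos y)))
  (is_derive_sin y))))).
transitivity (t * (8 * (sin y ^+ 2 + (1 - cos y) * cos y))); first by ring.
by rewrite sin2cos2; ring.
Qed.

(** Cut [0, pi] at [d], [pi / 2], [c0 - d] and [c0 + d]. The pieces at 0 and [c0] have lengths [d]
    and [2 * d]; on the other three the second derivative of the phase is at least
    [t * d ^+ 2 = d ^- 2] in size, so each costs [6 * d]. The total is 21. The scale [t^(-1/4)] is
    dictated by the point 0; at [c0] it is coarser than the natural [t^(-1/3)], at no loss to the
    result. *)
Lemma phase_increment J x t c d : 0 < d <= 4^-1 -> t * d ^+ 4 = 1 ->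
  (forall y, 0 <= y <= pi -> is_derive y 1 J (cos (phase x t c y))) ->
  J pi - J 0 <= 21 * d.
Proof.
move=> /andP[d0 d4] td dJ.
have t0 : 0 < t.
  rewrite ltNge; apply/negP => t0; have d40 : 0 <= d ^+ 4 by rewrite exprn_ge0 ?ltW.
  by have := mulr_le0_ge0 t0 d40; rewrite td; lra.
have td2 : t * d ^+ 2 = d ^- 2.
  have dN0 : d ^+ 2 != 0 by rewrite expf_neq0 ?gt_eqF.
  by apply: (mulIf dN0); rewrite mulVf// -mulrA -exprD.
have [c0 [c1 c2 hB hC]] := @inflection_point R.
have pi0 := @pi_gt0 R; have pi2 := @pi_ge2 R.
have dd : 0 <= d <= 4^-1 by rewrite ltW.
have piece a b : 0 <= a -> a <= b -> b <= pi ->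
    (forall y, a <= y <= b -> is_derive y 1 J (cos (phase x t c y))).
  by move=> a0 ab bpi y /andP[ay yb]; apply: dJ; rewrite (le_trans a0 ay) (le_trans yb bpi).
have drv1 a b : forall y, a <= y <= b -> is_derive y 1 (phase x t c) _ := fun y _ => drv_phase x t c y.
have drv2 a b : forall y, a <= y <= b -> is_derive y 1 _ _ := fun y _ => drv2_phase x t y.
have dle1 : 0 <= d <= 1 by apply/andP; split; lra.
have dpi : d <= pi / 2 by lra.
have dc0 : pi / 2 <= c0 - d by lra.
have c0d : c0 - d <= c0 + d by lra.
have c0pi : c0 + d <= pi by lra.
have pos0 : 0 <= d by lra.
have pc : 0 <= (pi : R) / 2 by lra.
have posc : 0 <= c0 - d by lra.
have posc' : 0 <= c0 + d by lra.
have dpi1 : d <= pi by lra.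
have ppi : (pi : R) / 2 <= pi by lra.
have cdpi : c0 - d <= pi by lra.
have I1 : J d - J 0 <= d - 0 := cos_increment pos0 (piece 0 d (lexx 0) pos0 dpi1).
have I2 : J (pi / 2) - J d <= 6 * d.
  apply: (vdc_second dpi d0 (piece d (pi / 2) pos0 dpi ppi) (drv1 _ _) (drv2 _ _)) => y /andP[dy yp].
  rewrite -td2 ler_pM2l//.
  have h1 : d ^+ 2 / 4 <= 1 - cos y.
    have := cos_le_quad dle1; have := @cos_nincr _ d y pos0 dy (le_trans yp ppi); lra.
  have h2 : 0 <= cos y by apply: cos_ge0_pihalf; rewrite yp andbT; lra.
  by have := sqr_ge0 d; nra.
have I3 : J (c0 - d) - J (pi / 2) <= 6 * d.
  apply: (vdc_second dc0 d0 (piece _ _ pc dc0 cdpi) (drv1 _ _) (drv2 _ _)) => y ycd.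
  rewrite -td2 ler_pM2l//; have h1 := hB d y dd ycd.
  have h2 : cos y <= 0.
    rewrite -(@cos_pihalf R); case/andP: ycd => py yc.
    by apply: cos_nincr => //; rewrite (le_trans yc cdpi).
  have : d ^+ 2 <= d by rewrite expr2 ler_piMr//; lra.
  nra.
have I4 : J (c0 + d) - J (c0 - d) <= (c0 + d) - (c0 - d).
  exact: (cos_increment c0d (piece _ _ posc c0d c0pi)).
have I5 : J pi - J (c0 + d) <= 6 * d.
  apply: (vdc_secondN c0pi d0 (piece _ _ posc' c0pi (lexx pi)) (drv1 _ _) (drv2 _ _)) => y ycd.
  rewrite -td2 -mulrN ler_pM2l//; have h1 := hC d y dd ycd.
  have h2 : cos y <= 0.
    rewrite -(@cos_pihalf R); case/andP: ycd => py yc.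
    by apply: cos_nincr => //; lra.
  have : d ^+ 2 <= d by rewrite expr2 ler_piMr//; lra.
  nra.
lra.
Qed.

(** The profile [|t|^(-1/4)] made finite at 0, because the discrete sums below contain diagonal
    terms. *)
Definition kap (t : R) : R := (1 + `|t|) `^ (- 4^-1).

Lemma powR4 (a : R) : 0 < a -> (a `^ (- 4^-1)) ^+ 4 = a^-1.
Proof.
move=> a0; rewrite -powR_mulrn ?powR_ge0// -powRrM mulNr mulVf// powR_inv1//.
exact: ltW.
Qed.

Lemma onep_gt0 t : 0 < 1 + `|t|.
Proof. by rewrite ltr_pwDl. Qed.

Lemma kap_gt0 t : 0 < kap t.
Proof. exact/powR_gt0/onep_gt0. Qed.

Lemma kap_ge0 t : 0 <= kap t. Proof. exact/ltW/kap_gt0. Qed.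

Lemma kap4 t : kap t ^+ 4 = (1 + `|t|)^-1.
Proof. exact/powR4/onep_gt0. Qed.

Lemma ler_X4 (a b : R) : 0 <= a -> 0 <= b -> a ^+ 4 <= b ^+ 4 -> a <= b.
Proof. by move=> a0 b0; rewrite ler_pXn2r. Qed.

Lemma continuous_cos_phase x t c : continuous (fun y => cos (phase x t c y)).
Proof. by move=> y; exact: drv_continuous (drv_cos (drv_phase x t c y)). Qed.

(** The threshold 256 is [4 ^ 4], which makes [d <= 1 / 4]; then [d <= 2 * kap t] turns 21 into 42.
    For smaller [t] the integral is at most [pi <= 4], while [kap t >= 1 / 5] because
    [1 + t <= 5 ^ 4]. *)
Lemma ipi_phase_le x t c : 0 <= t -> ipi (fun y => cos (phase x t c y)) <= 42 * kap t.
Proof.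
move=> t0; have cf := @continuous_cos_phase x t c.
have pi4 : pi <= 4 :> R by have := @pihalf_lt2 R; lra.
have [t256|t256] := leP 256 t.
  have tp : 0 < t by lra.
  pose d := t `^ (- 4^-1).
  have d0 : 0 < d by exact: powR_gt0.
  have d4 : d ^+ 4 = t^-1 by exact: powR4.
  have d14 : d <= 4^-1.
    apply: ler_X4; [exact: ltW|by []|rewrite d4 exprVn lef_pV2 ?posrE//].
    by rewrite -natrX.
  have dk : d <= 2 * kap t.
    apply: ler_X4; rewrite ?mulr_ge0 ?kap_ge0 ?(ltW d0)// exprMn d4 kap4 ger0_norm//.
    rewrite ler_pdivlMr ?ltr_pwDl// ler_pdivrMl//.
    by rewrite -natrX (_ : (2 ^ 4)%N = 16%N)//; lra.
  apply: (@le_trans _ _ (21 * d)); last lra.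
  apply: (@phase_increment _ x t c) => //; first by rewrite d0.
    by rewrite d4 divff ?gt_eqF.
  by move=> y /andP[y0 _]; exact: (prim_drv cf y0).
have k5 : 5^-1 <= kap t.
  apply: ler_X4 => //; first exact: kap_ge0.
  rewrite kap4 exprVn lef_pV2 ?posrE ?onep_gt0// ger0_norm//.
  have -> : (5 : R) ^+ 4 = 625 by ring.
  lra.
have kb : 4 <= 42 * kap t by lra.
apply: le_trans kb; apply: le_trans pi4.
have := @ipi_norm_le _ _ 1 cf (fun y _ => cos_max _).
by rewrite mul1r ler_norml => /andP[].
Qed.

Lemma phaseN x t c y : phase (- x) (- t) (- c) y = - phase x t c y.
Proof. by rewrite /phase; ring. Qed.

Lemma kapN t : kap (- t) = kap t. Proof. by rewrite /kap normrN. Qed.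

(** Negative times are reached by negating the whole phase, lower bounds by adding pi to it. *)
Lemma ipi_phase_norm x t c : `|ipi (fun y => cos (phase x t c y))| <= 42 * kap t.
Proof.
have aux x' t' c' : ipi (fun y => cos (phase x' t' c' y)) <= 42 * kap t'.
  have [t0|/ltW t0] := leP 0 t'; first exact: ipi_phase_le.
  rewrite -kapN (_ : (fun y => _) = (fun y => cos (phase (- x') (- t') (- c') y))).
    by apply: ipi_phase_le; rewrite oppr_ge0.
  by apply/funext => y; rewrite phaseN cosN.
rewrite ler_norml aux andbT lerNl.
have cf := @continuous_cos_phase x t c.
rewrite -ipiN// (_ : (fun y => _) = (fun y => cos (phase x t (c + pi) y))).
  exact: aux.
by apply/funext => y; rewrite /phase addrA cosDpi.
Qed.

End Dispersion.

(** * Derivatives from quadratic remainder bounds *)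

Section QuadraticRemainders.
Context {R : realType}.
Implicit Types (f : R -> R) (x y t h a c : R).

(** A quadratic remainder bound that is uniform in a parameter survives integration over it; this is
    how the kernel is differentiated in time under the integral sign. *)
Lemma drv_quad f t a c : (forall h, `|f (t + h) - f t - h * a| <= c * h ^+ 2) ->
  is_derive t 1 f a.
Proof.
move=> fc.
have c0 : 0 <= c by have := le_trans (normr_ge0 _) (fc 1); rewrite expr1n mulr1.
suff cv : h^-1 *: (f (h *: 1 + t) - f t) @[h --> 0^'] --> a.
  by split; [apply/cvg_ex; exists a|apply/cvg_lim].
apply/cvgrPdist_le => e e0; near=> h.
have hN0 : h != 0 by near: h; exact: nbhs_dnbhs_neq.
have he : `|h| < e / (c + 1) by near: h; apply: dnbhs0_lt; rewrite divr_gt0 ?ltr_wpDl.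
have -> : h *: 1 + t = t + h by rewrite /GRing.scale /= mulr1 addrC.
have -> : a - h^-1 *: (f (t + h) - f t) = - (h^-1 * (f (t + h) - f t - h * a)).
  by rewrite /GRing.scale /=; field.
rewrite normrN normrM normfV mulrC ler_pdivrMr ?normr_gt0//.
apply: le_trans (fc h) _; rewrite -(ger0_norm (sqr_ge0 h)) normrX.
move: he; rewrite ltr_pdivlMr ?ltr_wpDl// => he.
by have := normr_ge0 h; nra.
Unshelve. all: by end_near. Qed.

Lemma onem_cos_le h : 0 <= h -> 1 - cos h <= h.
Proof.
move=> h0; suff : - cos h - - cos 0 <= h - 0 by rewrite cos0; lra.
apply: (@le_increment _ (fun x => - cos x) (fun x => x) sin (fun=> 1)) => // y _.
  by apply: (drv_eq (drvN (is_derive_cos y))); rewrite opprK.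
Qed.

Lemma sin_quad h : `|sin h - h| <= h ^+ 2.
Proof.
have aux (y : R) : 0 <= y -> `|sin y - y| <= y ^+ 2.
  move=> y0; rewrite distrC ger0_norm ?subr_ge0 ?sin_le//.
  suff : (y - sin y) - (0 - sin 0) <= y ^+ 2 / 2 - 0 ^+ 2 / 2.
    by rewrite sin0 expr0n /= mul0r !subr0; have := sqr_ge0 y; lra.
  apply: (@le_increment _ (fun x => x - sin x) (fun x => x ^+ 2 / 2) (fun x => 1 - cos x) (fun x => x) 0 y) => // z.
    move=> _; apply: (drv_eq (drvM (drvM (drvI z) (drvI z)) (drvC 2^-1 z))).
    by rewrite /=; field.
  by move=> /andP[z0 _]; exact: onem_cos_le.
have [h0|/ltW h0] := leP 0 h; first exact: aux.
by have := aux (- h); rewrite sinN sqrrN -opprD normrN oppr_ge0 => /(_ h0).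
Qed.

Lemma cos_quad h : `|cos h - 1| <= h ^+ 2 / 2.
Proof.
rewrite distrC ger0_norm ?subr_ge0 ?cos_le1//.
rewrite -cos_norm -(ger0_norm (sqr_ge0 h)) normrX.
by have := cos_ge_quad (normr_ge0 h); lra.
Qed.

Lemma norm_comb2 (a b p q s1 s2 : R) : `|a| <= 1 -> `|b| <= 1 -> `|p| <= s1 -> `|q| <= s2 ->
  `|a * p + b * q| <= s1 + s2.
Proof.
move=> a1 b1 ps qs; apply: le_trans (ler_normD _ _) _; rewrite !normrM lerD//.
- by rewrite (le_trans (ler_wpM2r _ a1))// mul1r.
- by rewrite (le_trans (ler_wpM2r _ b1))// mul1r.
Qed.

Lemma cos_taylor x h : `|cos (x + h) - cos x + h * sin x| <= 2 * h ^+ 2.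
Proof.
have -> : cos (x + h) - cos x + h * sin x = cos x * (cos h - 1) + (- sin x) * (sin h - h).
  by rewrite cosD; ring.
apply: le_trans (norm_comb2 (cos_max x) _ (cos_quad h) (sin_quad h)) _.
  by rewrite normrN sin_max.
by have := sqr_ge0 h; lra.
Qed.

Lemma sin_taylor x h : `|sin (x + h) - sin x - h * cos x| <= 2 * h ^+ 2.
Proof.
have -> : sin (x + h) - sin x - h * cos x = sin x * (cos h - 1) + cos x * (sin h - h).
  by rewrite sinD; ring.
apply: le_trans (norm_comb2 (sin_max x) (cos_max x) (cos_quad h) (sin_quad h)) _.
by have := sqr_ge0 h; lra.
Qed.

End QuadraticRemainders.

(** * The kernel: size, decay in space, evolution equation *)

Section Kernel.
Context {R : realType}.
Implicit Types (t x y h : R) (n m : int).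

Definition gcc t n y : R := cos (n%:~R * y) * cos (t * omega y).
Definition gcs t n y : R := cos (n%:~R * y) * sin (t * omega y).
Definition kerA t n : R := ipi (gcc t n) / pi.
Definition kerB t n : R := ipi (gcs t n) / pi.

(* [kern t n] is the convolution kernel of [e^{-it Delta^2}]: the Fourier
   integral of the even function [e^{-it omega}], folded to [0, pi]. *)
Definition kern t n : R[i] := (kerA t n +i* (- kerB t n))%C.

Lemma drv_gcc t n y : is_derive y 1 (gcc t n)
  (- sin (n%:~R * y) * n%:~R * cos (t * omega y)
   - cos (n%:~R * y) * (sin (t * omega y) * (t * (8 * (1 - cos y) * sin y)))).
Proof.
apply: (drv_eq (drvM (drv_cos (drvZ n%:~R (drvI y))) (drv_cos (drvZ t (drv_omega y))))).
ring.
Qed.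

Lemma drv_gcs t n y : is_derive y 1 (gcs t n)
  (- sin (n%:~R * y) * n%:~R * sin (t * omega y)
   + cos (n%:~R * y) * (cos (t * omega y) * (t * (8 * (1 - cos y) * sin y)))).
Proof.
apply: (drv_eq (drvM (drv_cos (drvZ n%:~R (drvI y))) (drv_sin (drvZ t (drv_omega y))))).
ring.
Qed.

Lemma cont_gcc t n : continuous (gcc t n).
Proof. by move=> y; exact: drv_continuous (drv_gcc t n y). Qed.

Lemma cont_gcs t n : continuous (gcs t n).
Proof. by move=> y; exact: drv_continuous (drv_gcs t n y). Qed.

Lemma pi_neq0 : (pi : R) != 0. Proof. by rewrite gt_eqF ?pi_gt0. Qed.

Lemma ker_le_aux (I c : R) : 0 <= c -> `|I| <= 42 * c -> `|I / pi| <= 21 * c.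
Proof.
move=> c0 Ic; rewrite normrM normfV (ger0_norm (pi_ge0 R)) ler_pdivrMr ?pi_gt0//.
by have := @pi_ge2 R; nra.
Qed.

Lemma kerA_le t n : `|kerA t n| <= 21 * kap t.
Proof.
apply: ker_le_aux; first exact: kap_ge0.
rewrite (_ : gcc t n = fun y => 2^-1 * (cos (phase n%:~R t 0 y) + cos (phase (- n%:~R) t 0 y))).
  have c1 := @continuous_cos_phase R n%:~R t 0.
  have c2 := @continuous_cos_phase R (- n%:~R) t 0.
  rewrite ipiZ; last by move=> y; apply: cvgD; [exact: c1|exact: c2].
  rewrite ipiD// normrM ger0_norm// mulrC ler_pdivrMr//.
  have := ipi_phase_norm n%:~R t 0; have := ipi_phase_norm (- n%:~R) t 0 => h1 h2.
  by apply: le_trans (ler_normD _ _) _; lra.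
by apply/funext => y; rewrite /phase /gcc !addr0 mulNr !cosD sinN cosN; field.
Qed.

Lemma kerB_le t n : `|kerB t n| <= 21 * kap t.
Proof.
apply: ker_le_aux; first exact: kap_ge0.
rewrite (_ : gcs t n = fun y => 2^-1 * (cos (phase n%:~R t (- (pi / 2)) y)
                                        + cos (phase (- n%:~R) t (- (pi / 2)) y))).
  have c1 := @continuous_cos_phase R n%:~R t (- (pi / 2)).
  have c2 := @continuous_cos_phase R (- n%:~R) t (- (pi / 2)).
  rewrite ipiZ; last by move=> y; apply: cvgD; [exact: c1|exact: c2].
  rewrite ipiD// normrM ger0_norm// mulrC ler_pdivrMr//.
  have := ipi_phase_norm n%:~R t (- (pi / 2)); have := ipi_phase_norm (- n%:~R) t (- (pi / 2)) => h1 h2.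
  by apply: le_trans (ler_normD _ _) _; lra.
by apply/funext => y; rewrite /phase /gcs !cosBpihalf mulNr !sinD sinN cosN; field.
Qed.

(** One integration by parts, carried out by comparing the primitive with [G] plus or minus a linear
    function. The 1 bounds the boundary term at pi; the one at 0 vanishes. This decay in [n] later
    removes the boundary terms of the summation by parts. *)
Lemma ipi_decay (g g' : R -> R) (D : R) n : n != 0 ->
  (forall y, is_derive y 1 g (g' y)) -> (forall y, `|g y| <= 1) -> (forall y, `|g' y| <= D) ->
  `|ipi (fun y => cos (n%:~R * y) * g y)| <= (1 + D * pi) / `|n%:~R|.
Proof.
move=> n0 dg g1 gD; set nn : R := n%:~R.
have nN0 : nn != 0 by rewrite intr_eq0.
have np : 0 < `|nn| by rewrite normr_gt0.
pose f y := cos (nn * y) * g y.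
have cf : continuous f.
  move=> y; exact: drv_continuous (drvM (drv_cos (drvZ nn (drvI y))) (dg y)).
pose G y := sin (nn * y) * g y * nn^-1.
have dG y : is_derive y 1 G (f y + sin (nn * y) * g' y / nn).
  apply: (drv_eq (drvM (drvM (drv_sin (drvZ nn (drvI y))) (dg y)) (drvC nn^-1 y))).
  by rewrite /f; field.
have rem y : `|sin (nn * y) * g' y / nn| <= D / `|nn|.
  rewrite !normrM normfV ler_pM2r ?invr_gt0// (le_trans _ (gD y))// ler_piMl//.
  exact: sin_max.
have lin c y : is_derive y 1 (fun y : R => c * y) c.
  by apply: (drv_eq (drvZ c (drvI y))); rewrite mulr1.
have dp y : 0 <= y <= pi -> is_derive y 1 (prim f) (f y) by move=> /andP[y0 _]; exact: prim_drv.
have up : prim f pi - prim f 0 <= (G pi + D / `|nn| * pi) - (G 0 + D / `|nn| * 0).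
  apply: (le_increment (pi_ge0 R) dp (fun y _ => drvD (dG y) (lin _ y))) => y _.
  by have := rem y; rewrite ler_norml => /andP[]; lra.
have lo : (G pi - D / `|nn| * pi) - (G 0 - D / `|nn| * 0) <= prim f pi - prim f 0.
  apply: (le_increment (pi_ge0 R) (fun y _ => drvB (dG y) (lin _ y)) dp) => y _.
  by have := rem y; rewrite ler_norml => /andP[]; lra.
have G0 : G 0 = 0 by rewrite /G mulr0 sin0 !mul0r.
have Gpi : `|G pi| <= 1 / `|nn|.
  rewrite /G !normrM normfV ler_pM2r ?invr_gt0// -[leRHS]mulr1 ler_pM// ?sin_max//.
move: Gpi up lo; rewrite G0 !mulr0 !addr0 !subr0 ler_norml => /andP[h1 h2] h3 h4.
rewrite /ipi ler_norml mulrDl mulrAC; apply/andP; split; lra.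
Qed.

Lemma omega'_le y : `|8 * (1 - cos y) * sin y| <= 16 :> R.
Proof.
rewrite !normrM (ger0_norm (_ : 0 <= 8))// (ger0_norm (_ : 0 <= 1 - cos y)) ?subr_ge0 ?cos_le1//.
have := sin_max y; have := cos_geN1 y; have := cos_le1 y; have := normr_ge0 (sin y) => h1 h2 h3 h4.
nra.
Qed.

Lemma ker_decay_aux t n I : n != 0 ->
  `|I| <= (1 + 16 * `|t| * pi) / `|n%:~R : R| -> `|I / pi| <= (1 + 16 * `|t|) / `|n%:~R|.
Proof.
move=> n0 h; rewrite normrM normfV (ger0_norm (pi_ge0 R)) ler_pdivrMr ?pi_gt0//.
apply: le_trans h _; rewrite [leRHS]mulrAC ler_pM2r ?invr_gt0 ?normr_gt0 ?intr_eq0//.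
by have := @pi_ge2 R; have := normr_ge0 t; nra.
Qed.

Lemma norm_ctw (c t w : R) : `|c| <= 1 -> `|w| <= 16 -> `|c * (t * w)| <= 16 * `|t|.
Proof.
move=> c1 w16; rewrite !normrM; have t0 := normr_ge0 t.
apply: (@le_trans _ _ (1 * (`|t| * `|w|))); first by rewrite ler_wpM2r ?mulr_ge0.
by rewrite mul1r mulrC ler_wpM2r.
Qed.

Lemma kerA_decay t n : n != 0 -> `|kerA t n| <= (1 + 16 * `|t|) / `|n%:~R|.
Proof.
move=> n0; apply: ker_decay_aux => //.
apply: (@ipi_decay (fun y => cos (t * omega y))
  (fun y => - sin (t * omega y) * (t * (8 * (1 - cos y) * sin y)))) => // y.
- by apply: drv_cos; apply: drvZ; exact: drv_omega.
- exact: cos_max.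
- by apply: norm_ctw; [rewrite normrN sin_max|exact: omega'_le].
Qed.

Lemma kerB_decay t n : n != 0 -> `|kerB t n| <= (1 + 16 * `|t|) / `|n%:~R|.
Proof.
move=> n0; apply: ker_decay_aux => //.
apply: (@ipi_decay (fun y => sin (t * omega y))
  (fun y => cos (t * omega y) * (t * (8 * (1 - cos y) * sin y)))) => // y.
- by apply: drv_sin; apply: drvZ; exact: drv_omega.
- exact: sin_max.
- by apply: norm_ctw; [exact: cos_max|exact: omega'_le].
Qed.

Lemma sin_natpi k : sin (k%:R * pi) = 0 :> R.
Proof.
elim: k => [|k IH]; first by rewrite mul0r sin0.
by rewrite -natr1 mulrDl mul1r sinDpi IH oppr0.
Qed.

Lemma sin_intpi n : sin (n%:~R * pi) = 0 :> R.
Proof.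
by case: n => k; [exact: sin_natpi|rewrite NegzE mulrNz mulNr sinN sin_natpi oppr0].
Qed.

Lemma kerA0 n : kerA 0 n = (n == 0)%:R.
Proof.
rewrite /kerA; have [->|n0] := eqVneq n 0.
  rewrite (_ : gcc 0 0 = fun=> 1); first by rewrite ipi_cst mul1r divff// pi_neq0.
  by apply/funext => y; rewrite /gcc !mul0r cos0 mulr1.
have nN0 : n%:~R != 0 :> R by rewrite intr_eq0.
rewrite (_ : gcc 0 n = fun y => cos (n%:~R * y)); last first.
  by apply/funext => y; rewrite /gcc mul0r cos0 mulr1.
have d (y : R) : 0 <= y <= pi -> is_derive y 1 (fun y => (n%:~R)^-1 * sin (n%:~R * y)) (cos (n%:~R * y)).
  by move=> _; apply: (drv_eq (drvZ (n%:~R)^-1 (drv_sin (drvZ n%:~R (drvI y))))); field.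
rewrite (ipi_prim _ d); last by move=> y; exact: drv_continuous (drv_cos (drvZ n%:~R (drvI y))).
by rewrite sin_intpi !mulr0 sin0 !mulr0 subrr mul0r.
Qed.

Lemma kerB0 n : kerB 0 n = 0.
Proof.
rewrite /kerB (_ : gcs 0 n = fun=> 0); first by rewrite ipi_cst !mul0r.
by apply/funext => y; rewrite /gcs mul0r sin0 mulr0.
Qed.

Lemma kerAN t n : kerA (- t) n = kerA t n.
Proof. by rewrite /kerA; congr (ipi _ / _); apply/funext => y; rewrite /gcc mulNr cosN. Qed.

Lemma kerBN t n : kerB (- t) n = - kerB t n.
Proof.
rewrite /kerB -mulNr -ipiN; last exact: cont_gcs.
by congr (ipi _ / _); apply/funext => y; rewrite /gcs mulNr sinN mulrN.
Qed.

Lemma ker_oppn t n : kern t (- n) = kern t n.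
Proof.
have e y : cos ((- n)%:~R * y) = cos (n%:~R * y) :> R by rewrite mulrNz mulNr cosN.
rewrite /kern /kerA /kerB; congr (_ +i* _)%C; [|congr (- _)]; congr (ipi _ / _); apply/funext => y;
  by rewrite /gcc /gcs e.
Qed.

Definition lap1 (f : int -> R) n : R := f (n + 1) + f (n - 1) - 2 * f n.

Lemma lap1_ipi (g : int -> R -> R) n : (forall m, continuous (g m)) ->
  lap1 (fun m => ipi (g m)) n = ipi (fun y => lap1 (fun m => g m y) n).
Proof.
move=> cg; rewrite /lap1 ipiD.
- rewrite ipiD; [|exact: cg|exact: cg].
  by rewrite (ipiN (f := fun y => 2 * g n y)) ?ipiZ// => y; apply: cvgM; [exact: cvg_cst|exact: cg].
- by move=> y; apply: cvgD; exact: cg.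
- by move=> y; apply: cvgN; apply: cvgM; [exact: cvg_cst|exact: cg].
Qed.

Lemma lap1_cos n y : lap1 (fun m => cos (m%:~R * y)) n = (2 * cos y - 2) * cos (n%:~R * y).
Proof. by rewrite /lap1 intrD intrB mulr1z mulrDl mulrBl mul1r cosD cosB; ring. Qed.

Lemma lap1Zr (f : int -> R) c n : lap1 (fun m => f m * c) n = lap1 f n * c.
Proof. by rewrite /lap1; ring. Qed.

(** Each discrete Laplacian multiplies [cos (m y)] by [2 * cos y - 2], so two of them produce the
    factor [omega y]. *)
Lemma lap2_cos_ipi (w : R -> R) n : continuous w ->
  lap1 (lap1 (fun m => ipi (fun y => cos (m%:~R * y) * w y) / pi)) n
  = ipi (fun y => omega y * (cos (n%:~R * y) * w y)) / pi.
Proof.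
move=> cw.
have cc m : continuous (fun y : R => cos (m%:~R * y)).
  by move=> y; exact: drv_continuous (drv_cos (drvZ m%:~R (drvI y))).
have cg m : continuous (fun y => cos (m%:~R * y) * w y).
  by move=> y; apply: cvgM; [exact: cc|exact: cw].
have cw2 : continuous (fun y => (2 * cos y - 2) * w y).
  move=> y; apply: cvgM; last exact: cw.
  exact: drv_continuous (drvB (drvZ 2 (is_derive_cos y)) (drvC 2 y)).
have step (v : R -> R) : continuous v -> (forall m, continuous (fun y => cos (m%:~R * y) * v y)) ->
    lap1 (fun m => ipi (fun y => cos (m%:~R * y) * v y) / pi)
    = (fun m => ipi (fun y => cos (m%:~R * y) * ((2 * cos y - 2) * v y)) / pi).
  move=> cv cg'; apply/funext => m; rewrite lap1Zr lap1_ipi//; congr (ipi _ / _).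
  by apply/funext => y; rewrite lap1Zr lap1_cos; ring.
rewrite step// step//; last by move=> m y; apply: cvgM; [exact: cc|exact: cw2].
by congr (ipi _ / _); apply/funext => y; rewrite /omega; ring.
Qed.

Lemma drv_ker_aux (g : R -> R -> R) (g' : R -> R) t (c : R) :
  (forall t, continuous (g t)) -> continuous g' -> 
  (forall h y, `|g (t + h) y - g t y - h * g' y| <= c * h ^+ 2) ->
  is_derive t 1 (fun t => ipi (g t) / pi) (ipi g' / pi).
Proof.
move=> cg cg' gc; apply: (@drv_quad _ _ _ _ c) => h.
have -> : ipi (g (t + h)) / pi - ipi (g t) / pi - h * (ipi g' / pi)
    = ipi (fun y => g (t + h) y + (- g t y + (- h) * g' y)) / pi.
  have chg : continuous (fun y => - h * g' y).
    by move=> y; apply: cvgM; [exact: cvg_cst|exact: cg'].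
  have cN : continuous (fun y => - g t y) by move=> y; apply: cvgN; exact: cg.
  have cS : continuous (fun y => - g t y + - h * g' y).
    by move=> y; apply: cvgD; [exact: cN|exact: chg].
  rewrite ipiD// ipiD// ipiN// ipiZ//; ring.
rewrite normrM normfV (ger0_norm (pi_ge0 R)) ler_pdivrMr ?pi_gt0//.
apply: ipi_norm_le => [y|y _].
  apply: cvgD; first exact: cg.
  by apply: cvgD; [apply: cvgN; exact: cg|apply: cvgM; [exact: cvg_cst|exact: cg']].
by have := gc h y; rewrite mulNr addrA.
Qed.

(** The constant is [2 * 16 ^ 2], since [omega <= 16]; it does not depend on [y], as [drv_ker_aux]
    requires. *)
Lemma taylor_omega_le h y (r c : R) : `|c| <= 1 -> `|r| <= 2 * (h * omega y) ^+ 2 ->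
  `|c * r| <= 512 * h ^+ 2.
Proof.
move=> c1 hr; rewrite normrM; apply: le_trans (ler_wpM2r (normr_ge0 _) c1) _.
rewrite mul1r; apply: le_trans hr _; rewrite exprMn.
have := omega_ge0 y; have := omega_le y; have := sqr_ge0 h => h0 h1 h2.
have : omega y ^+ 2 <= 256 by nra.
by nra.
Qed.

Lemma drv_kerA t n : is_derive t 1 (kerA ^~ n) (- lap1 (lap1 (kerB t)) n).
Proof.
have cw : continuous (fun y => sin (t * omega y)).
  by move=> y; exact: drv_continuous (drv_sin (drvZ t (drv_omega y))).
have cg' : continuous (fun y => omega y * (cos (n%:~R * y) * sin (t * omega y))).
  by move=> y; apply: cvgM; [exact: continuous_omega|exact: cont_gcs].
rewrite /kerB (lap2_cos_ipi n cw) -mulNr -ipiN//.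
apply: (@drv_ker_aux (fun t => gcc t n) _ t 512); first by move=> ?; exact: cont_gcc.
  by move=> y; apply: cvgN; exact: cg'.
move=> h y; rewrite (_ : _ - _ = cos (n%:~R * y) *
    (cos (t * omega y + h * omega y) - cos (t * omega y) + h * omega y * sin (t * omega y))).
  by apply: (@taylor_omega_le h y); [exact: cos_max|exact: cos_taylor].
by rewrite /gcc -mulrDl; ring.
Qed.

Lemma drv_kerB t n : is_derive t 1 (kerB ^~ n) (lap1 (lap1 (kerA t)) n).
Proof.
have cw : continuous (fun y => cos (t * omega y)).
  by move=> y; exact: drv_continuous (drv_cos (drvZ t (drv_omega y))).
have cg' : continuous (fun y => omega y * (cos (n%:~R * y) * cos (t * omega y))).
  by move=> y; apply: cvgM; [exact: continuous_omega|exact: cont_gcc].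
rewrite /kerA (lap2_cos_ipi n cw).
apply: (@drv_ker_aux (fun t => gcs t n) _ t 512) => //; first by move=> ?; exact: cont_gcs.
move=> h y; rewrite (_ : _ - _ = cos (n%:~R * y) *
    (sin (t * omega y + h * omega y) - sin (t * omega y) - h * omega y * cos (t * omega y))).
  by apply: (@taylor_omega_le h y); [exact: cos_max|exact: sin_taylor].
by rewrite /gcs -mulrDl; ring.
Qed.

End Kernel.

(** * Modulus and derivative of complex-valued functions *)

Section ComplexNorm.
Context {R : realType}.
Local Notation C := R[i].
Local Notation Re := complex.Re.
Local Notation Im := complex.Im.
Local Notation nc := ComplexField.Normc.normc.
Implicit Types (x y z : C).

Lemma ReD x y : Re (x + y) = Re x + Re y. Proof. by case: x y => [a b] [c d]. Qed.
Lemma ImD x y : Im (x + y) = Im x + Im y. Proof. by case: x y => [a b] [c d]. Qed.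
Lemma ReN x : Re (- x) = - Re x. Proof. by case: x. Qed.
Lemma ImN x : Im (- x) = - Im x. Proof. by case: x. Qed.
Lemma ReM x y : Re (x * y) = Re x * Re y - Im x * Im y.
Proof. by case: x y => [a b] [c d]. Qed.
Lemma ImM x y : Im (x * y) = Re x * Im y + Im x * Re y.
Proof. by case: x y => [a b] [c d]. Qed.
Lemma ReiM z : Re ('i%C * z) = - Im z.
Proof. by rewrite ReM /= mul0r mul1r sub0r. Qed.
Lemma ImiM z : Im ('i%C * z) = Re z.
Proof. by rewrite ImM /= mul0r mul1r add0r. Qed.
Lemma Re_sum I (r : seq I) (F : I -> C) : Re (\sum_(i <- r) F i) = \sum_(i <- r) Re (F i).
Proof. by elim/big_rec2: _ => // i a b _ <-; rewrite ReD. Qed.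
Lemma Im_sum I (r : seq I) (F : I -> C) : Im (\sum_(i <- r) F i) = \sum_(i <- r) Im (F i).
Proof. by elim/big_rec2: _ => // i a b _ <-; rewrite ImD. Qed.
Lemma eqC x y : Re x = Re y -> Im x = Im y -> x = y.
Proof. by case: x y => [a b] [c d] /= -> ->. Qed.

Lemma nc_ge0 x : 0 <= nc x. Proof. by case: x => a b; exact: sqrtr_ge0. Qed.
Lemma ncD x y : nc (x + y) <= nc x + nc y. Proof. exact: le_normcD. Qed.
Lemma ncN x : nc (- x) = nc x. Proof. exact: normcN. Qed.
Lemma ncB x y : nc (x - y) <= nc x + nc y. Proof. by rewrite -(ncN y); exact: ncD. Qed.
Lemma ncM x y : nc (x * y) = nc x * nc y. Proof. exact: ComplexField.Normc.normcM. Qed.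
Lemma nc_sqr x : nc x ^+ 2 = Re x ^+ 2 + Im x ^+ 2.
Proof. by case: x => a b /=; rewrite sqr_sqrtr// addr_ge0 ?sqr_ge0. Qed.
Lemma nc0 : nc (0 : C) = 0. Proof. exact: ComplexField.Normc.normc0. Qed.
Lemma nc_eq0 x : nc x = 0 -> x = 0. Proof. exact: ComplexField.Normc.eq0_normc. Qed.
Lemma nci : nc ('i%C : C) = 1.
Proof. by rewrite /= expr0n /= expr1n add0r sqrtr1. Qed.
Lemma nc_real (a : R) : nc (a%:C)%C = `|a|.
Proof. by rewrite /= expr0n /= addr0 sqrtr_sqr. Qed.

Lemma le_Re_nc x : `|Re x| <= nc x.
Proof.
rewrite -(ler_pXn2r (n := 2))// ?nnegrE ?nc_ge0// nc_sqr -normrX ger0_norm ?sqr_ge0//.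
by rewrite lerDl sqr_ge0.
Qed.

Lemma le_Im_nc x : `|Im x| <= nc x.
Proof.
rewrite -(ler_pXn2r (n := 2))// ?nnegrE ?nc_ge0// nc_sqr -normrX ger0_norm ?sqr_ge0//.
by rewrite lerDr sqr_ge0.
Qed.

Lemma nc_le_ReIm x : nc x <= `|Re x| + `|Im x|.
Proof.
rewrite -(ler_pXn2r (n := 2))// ?nnegrE ?nc_ge0 ?addr_ge0// nc_sqr sqrrD !real_normK ?num_real//.
by rewrite addrAC lerDl mulrn_wge0// mulr_ge0.
Qed.

Lemma nc_sum I (r : seq I) (F : I -> C) : nc (\sum_(i <- r) F i) <= \sum_(i <- r) nc (F i).
Proof.
elim/big_rec2: _ => [|i a b _ h]; first by rewrite nc0.
by apply: le_trans (ncD _ _) _; rewrite lerD2l.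
Qed.

Definition cdrv (f : R -> C) (t : R) (l : C) :=
  is_derive t 1 (fun s => Re (f s)) (Re l) /\ is_derive t 1 (fun s => Im (f s)) (Im l).

Lemma cdrvD f g t k l : cdrv f t k -> cdrv g t l -> cdrv (fun s => f s + g s) t (k + l).
Proof.
move=> [f1 f2] [g1 g2]; split.
- by rewrite ReD; under eq_fun do rewrite ReD; exact: drvD.
- by rewrite ImD; under eq_fun do rewrite ImD; exact: drvD.
Qed.

Lemma cdrvM f g t k l : cdrv f t k -> cdrv g t l ->
  cdrv (fun s => f s * g s) t (k * g t + f t * l).
Proof.
move=> [f1 f2] [g1 g2]; split.
- rewrite ReD !ReM; under eq_fun do rewrite ReM.
  by apply: (drv_eq (drvB (drvM f1 g1) (drvM f2 g2))); ring.
- rewrite ImD !ImM; under eq_fun do rewrite ImM.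
  by apply: (drv_eq (drvD (drvM f1 g2) (drvM f2 g1))); ring.
Qed.

Lemma cdrv_cst z t : cdrv (fun=> z) t 0.
Proof. by split; exact: drvC. Qed.

Lemma cdrvZ z f t l : cdrv f t l -> cdrv (fun s => z * f s) t (z * l).
Proof. by move=> df; have := cdrvM (cdrv_cst z t) df; rewrite mul0r add0r. Qed.

Lemma cdrv_sum I (r : seq I) (F : I -> R -> C) (L : I -> C) t :
  (forall i, cdrv (F i) t (L i)) -> cdrv (fun s => \sum_(i <- r) F i s) t (\sum_(i <- r) L i).
Proof.
move=> d; elim: r => [|i r IH].
  by rewrite big_nil; under eq_fun do rewrite big_nil; exact: cdrv_cst.
by rewrite big_cons; under eq_fun do rewrite big_cons; exact: cdrvD.
Qed.

Lemma cdrv_affine f (a b t : R) l : cdrv f (a + b * t) l ->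
  cdrv (fun s => f (a + b * s)) t (b%:C%C * l).
Proof.
have dl : is_derive t 1 (fun s => a + b * s) b.
  by apply: (drv_eq (drvD (drvC a t) (drvZ b (drvI t)))); rewrite add0r mulr1.
move=> [f1 f2]; split.
- by rewrite ReM /= mul0r subr0; apply: (drv_eq (@drv_comp _ (fun s => Re (f s)) (fun s => a + b * s) _ _ _ f1 dl)); rewrite mulrC.
- by rewrite ImM /= mul0r addr0; apply: (drv_eq (@drv_comp _ (fun s => Im (f s)) (fun s => a + b * s) _ _ _ f2 dl)); rewrite mulrC.
Qed.

Lemma cdrv_eq f t k l : cdrv f t k -> k = l -> cdrv f t l.
Proof. by move=> d <-. Qed.

Lemma increment_norm (f f' : R -> R) (a b M : R) : a <= b ->
  (forall s, a <= s <= b -> is_derive s 1 f (f' s)) ->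
  (forall s, a <= s <= b -> `|f' s| <= M) -> `|f b - f a| <= M * (b - a).
Proof.
move=> ab df fM.
have lin (c s : R) : is_derive s 1 (fun y : R => c * y) c.
  by apply: (drv_eq (drvZ c (drvI s))); rewrite mulr1.
rewrite ler_norml; apply/andP; split.
  rewrite -mulNr mulrBr; apply: (le_increment ab (fun s _ => lin (- M) s) df) => s sab.
  by have := fM s sab; rewrite ler_norml => /andP[].
rewrite mulrBr; apply: (le_increment ab df (fun s _ => lin M s)) => s sab.
by have := fM s sab; rewrite ler_norml => /andP[].
Qed.

(** The factor 2 comes from applying the mean value theorem to real and imaginary parts
    separately. *)
Lemma cincrement_norm (f f' : R -> C) (a b M : R) : a <= b ->
  (forall s, a <= s <= b -> cdrv f s (f' s)) ->
  (forall s, a <= s <= b -> nc (f' s) <= M) -> nc (f b - f a) <= 2 * M * (b - a).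
Proof.
move=> ab df fM; apply: le_trans (nc_le_ReIm _) _.
rewrite ReD ImD ReN ImN.
have h1 := increment_norm ab (fun s h => (df s h).1) (fun s h => le_trans (le_Re_nc _) (fM s h)).
have h2 := increment_norm ab (fun s h => (df s h).2) (fun s h => le_trans (le_Im_nc _) (fM s h)).
by move: h1 h2 => /=; lra.
Qed.

Lemma cincrement_norm_sym (f f' : R -> C) (T M : R) :
  (forall s, `|s| <= `|T| -> cdrv f s (f' s)) ->
  (forall s, `|s| <= `|T| -> nc (f' s) <= M) -> nc (f T - f 0) <= 2 * M * `|T|.
Proof.
move=> df fM; have [T0|/ltW T0] := leP 0 T.
  rewrite ger0_norm// -[X in _ * X]subr0.
  have sb s : 0 <= s <= T -> `|s| <= `|T| by move=> /andP[s0 sT]; rewrite !ger0_norm.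
  by apply: cincrement_norm => // s /sb; [exact: df|exact: fM].
rewrite ler0_norm// -[X in _ * X]sub0r -ncN opprB.
have sb s : T <= s <= 0 -> `|s| <= `|T| by move=> /andP[s0 sT]; rewrite !ler0_norm// lerN2.
by apply: cincrement_norm => // s /sb; [exact: df|exact: fM].
Qed.

End ComplexNorm.

Notation nc := ComplexField.Normc.normc.

(** * Green's summation by parts for the bilaplacian *)

Section Green.
Context {R : realType}.
Local Notation C := R[i].
Implicit Types (u v : int -> C) (n m : int) (N : nat).

Lemma bilap_kern (t : R) n :
  bilaplacian (kern t) n = (lap1 (lap1 (kerA t)) n +i* (- lap1 (lap1 (kerB t)) n))%C.
Proof.
rewrite /bilaplacian /discrete_laplacian.
apply: eqC; rewrite !mulr2n !(ReD, ReN, ImD, ImN) /= /lap1; ring.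
Qed.

Lemma cdrv_kern (t : R) n : cdrv (kern ^~ n) t (- ('i%C * bilaplacian (kern t) n)).
Proof.
rewrite bilap_kern; split.
  by rewrite ReN ReiM /= opprK; exact: drv_kerA.
by rewrite ImN ImiM /=; apply: drvN; exact: drv_kerB.
Qed.

Lemma kern0 n : kern (0 : R) n = (n == 0)%:R.
Proof. by rewrite /kern kerA0 kerB0 oppr0; case: (n == 0). Qed.

Lemma kern_le (t : R) n : nc (kern t n) <= 42 * kap t.
Proof.
apply: le_trans (nc_le_ReIm _) _; rewrite /= normrN.
by have := kerA_le t n; have := kerB_le t n; lra.
Qed.

Lemma kap_le1 (t : R) : kap t <= 1.
Proof.
apply: ler_X4 => //; first exact: kap_ge0.
by rewrite kap4 expr1n invf_le1 ?lerDl// onep_gt0.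
Qed.

Lemma kern_le42 (t : R) n : nc (kern t n) <= 42.
Proof. by have := kern_le t n; have := kap_le1 t; lra. Qed.

Lemma kern_decay (t : R) n : n != 0 -> nc (kern t n) <= 2 * (1 + 16 * `|t|) / `|n%:~R|.
Proof.
move=> n0; apply: le_trans (nc_le_ReIm _) _; rewrite /= normrN.
by have := kerA_decay t n0; have := kerB_decay t n0; lra.
Qed.

Lemma kernN (t : R) n : kern (- t) n = ((kern t n)^*)%C.
Proof. by rewrite /kern kerAN kerBN. Qed.

Definition wsum (V : nmodType) N (f : int -> V) : V :=
  \sum_(k < N.*2.+1) f (k%:Z - N%:Z).

(** The flux in Green's identity, a discrete Wronskian of fourth order. The bilaplacian has the
    coefficients 1, -4, 6, -4, 1; the 6 cancels by antisymmetry, the -4 needs one difference to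
    telescope, and the outer 1 needs two, whence the last two terms. *)
Definition green u v n : C :=
  - 4 * (u n * v (n + 1) - v n * u (n + 1))
  + (u n * v (n + 1 + 1) - v n * u (n + 1 + 1))
  + (u (n - 1) * v (n + 1) - v (n - 1) * u (n + 1)).

Lemma green_step u v n :
  u n * bilaplacian v n - v n * bilaplacian u n = green u v n - green u v (n - 1).
Proof.
rewrite /green /bilaplacian /discrete_laplacian !addrK ?subrK.
ring.
Qed.

Lemma wsum_telescope (V : zmodType) N (h : int -> V) :
  wsum N (fun n => h n - h (n - 1)) = h N%:Z - h (- N%:Z - 1).
Proof.
rewrite /wsum -(big_mkord xpredT (fun k => h (k%:Z - N%:Z) - h (k%:Z - N%:Z - 1))).
rewrite (eq_bigr (fun k => h (k.+1%:Z - N%:Z - 1) - h (k%:Z - N%:Z - 1))); last first.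
  by move=> k _; congr (h _ - _); lia.
rewrite telescope_sumr//; congr (h _ - h _); lia.
Qed.

Lemma green_le u v n (a b : R) : 0 <= a ->
  (forall m, nc (u m) <= a) -> (forall m, n - 1 <= m <= n + 1 + 1 -> nc (v m) <= b) ->
  nc (green u v n) <= 12 * (a * b).
Proof.
move=> a0 ua vb.
have uv m m' : n - 1 <= m <= n + 1 + 1 -> nc (u m' * v m) <= a * b.
  by move=> h; rewrite ncM ler_pM ?nc_ge0 ?vb.
have vu m m' : n - 1 <= m <= n + 1 + 1 -> nc (v m * u m') <= a * b.
  by move=> h; rewrite mulrC uv.
have df (p q : C) (c : R) : nc p <= c -> nc q <= c -> nc (p - q) <= 2 * c.
  by move=> pc qc; apply: le_trans (ncB _ _) _; lra.
rewrite /green; apply: le_trans (ncD _ _) _.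
have i1 : n - 1 <= n + 1 <= n + 1 + 1 by apply/andP; split; lia.
have i2 : n - 1 <= n <= n + 1 + 1 by apply/andP; split; lia.
have i3 : n - 1 <= n + 1 + 1 <= n + 1 + 1 by apply/andP; split; lia.
have i4 : n - 1 <= n - 1 <= n + 1 + 1 by apply/andP; split; lia.
have := df _ _ _ (uv _ (n - 1) i1) (vu _ (n + 1) i4).
have := ncD (- 4 * (u n * v (n + 1) - v n * u (n + 1))) (u n * v (n + 1 + 1) - v n * u (n + 1 + 1)).
have := df _ _ _ (uv _ n i3) (vu _ (n + 1 + 1) i2).
have := df _ _ _ (uv _ n i1) (vu _ (n + 1) i2).
have n4 : nc (- 4 : C) = 4 by rewrite ncN normcMn ComplexField.Normc.normc1.
rewrite [nc (- 4 * _)]ncM n4; lra.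
Qed.

End Green.

(** * Pairing a solution with the kernel run backwards in time *)

Section Pairing.
Context {R : realType}.
Local Notation C := R[i].
Implicit Types (u F : R -> int -> C) (n m x : int) (N : nat) (s T a e : R).

Lemma bilap_shift (phi : int -> C) x n :
  bilaplacian (fun m => phi (m - x)) n = bilaplacian phi (n - x).
Proof.
by rewrite /bilaplacian /discrete_laplacian; congr (phi _ + phi _ - phi _ *+ 2
  + (phi _ + phi _ - phi _ *+ 2) - (phi _ + phi _ - phi _ *+ 2) *+ 2); lia.
Qed.

Lemma cdrv_kern_rev T x n s :
  cdrv (fun s => kern (T - s) (n - x)) s
    ('i%C * bilaplacian (fun m => kern (T - s) (m - x)) n).
Proof.
have h := @cdrv_affine _ (kern ^~ (n - x)) T (-1) s.
have e r : T + -1 * r = T - r by rewrite mulN1r.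
have := h _ (cdrv_kern _ _); under eq_fun do rewrite e; rewrite e bilap_shift => d.
apply: (cdrv_eq d); rewrite (_ : ((-1)%:C)%C = -1 :> C); last by apply: eqC; rewrite ?ReN ?ImN //= oppr0.
by rewrite mulN1r opprK.
Qed.

Lemma cdrv_wsum N (f : R -> int -> C) (f' : int -> C) s :
  (forall n, cdrv (f ^~ n) s (f' n)) -> cdrv (fun s => wsum N (f s)) s (wsum N f').
Proof. by move=> d; apply: (@cdrv_sum _ 'I_(N.*2.+1) _ (fun k s => f s ((k : nat)%:Z - N%:Z))) => i. Qed.

Lemma wsumD (V : nmodType) N (f g : int -> V) :
  wsum N (fun n => f n + g n) = wsum N f + wsum N g.
Proof. exact: big_split. Qed.

Lemma wsumZ N (f : int -> C) (c : C) : wsum N (fun n => c * f n) = c * wsum N f.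
Proof. by rewrite /wsum mulr_sumr. Qed.

Definition boundary u T x s N : C :=
  green (u s) (fun m => kern (T - s) (m - x)) N%:Z
  - green (u s) (fun m => kern (T - s) (m - x)) (- N%:Z - 1).

Lemma cdrv_pairing u F T x N s :
  (forall n, cdrv (u ^~ n) s (- ('i%C * bilaplacian (u s) n) + 'i%C * F s n)) ->
  cdrv (fun s => wsum N (fun n => u s n * kern (T - s) (n - x))) s
    ('i%C * (wsum N (fun n => F s n * kern (T - s) (n - x)) + boundary u T x s N)).
Proof.
move=> du; apply: cdrv_eq.
  by apply: cdrv_wsum => n; apply: cdrvM; [exact: du|exact: cdrv_kern_rev].
rewrite /boundary -wsum_telescope -wsumD -wsumZ; congr wsum; apply/funext => n.
by rewrite -green_step; ring.
Qed.

Lemma boundary_small u T x (S a : R) : 0 <= a -> 0 <= S ->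
  (forall s n, `|s| <= S -> nc (u s n) <= a) ->
  forall e, 0 < e -> exists N0, forall N s, (N0 <= N)%N -> `|s| <= S -> nc (boundary u T x s N) <= e.
Proof.
move=> a0 S0 ua e e0.
pose M := 2 * (1 + 16 * (`|T| + S)).
have M0 : 0 <= M by rewrite mulr_ge0// addr_ge0// mulr_ge0// addr_ge0.
(* Each of the two fluxes is at most [12 * (a * (M / (q + 1)))] once the window reaches beyond [q]
   from [x]; this [q] makes it at most [e / 2]. *)
pose q := 24 * (a * M) / e.
have q0 : 0 <= q by rewrite mulr_ge0 ?invr_ge0 ?(ltW e0)// mulr_ge0// mulr_ge0.
exists ((Num.bound q).+1 + `|x|).+1%N => N s hN hs.
have kb m : (Num.bound q)%:Z + 1 <= `|m - x| -> nc (kern (T - s) (m - x)) <= M / (q + 1).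
  move=> hm; have mx : m - x != 0 by apply/eqP => h; move: hm; rewrite h normr0; lia.
  apply: le_trans (kern_decay _ mx) _.
  have p1 : 0 < q + 1 by rewrite ltr_wpDl.
  have lb : q + 1 <= `|(m - x)%:~R|.
    have := archi_boundP q0 => /ltW h; apply: (@le_trans _ _ ((Num.bound q)%:Z + 1)%:~R).
      by rewrite intrD mulr1z lerD2r.
    by rewrite -intr_norm ler_int.
  rewrite ler_pM ?invr_ge0 ?mulr_ge0 ?addr_ge0 ?mulr_ge0//.
    rewrite ler_pM2l// lerD2l ler_pM2l//; apply: le_trans (ler_normB _ _) _.
    by rewrite lerD2l.
  by rewrite lef_pV2 ?posrE// (lt_le_trans p1).
have hb : 12 * (a * (M / (q + 1))) <= e / 2.
  have p1 : 0 < q + 1 by rewrite ltr_wpDl.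
  rewrite mulrA mulrA ler_pdivrMr// mulrDr mulr1.
  have -> : e / 2 * q = 12 * a * M by rewrite /q; field; rewrite gt_eqF.
  by rewrite lerDl divr_ge0// ltW.
have g1 : nc (green (u s) (fun m => kern (T - s) (m - x)) N%:Z) <= e / 2.
  apply: le_trans hb; apply: green_le => // m; first exact: ua.
  by move=> hm; apply: kb; lia.
have g2 : nc (green (u s) (fun m => kern (T - s) (m - x)) (- N%:Z - 1)) <= e / 2.
  apply: le_trans hb; apply: green_le => // m; first exact: ua.
  by move=> hm; apply: kb; lia.
by apply: le_trans (ncB _ _) _; lra.
Qed.

Lemma wsum_delta N (f : int -> C) x : (`|x| <= N)%N -> wsum N (fun n => f n * (n - x == 0)%:R) = f x.
Proof.
move=> hx; rewrite /wsum.
have hk : (absz (x + N%:Z)%R < N.*2.+1)%N by lia.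
have ek : (absz (x + N%:Z)%R)%:Z - N%:Z = x by lia.
rewrite (bigD1 (Ordinal hk))//= ek subrr eqxx mulr1 big1 ?addr0// => i /eqP ne.
have -> : (i%:Z - N%:Z - x == 0) = false.
  by apply/negbTE/eqP => h; apply: ne; apply/val_inj => /=; lia.
by rewrite mulr0.
Qed.

Lemma wsum_norm_le N (f : int -> C) : nc (wsum N f) <= wsum N (fun n => nc (f n)).
Proof. exact: nc_sum. Qed.

Lemma ler_wsum N (f g : int -> R) : (forall n, f n <= g n) -> wsum N f <= wsum N g.
Proof. by move=> fg; apply: ler_sum => i _. Qed.

Lemma wsum_ge0 N (f : int -> R) : (forall n, 0 <= f n) -> 0 <= wsum N f.
Proof. by move=> f0; apply: sumr_ge0. Qed.

(** Integrate the pairing from 0 to [T]: at [s = T] the kernel is a point mass and picks out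
    [u T x], at [s = 0] it gives the free evolution of the data. The 84 is 42 from the kernel times
    2 from the complex increment. It serves twice, for the group law and for the truncated
    exponential series. *)
Lemma duhamel_smooth u F T x a D : 0 <= a -> 0 <= D ->
  (forall s n, cdrv (u ^~ n) s (- ('i%C * bilaplacian (u s) n) + 'i%C * F s n)) ->
  (forall s n, `|s| <= `|T| -> nc (u s n) <= a) ->
  (forall s N, `|s| <= `|T| -> wsum N (fun n => nc (F s n)) <= D) ->
  forall e, 0 < e -> exists N0, forall N, (N0 <= N)%N ->
    nc (u T x - wsum N (fun n => u 0 n * kern T (n - x))) <= 84 * D * `|T| + e.
Proof.
move=> a0 D0 du ua FD e e0.
have e'0 : 0 < e / (2 * (`|T| + 1)) by rewrite divr_gt0// mulr_gt0// ltr_wpDl.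
have [N0 hN0] := @boundary_small u T x _ a a0 (normr_ge0 T) ua _ e'0.
exists (maxn N0 `|x|%N) => N; rewrite geq_max => /andP[hN hx].
have := @cincrement_norm_sym _ (fun s => wsum N (fun n => u s n * kern (T - s) (n - x))) _ T
  (42 * D + e / (2 * (`|T| + 1))) (fun s _ => @cdrv_pairing u F T x N s (du s)).
rewrite subrr; under [X in wsum N X]eq_fun do rewrite kern0.
rewrite wsum_delta// subr0 => h; apply: (le_trans (h _)) => [s hs|].
  rewrite ncM nci mul1r; apply: le_trans (ncD _ _) _; rewrite lerD//; last exact: hN0.
  apply: le_trans (wsum_norm_le _ _) _.
  apply: (@le_trans _ _ (wsum N (fun n => 42 * nc (F s n)))).
    by apply: ler_wsum => n; rewrite ncM mulrC ler_wpM2r ?nc_ge0 ?kern_le42.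
  by rewrite /wsum -mulr_sumr ler_pM2l// FD.
have -> : 2 * (42 * D + e / (2 * (`|T| + 1))) * `|T|
   = 84 * D * `|T| + e * (`|T| / (`|T| + 1)).
  by field; rewrite gt_eqF// ltr_wpDl.
by rewrite lerD2l ler_piMr ?(ltW e0)// ler_pdivrMr ?ltr_wpDl// mul1r lerDl.
Qed.

(* The group law of the propagator; at [T = -a], [x = y] it is unitarity. *)
Lemma kern_group a T x y e : 0 < e -> exists N0, forall N, (N0 <= N)%N ->
  nc (kern (T + a) (x - y) - wsum N (fun n => kern a (n - y) * kern T (n - x))) <= e.
Proof.
move=> e0.
pose u s n : C := kern (s + a) (n - y).
have du s n : cdrv (u ^~ n) s (- ('i%C * bilaplacian (u s) n) + 'i%C * 0).
  have := @cdrv_affine _ (kern ^~ (n - y)) a 1 s.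
  have er r : a + 1 * r = r + a by rewrite mul1r addrC.
  move=> /(_ _ (cdrv_kern _ _)); under eq_fun do rewrite er; rewrite er /u bilap_shift => d.
  by apply: (cdrv_eq d); rewrite mulr0 addr0 (_ : (1%:C)%C = 1 :> C)// mul1r.
have [||s n _|s N _|N0 h] := @duhamel_smooth u (fun _ _ => 0) T x 42 0 _ _ du _ _ e e0 => //.
- exact: kern_le42.
- by rewrite /wsum big1// => i _; rewrite nc0.
exists N0 => N /h; rewrite /u mulr0 mul0r add0r add0r.
by [].
Qed.

End Pairing.

Notation nf phi := (fun n => nc (phi n)).

(** * The exponential series of the propagator and its kernel *)

Section Propagator.
Context {R : realType}.
Local Notation C := R[i].
Implicit Types (phi : int -> C) (n m x : int) (t s T P e : R) (k M : nat).

(** For nonnegative [f] this is the l^1 bound by [P], phrased with finite sums over distinct sites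
    so that estimates stay finite. *)
Definition sumle (f : int -> R) P := forall r : seq int, uniq r -> \sum_(n <- r) f n <= P.

Lemma sumle_ge0 f P : sumle f P -> 0 <= P.
Proof. by move=> /(_ [::] isT); rewrite big_nil. Qed.

Lemma sumle_le f P n : sumle f P -> f n <= P.
Proof. by move=> /(_ [:: n] isT); rewrite big_seq1. Qed.

Lemma wsum_seq (V : nmodType) N (f : int -> V) :
  wsum N f = \sum_(n <- [seq k%:Z - N%:Z | k <- iota 0 N.*2.+1]) f n.
Proof. by rewrite big_map /wsum -(big_mkord xpredT (fun k => f (k%:Z - N%:Z))) /index_iota subn0. Qed.

Lemma uniq_window N : uniq [seq k%:Z - N%:Z | k <- iota 0 N.*2.+1].
Proof. by rewrite map_inj_uniq ?iota_uniq// => i j; lia. Qed.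

Lemma sumle_wsum f P N : sumle f P -> wsum N f <= P.
Proof. by rewrite wsum_seq; apply; exact: uniq_window. Qed.

Lemma sumle_shift f P (g : int -> int) : injective g -> sumle f P -> sumle (f \o g) P.
Proof.
move=> gi fP r ur; rewrite -(big_map g xpredT f); apply: fP.
by rewrite map_inj_uniq.
Qed.

Lemma sumleD f g P Q : sumle f P -> sumle g Q -> sumle (fun n => f n + g n) (P + Q).
Proof. by move=> fP gQ r ur; rewrite big_split lerD ?fP ?gQ. Qed.

Lemma sumle_mono f g P : (forall n, f n <= g n) -> sumle g P -> sumle f P.
Proof. by move=> fg gP r ur; apply: le_trans (gP r ur); apply: ler_sum. Qed.

Lemma sumleZ f P c : 0 <= c -> sumle f P -> sumle (fun n => c * f n) (c * P).
Proof. by move=> c0 fP r ur; rewrite -mulr_sumr ler_wpM2l// fP. Qed.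

Lemma sumle_lap phi P : sumle (nf phi) P -> sumle (nf (discrete_laplacian phi)) (4 * P).
Proof.
move=> hP.
have i1 : injective (fun n : int => n + 1) by move=> a b; lia.
have i2 : injective (fun n : int => n - 1) by move=> a b; lia.
have -> : 4 * P = P + P + 2 * P by ring.
apply: sumle_mono (sumleD (sumleD (sumle_shift i1 hP) (sumle_shift i2 hP))
  (sumleZ (c := 2) _ hP)) => // n /=.
rewrite /discrete_laplacian; apply: le_trans (ncB _ _) _.
by rewrite normcMn mulr_natl lerD2r ncD.
Qed.

Lemma sumle_iter phi P k : sumle (nf phi) P ->
  sumle (nf (iter k (@bilaplacian R) phi)) (16 ^+ k * P).
Proof.
move=> hP; elim: k => [|k IH]; first by rewrite expr0 mul1r.
rewrite iterS exprS -mulrA (_ : 16 * (16 ^+ k * P) = 4 * (4 * (16 ^+ k * P))); last by ring.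
by rewrite /bilaplacian; do 2 apply: sumle_lap.
Qed.

Lemma cdrv_power s k :
  cdrv (fun s => (- ('i%C * s%:C%C)) ^+ k.+1 / (k.+1)`!%:R) s
    (- 'i%C * ((- ('i%C * s%:C%C)) ^+ k / k`!%:R) : C).
Proof.
have d1 r : cdrv (fun s => (- ('i%C * s%:C%C))) r (- 'i%C : C).
  split.
    have -> : (fun y : R => complex.Re (- ('i%C * y%:C%C))) = fun=> 0.
      by apply/funext => y; rewrite ReN ReM /=; ring.
    by rewrite ReN /= oppr0; exact: drvC.
  have -> : (fun y : R => complex.Im (- ('i%C * y%:C%C))) = fun y => - y.
    by apply/funext => y; rewrite ImN ImM /=; ring.
  by rewrite ImN /=; exact: drvN (drvI r).
have dk j r : cdrv (fun s => (- ('i%C * s%:C%C)) ^+ j.+1) r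
    (- 'i%C * ((- ('i%C * r%:C%C)) ^+ j *+ j.+1) : C).
  elim: j => [|j IH].
    by under eq_fun do rewrite expr1; rewrite expr0 mulr1n mulr1; exact: d1.
  under eq_fun do rewrite exprS; apply: (cdrv_eq (cdrvM (d1 r) IH)).
  by rewrite [in RHS]mulrS mulrDr; congr (_ + _); rewrite mulrCA; congr (_ * _); rewrite exprS mulrnAr.
have := cdrvM (dk k s) (cdrv_cst (k.+1)`!%:R^-1 s); rewrite mulr0 addr0 => d.
apply: (cdrv_eq d); rewrite factS natrM invfM -mulr_natr; field.
by rewrite nat1r !pnatr_eq0 -!lt0n fact_gt0.
Qed.

Definition partial_prop phi M s n : C := \sum_(k < M.+1) propagator_term s phi n k.

Lemma lap_lin (f g : int -> C) (c : C) n :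
  discrete_laplacian (fun m => f m + c * g m) n = discrete_laplacian f n + c * discrete_laplacian g n.
Proof. by rewrite /discrete_laplacian; ring. Qed.

Lemma bilap_lin (f g : int -> C) (c : C) n :
  bilaplacian (fun m => f m + c * g m) n = bilaplacian f n + c * bilaplacian g n.
Proof.
rewrite /bilaplacian -lap_lin; congr (discrete_laplacian _ n); apply/funext => m; exact: lap_lin.
Qed.

(** The bilaplacian of the last term kept. The series cut after the power [M] is an exact solution
    of the equation with this source, so [duhamel_smooth] applies; the source tends to 0 because of
    the factorial. *)
Definition last_source phi M s n : C :=
  (- ('i%C * s%:C%C)) ^+ M / M`!%:R * iter M.+1 (@bilaplacian R) phi n.

Lemma cdrv_partial phi M s n : cdrv (fun s => partial_prop phi M s n) s
  (- ('i%C * bilaplacian (partial_prop phi M s) n) + 'i%C * last_source phi M s n).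
Proof.
elim: M => [|M IH].
  rewrite /partial_prop; under eq_fun do rewrite big_ord1 /propagator_term expr0.
  apply: (cdrv_eq (cdrv_cst _ s)); rewrite /last_source expr0 fact0 divr1 mul1r /=.
  rewrite (_ : (fun m => _) = phi) ?addNr//.
  by apply/funext => m; rewrite big_ord1 /propagator_term expr0 fact0 divr1 mul1r.
have eP : partial_prop phi M.+1 = fun s n => partial_prop phi M s n
    + (- ('i%C * s%:C%C)) ^+ M.+1 / (M.+1)`!%:R * iter M.+1 (@bilaplacian R) phi n.
  by apply/funext => r; apply/funext => m; rewrite /partial_prop big_ord_recr.
rewrite eP bilap_lin.
apply: (cdrv_eq (cdrvD IH (cdrvM (cdrv_power s M) (cdrv_cst _ s)))).
by rewrite /last_source /=; ring.
Qed.

Lemma partial_prop0 phi M n : partial_prop phi M 0 n = phi n.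
Proof.
rewrite /partial_prop big_ord_recl big1 ?addr0 => [|i _].
  by rewrite /propagator_term expr0 fact0 divr1 mul1r.
by rewrite /propagator_term mulr0 oppr0 lift0 expr0n /= !mul0r.
Qed.

Lemma nc_natr k : nc (k%:R : C) = k%:R.
Proof. by rewrite normcMn ComplexField.Normc.normc1. Qed.

Lemma nc_exp (z : C) k : nc (z ^+ k) = nc z ^+ k.
Proof.
by elim: k => [|k IH]; rewrite ?expr0 ?ComplexField.Normc.normc1// !exprS ncM IH.
Qed.

Lemma nc_coef s k : nc ((- ('i%C * s%:C%C)) ^+ k / k`!%:R : C) = `|s| ^+ k / k`!%:R.
Proof.
by rewrite ncM ComplexField.Normc.normcV nc_natr nc_exp ncN ncM nci mul1r nc_real.
Qed.

Lemma nc_term phi P s n k : sumle (nf phi) P ->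
  nc (propagator_term s phi n k) <= (16 * `|s|) ^+ k / k`!%:R * P.
Proof.
move=> hP; rewrite ncM nc_coef exprMn.
have := sumle_le n (sumle_iter k hP) => /= h.
have c0 : 0 <= `|s| ^+ k / k`!%:R by rewrite divr_ge0// exprn_ge0.
by apply: le_trans (ler_wpM2l c0 h) _; rewrite le_eqVlt; apply/orP; left; apply/eqP; ring.
Qed.

Lemma nc_partial phi P M s n : sumle (nf phi) P ->
  nc (partial_prop phi M s n) <= \sum_(k < M.+1) (16 * `|s|) ^+ k / k`!%:R * P.
Proof.
by move=> hP; apply: le_trans (nc_sum _ _) _; apply: ler_sum => k _; exact: nc_term.
Qed.

Lemma nc_partial_bounded phi P M T : sumle (nf phi) P ->
  exists2 a : R, 0 <= a & forall s n, `|s| <= `|T| -> nc (partial_prop phi M s n) <= a.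
Proof.
move=> hP; have P0 := sumle_ge0 hP.
exists (\sum_(k < M.+1) (16 * `|T|) ^+ k / k`!%:R * P).
  by apply: sumr_ge0 => k _; rewrite mulr_ge0// divr_ge0// exprn_ge0// mulr_ge0.
move=> s n hs; apply: le_trans (nc_partial M s n hP) _; apply: ler_sum => k _.
rewrite ler_wpM2r// ler_wpM2r ?invr_ge0// lerXn2r ?nnegrE ?mulr_ge0//.
by rewrite ler_pM2l.
Qed.

Definition source_bound T P M : R := (16 * `|T|) ^+ M / M`!%:R * (16 * P).

Lemma source_bound_ge0 T P M : 0 <= P -> 0 <= source_bound T P M.
Proof. by move=> P0; rewrite mulr_ge0 ?mulr_ge0// divr_ge0// exprn_ge0// mulr_ge0. Qed.

Lemma last_source_le phi P M T s N : sumle (nf phi) P -> `|s| <= `|T| ->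
  wsum N (fun n => nc (last_source phi M s n)) <= source_bound T P M.
Proof.
move=> hP hs; have P0 := sumle_ge0 hP.
have := sumle_wsum N (sumle_iter M.+1 hP) => h.
have c0 : 0 <= `|s| ^+ M / M`!%:R by rewrite divr_ge0// exprn_ge0.
rewrite (_ : wsum N _ = `|s| ^+ M / M`!%:R *
    wsum N (fun n => nc (iter M.+1 (@bilaplacian R) phi n))); last first.
  by rewrite /wsum mulr_sumr; apply: eq_bigr => k _; rewrite ncM nc_coef.
apply: le_trans (ler_wpM2l c0 h) _.
have -> : `|s| ^+ M / M`!%:R * (16 ^+ M.+1 * P) = (16 * `|s|) ^+ M / M`!%:R * (16 * P).
  by rewrite exprMn exprS; ring.
rewrite ler_wpM2r ?mulr_ge0// ler_wpM2r ?invr_ge0// lerXn2r ?nnegrE ?mulr_ge0//.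
by rewrite ler_pM2l.
Qed.

Lemma partial_prop_kern phi P M T x e : sumle (nf phi) P -> 0 < e ->
  exists N0, forall N, (N0 <= N)%N ->
  nc (partial_prop phi M T x - wsum N (fun n => phi n * kern T (n - x)))
  <= 84 * source_bound T P M * `|T| + e.
Proof.
move=> hP e0; have [a a0 ha] := nc_partial_bounded M T hP.
have [N0 h] := @duhamel_smooth _ (partial_prop phi M) (last_source phi M) T x a _ a0
  (source_bound_ge0 T M (sumle_ge0 hP)) (fun s n => cdrv_partial phi M s n) ha
  (fun s N hs => last_source_le M N hP hs) e e0.
exists N0 => N /h; rewrite (_ : (fun n => partial_prop phi M 0 n * _) = (fun n => phi n * kern T (n - x)))//.
by apply/funext => n; rewrite partial_prop0.
Qed.

Lemma source_bound_cvg T P : source_bound T P M @[M --> \oo] --> 0.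
Proof.
rewrite -[X in _ --> X](mul0r (16 * P)); apply: cvgMl.
apply: cvg_series_cvg_0; exact: (is_cvg_series_exp_coeff (16 * `|T|)).
Qed.

(** [part] stands for [Re] and [Im], since [propagator] sums two real series. *)
Lemma is_cvg_propagator (part : C -> R) phi P t n : (forall z, `|part z| <= nc z) ->
  sumle (nf phi) P -> cvgn (series (fun k => part (propagator_term t phi n k))).
Proof.
move=> hpart hP; have P0 := sumle_ge0 hP.
apply: normed_cvg.
apply: (@series_le_cvg _ _ (fun k => (16 * `|t|) ^+ k / k`!%:R * P)) => [k|k|k|].
- exact: normr_ge0.
- by rewrite mulr_ge0// divr_ge0// exprn_ge0// mulr_ge0.
- by apply: le_trans (hpart _) _; exact: nc_term.
- rewrite (_ : (fun k => _) = (fun k => P * exp_coeff (16 * `|t|) k)); last first.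
    by apply/funext => k; rewrite /exp_coeff /= mulrC.
  apply: is_cvg_seriesZ; exact: is_cvg_series_exp_coeff.
Qed.

Lemma bound_cvg (u : R^nat) (e : R) : u @ \oo --> 0 -> 0 < e ->
  exists M0, forall M, (M0 <= M)%N -> `|u M| <= e.
Proof.
move=> u0 e0; have /cvgrPdist_le /(_ _ e0) [M0 _ h] := u0.
by exists M0 => M hM; have := h M hM; rewrite sub0r normrN.
Qed.

Lemma series_part_close (part : C -> R) phi P t n e : (forall z, `|part z| <= nc z) ->
  (forall r (F : nat -> C), part (\sum_(k <- r) F k) = \sum_(k <- r) part (F k)) ->
  sumle (nf phi) P -> 0 < e -> exists M0, forall M, (M0 <= M)%N ->
  `|limn (series (fun k => part (propagator_term t phi n k))) - part (partial_prop phi M t n)| <= e.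
Proof.
move=> hp hs hP e0; have cv := @is_cvg_propagator part phi P t n hp hP.
have /cvgrPdist_le /(_ _ e0) [M0 _ h] := cv.
exists M0 => M hM; have := h M.+1 (leq_trans hM (leqnSn M)).
rewrite /series /= big_mkord /partial_prop.
by rewrite -(big_mkord xpredT (fun k => propagator_term t phi n k)) hs big_mkord.
Qed.

(* All that is needed of the exponential series defining [propagator]: its sum
   is approximated by the kernel applied to a window of the data. *)
Lemma propagator_kern phi P t x e : sumle (nf phi) P -> 0 < e ->
  exists N0, forall N, (N0 <= N)%N ->
  nc (propagator t phi x - wsum N (fun n => phi n * kern t (n - x))) <= e.
Proof.
move=> hP e0; have e4 : 0 < e / 4 by rewrite divr_gt0.
have e84 : 0 < e / 4 / (84 * (`|t| + 1)) by rewrite divr_gt0// mulr_gt0// ltr_wpDl.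
have [M1 h1] := series_part_close t x le_Re_nc (fun r F => Re_sum r F) hP e4.
have [M2 h2] := series_part_close t x le_Im_nc (fun r F => Im_sum r F) hP e4.
have [M3 h3] := bound_cvg (source_bound_cvg t P) e84.
pose M := maxn M1 (maxn M2 M3).
have {}h1 := h1 M (leq_maxl _ _).
have {}h2 := h2 M (leq_trans (leq_maxl _ _) (leq_maxr _ _)).
have {}h3 := h3 M (leq_trans (leq_maxr _ _) (leq_maxr _ _)).
have [N0 h] := partial_prop_kern M t x hP e4.
exists N0 => N /h {}h.
have -> : propagator t phi x - wsum N (fun n => phi n * kern t (n - x))
  = (propagator t phi x - partial_prop phi M t x)
    + (partial_prop phi M t x - wsum N (fun n => phi n * kern t (n - x))) by ring.
apply: le_trans (ncD _ _) _.
have a1 : nc (propagator t phi x - partial_prop phi M t x) <= e / 4 + e / 4.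
  by apply: le_trans (nc_le_ReIm _) _; rewrite ReD ImD ReN ImN lerD.
have a2 : 84 * source_bound t P M * `|t| <= e / 4.
  move: h3; rewrite ger0_norm ?source_bound_ge0 ?(sumle_ge0 hP)//.
  rewrite ler_pdivlMr ?mulr_gt0 ?ltr_wpDl// => h3; apply: le_trans h3.
  by have := source_bound_ge0 t M (sumle_ge0 hP); have := normr_ge0 t; nra.
lra.
Qed.

Lemma propagator_le phi P t x : sumle (nf phi) P ->
  nc (propagator t phi x) <= 42 * kap t * P.
Proof.
move=> hP; apply/ler_addgt0Pr => e e0.
have [N0 /(_ N0 (leqnn _)) h] := propagator_kern t x hP e0.
have k0 : 0 <= 42 * kap t by rewrite mulr_ge0 ?kap_ge0.
rewrite -[propagator t phi x](subrK (wsum N0 (fun n => phi n * kern t (n - x)))).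
apply: le_trans (ncD _ _) _; rewrite addrC lerD//.
apply: le_trans (wsum_norm_le _ _) _; apply: le_trans (sumle_wsum N0 (sumleZ k0 hP)).
by apply: ler_wsum => n; rewrite ncM mulrC ler_wpM2r ?nc_ge0 ?kern_le.
Qed.

Definition delta0 (n : int) : C := (n == 0)%:R.

Lemma sumle_delta0 : sumle (nf delta0) 1.
Proof.
move=> r ur; rewrite (eq_bigr (fun n => (n == 0)%:R)); last first.
  by move=> n _; rewrite /delta0 nc_natr.
rewrite -natr_sum; have -> : (\sum_(n <- r) (n == 0%R) = ((0%R : int) \in r))%N.
  rewrite -(count_uniq_mem _ ur) -sum1_count [RHS]big_mkcond /=.
  by apply: eq_bigr => n _; case: (n == 0).
by case: ((0 : int) \in r); rewrite ?ler01.
Qed.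

Lemma propagator_delta0 t x : propagator t delta0 x = kern t x.
Proof.
apply/eqP; rewrite -subr_eq0; apply/eqP/nc_eq0/eqP; rewrite eq_le nc_ge0 andbT.
apply/ler_addgt0Pr => e e0; rewrite add0r.
have [N0 /(_ N0 (leqnn _))] := propagator_kern t x sumle_delta0 e0.
rewrite (_ : (fun n => delta0 n * _) = fun n => kern t (n - x) * (n - 0 == 0)%:R).
  by rewrite (wsum_delta _ (x := 0))// sub0r ker_oppn.
by apply/funext => n; rewrite subr0 mulrC.
Qed.

End Propagator.

(** * Sums of powers and of functions of a distance *)

Section PowerSums.
Context {R : realType}.
Implicit Types (a : R) (n N k : nat).

Lemma powR_onep_le (x a : R) : 0 <= x -> a <= 2^-1 -> (1 + x) `^ a <= 1 + x / 2.
Proof.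
move=> x0 ah; apply: (@le_trans _ _ ((1 + x) `^ 2^-1)).
  by apply: ler_powR => //; rewrite lerDl.
have p0 : 0 <= (1 + x) `^ 2^-1 by exact: powR_ge0.
rewrite -(ler_pXn2r (n := 2))// ?nnegrE ?addr_ge0 ?divr_ge0//.
rewrite -powR_mulrn// -powRrM mulVf// powRr1 ?addr_ge0//.
by have := sqr_ge0 x; lra.
Qed.

(** The constant 2 is the worst case of [1 / (1 - a)]. The induction step compares [n ^ (- a)] with
    [(n + 1) ^ (- a)] by Bernoulli's inequality. *)
Lemma sum_powR a n : a <= 2^-1 ->
  \sum_(i < n) i.+1%:R `^ (- a) <= 2 * n%:R * n%:R `^ (- a) :> R.
Proof.
move=> ah; elim: n => [|n IH]; first by rewrite big_ord0 mulr0 mul0r.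
rewrite big_ord_recr /=; apply: le_trans (lerD IH (lexx _)) _.
have [->|n0] := posnP n.
  by rewrite mulr0 mul0r add0r powR1 !mulr1; lra.
have np : 0 < n%:R :> R by rewrite ltr0n.
have en : n.+1%:R = n%:R * (1 + n%:R^-1) :> R by rewrite -natr1 mulrDr mulr1 divff ?gt_eqF.
have i0 : 0 <= n%:R^-1 :> R by rewrite invr_ge0 ltW.
have h := powR_onep_le i0 ah.
have e : n%:R `^ (- a) = n.+1%:R `^ (- a) * (1 + n%:R^-1) `^ a :> R.
  rewrite en powRM ?addr_ge0 ?(ltW np)// -mulrA [X in _ * X]mulrC -powRD; last first.
    by apply/implyP => _; rewrite gt_eqF// ltr_pwDl.
  by rewrite subrr powRr0 mulr1.
have p0 : 0 <= n.+1%:R `^ (- a) :> R by exact: powR_ge0.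
rewrite e.
have h2 : 2 * n%:R * (1 + n%:R^-1) `^ a <= 2 * n%:R + 1 :> R.
  apply: (@le_trans _ _ (2 * n%:R * (1 + n%:R^-1 / 2))); first by rewrite ler_wpM2l// mulr_ge0 ?ltW.
  by rewrite le_eqVlt; apply/orP; left; apply/eqP; field; rewrite gt_eqF.
have -> : 2 * n%:R * (n.+1%:R `^ (- a) * (1 + n%:R^-1) `^ a)
  = n.+1%:R `^ (- a) * (2 * n%:R * (1 + n%:R^-1) `^ a) :> R by ring.
have : n.+1%:R `^ (- a) * (2 * n%:R * (1 + n%:R^-1) `^ a) <= n.+1%:R `^ (- a) * (2 * n%:R + 1) :> R.
  by rewrite ler_wpM2l.
rewrite -natr1; lra.
Qed.

Lemma sum_uniq_le (g : nat -> R) (s : seq nat) n : (forall i, 0 <= g i) ->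
  uniq s -> all (fun i => i < n)%N s -> \sum_(i <- s) g i <= \sum_(i < n) g i.
Proof.
move=> g0 us /allP sn.
have -> : \sum_(i <- s) g i = \sum_(i <- iota 0 n | i \in s) g i.
  rewrite -[RHS]big_filter; apply: perm_big; apply: uniq_perm => //.
    by rewrite filter_uniq// iota_uniq.
  move=> i; rewrite mem_filter mem_iota /=; case: (boolP (i \in s)) => // /sn.
  by rewrite add0n => ->.
rewrite -(big_mkord xpredT g) /index_iota subn0 big_mkcond /=.
by apply: ler_sum => i _; case: ifP.
Qed.

(** A given distance from [k] is attained at most twice, once on either side. *)
Lemma sum_absdiff_le (g : nat -> R) (r : seq int) (k : int) n : (forall i, 0 <= g i) ->
  uniq r -> all (fun j => absz (j - k) < n)%N r ->
  \sum_(j <- r) g (absz (j - k)) <= 2 * \sum_(i < n) g i.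
Proof.
move=> g0 ur rn; rewrite (bigID (fun j => k <= j))/= mulr_natl mulr2n.
apply: lerD; rewrite -big_filter.
  rewrite -(big_map (fun j => absz (j - k)) xpredT g); apply: sum_uniq_le => //.
    rewrite map_inj_in_uniq ?filter_uniq// => i j.
    by rewrite !mem_filter => /andP[h1 _] /andP[h2 _]; lia.
  by rewrite all_map all_filter; apply/allP => j jr /=; rewrite (allP rn) ?implybT.
rewrite -(big_map (fun j => absz (j - k)) xpredT g); apply: sum_uniq_le => //.
  rewrite map_inj_in_uniq ?filter_uniq// => i j.
  by rewrite !mem_filter => /andP[h1 _] /andP[h2 _]; lia.
by rewrite all_map all_filter; apply/allP => j jr /=; rewrite (allP rn) ?implybT.
Qed.

End PowerSums.

(** * No decay rate above 1/4 *)

Section Sharpness.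
Context {R : realType}.
Implicit Types (a c G : R) (j k m N : nat).

Lemma ipi_ge_part (f : R -> R) (b c : R) : continuous f -> (forall y, 0 <= f y) ->
  0 <= b <= pi -> (forall y, 0 <= y <= b -> c <= f y) -> c * b <= ipi f.
Proof.
move=> cf f0 /andP[b0 bpi] fc.
have dp (y : R) : 0 <= y -> is_derive y 1 (prim f) (f y) by move=> y0; exact: prim_drv.
have h1 : c * b - c * 0 <= prim f b - prim f 0.
  apply: (@le_increment _ (fun y => c * y) (prim f) (fun=> c) f) => //.
  - by move=> y _; apply: (drv_eq (drvZ c (drvI y))); rewrite mulr1.
  - by move=> y /andP[y0 _]; exact: dp.
have h2 : 0 - 0 <= prim f pi - prim f b :> R.
  apply: (@le_increment _ (fun=> 0) (prim f) (fun=> 0) f) => //.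
  by move=> y /andP[y0 _]; apply: dp; exact: le_trans y0.
by rewrite /ipi; lra.
Qed.

Lemma kerA_at0 (t : R) : kerA t 0 = ipi (fun y => cos (t * omega y)) / pi.
Proof. by rewrite /kerA; congr (ipi _ / _); apply/funext => y; rewrite /gcc mul0r cos0 mul1r. Qed.

Lemma fejer_sum N (x : R) : \sum_(k < N) \sum_(j < N) cos ((j%:R - k%:R) * x)
  = (\sum_(j < N) cos (j%:R * x)) ^+ 2 + (\sum_(j < N) sin (j%:R * x)) ^+ 2.
Proof.
rewrite !expr2 !big_distrl -big_split /=; apply: eq_bigr => k _.
rewrite !big_distrr -big_split /=; apply: eq_bigr => j _.
by rewrite mulrBl cosB; ring.
Qed.

(** The double sum is the integral of a sum of two squares. For [y <= 1 / m] the bound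
    [omega y <= m ^ (-4)] keeps every [j * omega y] below 1, so all cosines are at least 1/2 and the
    first square is at least [(m ^ 4 / 2) ^ 2] on an interval of length [1 / m]. *)
Lemma fejer_lower m : (0 < m)%N ->
  ((m ^ 4)%:R / 2) ^+ 2 / m%:R / pi <=
  \sum_(k < m ^ 4) \sum_(j < m ^ 4) kerA (j%:R - k%:R : R) 0.
Proof.
move=> m0; set N := (m ^ 4)%N.
have cc (j k : nat) : continuous (fun y : R => cos ((j%:R - k%:R) * omega y)).
  by move=> y; exact: drv_continuous (drv_cos (drvZ _ (drv_omega y))).
have cs (k : nat) : continuous (fun y : R => \sum_(j < N) cos ((j%:R - k%:R) * omega y)).
  by apply: (continuous_bigsum (F := fun (j : 'I_N) y => cos (((j : nat)%:R - k%:R) * omega y))) => j; exact: cc.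
have -> : \sum_(k < N) \sum_(j < N) kerA (j%:R - k%:R : R) 0
   = ipi (fun y => \sum_(k < N) \sum_(j < N) cos ((j%:R - k%:R) * omega y)) / pi.
  rewrite (ipi_sum (F := fun (k : 'I_N) y => \sum_(j < N) cos ((j%:R - (k : nat)%:R) * omega y))); last first.
    by move=> k; exact: cs.
  rewrite mulr_suml; apply: eq_bigr => k _.
  rewrite (ipi_sum (F := fun (j : 'I_N) y => cos (((j : nat)%:R - (k : nat)%:R) * omega y))); last first.
    by move=> j; exact: cc.
  by rewrite mulr_suml; apply: eq_bigr => j _; rewrite kerA_at0.
rewrite ler_wpM2r ?invr_ge0 ?pi_ge0//.
have mp : 0 < m%:R :> R by rewrite ltr0n.
apply: ipi_ge_part.
- by apply: (continuous_bigsum (F := fun (k : 'I_N) y => \sum_(j < N) cos ((j%:R - (k : nat)%:R) * omega y))) => k; exact: cs.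
- by move=> y; rewrite fejer_sum addr_ge0 ?sqr_ge0.
- rewrite invr_ge0 ltW//=; apply: (@le_trans _ _ 1); last by have := @pi_ge2 R; lra.
  by rewrite invf_le1// ler1n.
- move=> y /andP[y0 ym]; rewrite fejer_sum -[leLHS]addr0 lerD ?sqr_ge0//.
  have sN : N%:R / 2 <= \sum_(j < N) cos (j%:R * omega y).
    have -> : N%:R / 2 = \sum_(j < N) (2^-1 : R) by rewrite sumr_const card_ord -[RHS]mulr_natl.
    apply: ler_sum => j _.
    have w0 : 0 <= j%:R * omega y by rewrite mulr_ge0 ?omega_ge0.
    have w1 : j%:R * omega y <= 1.
      apply: (@le_trans _ _ (N%:R * m%:R^-1 ^+ 4)).
        rewrite ler_pM ?omega_ge0// ?ler_nat ?(ltnW (ltn_ord j))//.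
        apply: le_trans (omega_le_quartic y0) _.
        by rewrite lerXn2r ?nnegrE ?invr_ge0 ?(ltW mp).
      by rewrite /N natrX exprVn divff// expf_neq0// gt_eqF.
    have := cos_ge_quad w0; have : (j%:R * omega y) ^+ 2 <= 1 by rewrite expr_le1.
    lra.
  by rewrite lerXn2r ?nnegrE ?divr_ge0// (le_trans _ sN) ?divr_ge0.
Qed.

Lemma fejer_upper a G N : a <= 2^-1 -> 0 <= G ->
  (forall j, `|kerA (j%:R : R) 0| <= G * j.+1%:R `^ (- a)) ->
  \sum_(k < N) \sum_(j < N) kerA (j%:R - k%:R : R) 0 <= 4 * G * N%:R ^+ 2 * N%:R `^ (- a).
Proof.
move=> ah G0 hG.
have hI (k : 'I_N) : \sum_(j < N) kerA (j%:R - k%:R : R) 0 <= 4 * G * (N%:R * N%:R `^ (- a)).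
  apply: (@le_trans _ _ (\sum_(j <- [seq (i : nat)%:Z | i <- iota 0 N]) G * (absz (j - k%:Z)).+1%:R `^ (- a))).
    rewrite big_map -(big_mkord xpredT (fun j => kerA (j%:R - k%:R : R) 0)) /index_iota subn0.
    apply: ler_sum => j _; apply: le_trans (ler_norm _) _.
    have [kj|jk] := leqP k j.
      by rewrite -natrB// (_ : absz (j%:Z - k%:Z) = (j - k)%N) ?hG//; lia.
    rewrite -opprB kerAN -natrB ?(ltnW jk)//.
    by rewrite (_ : absz (j%:Z - k%:Z) = (k - j)%N) ?hG//; lia.
  apply: le_trans (@sum_absdiff_le _ (fun i => G * i.+1%:R `^ (- a)) _ k%:Z N _ _ _) _.
  - by move=> i; rewrite mulr_ge0// powR_ge0.
  - by rewrite map_inj_uniq ?iota_uniq// => i j; lia.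
  - by rewrite all_map; apply/allP => i /=; rewrite mem_iota => /andP[_ iN]; have := ltn_ord k; lia.
  by rewrite -mulr_sumr; have := ler_wpM2l G0 (sum_powR N ah); lra.
apply: (@le_trans _ _ (\sum_(k < N) 4 * G * (N%:R * N%:R `^ (- a)))).
  by apply: ler_sum => k _; exact: hI.
by rewrite sumr_const card_ord -[leLHS]mulr_natl le_eqVlt; apply/orP; left; apply/eqP; ring.
Qed.

Lemma kerA_decay_sharp a c : 4^-1 < a ->
  ~ (forall j, (0 < j)%N -> `|kerA (j%:R : R) 0| <= c * j%:R `^ (- a)).
Proof.
move=> a4 hc.
(* A smaller exponent still above 1/4, capped at 1/2 to come within reach of [sum_powR]. *)
pose b := Num.min a 2^-1.
have b4 : 4^-1 < b by rewrite lt_min a4 /=; lra.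
have bh : b <= 2^-1 by rewrite ge_min lexx orbT.
have c0 : 0 <= c by have := le_trans (normr_ge0 _) (hc 1%N isT); rewrite powR1 mulr1.
(* The 21 covers [j = 0]; the [2 * c] pays for replacing [j] by [j + 1] in the base of the power. *)
pose G := 21 + 2 * c.
have G0 : 0 <= G by rewrite /G; lra.
have hG j : `|kerA (j%:R : R) 0| <= G * j.+1%:R `^ (- b).
  case: j => [|j].
    have := kerA_le (0 : R) 0; have := @kap_le1 R 0; rewrite powR1 mulr1 /G; lra.
  apply: le_trans (hc j.+1 isT) _.
  have pj : 0 < j.+1%:R :> R by rewrite ltr0n.
  have h1 : j.+1%:R `^ (- a) <= j.+1%:R `^ (- b) :> R.
    by apply: ler_powR; rewrite ?ler1n// lerN2 ge_min lexx.
  have h2 : j.+1%:R `^ (- b) <= 2 * j.+2%:R `^ (- b) :> R.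
    have -> : j.+2%:R = j.+1%:R * (1 + j.+1%:R^-1) :> R by rewrite mulrDr mulr1 divff ?gt_eqF// natr1.
    rewrite powRM ?addr_ge0 ?invr_ge0 ?(ltW pj)// mulrCA ler_peMr ?powR_ge0//.
    rewrite powRN ler_pdivlMr ?mul1r ?powR_gt0 ?ltr_pwDl ?invr_ge0 ?(ltW pj)//.
    have := powR_onep_le (_ : 0 <= j.+1%:R^-1) bh => h.
    apply: le_trans (h _) _; first by rewrite invr_ge0 ltW.
    have aux (x : R) : x <= 1 -> 1 + x / 2 <= 2 by lra.
    by apply: aux; rewrite invf_le1// ler1n.
  have p0 : 0 <= j.+2%:R `^ (- b) :> R by exact: powR_ge0.
  apply: (@le_trans _ _ (c * (2 * j.+2%:R `^ (- b)))).
    by rewrite ler_wpM2l// (le_trans h1).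
  by rewrite /G; nra.
pose q := 4 * b - 1; have q0 : 0 < q by rewrite /q; lra.
(* With [N = m ^ 4] the two Fejer bounds give [m ^ (4 b - 1) <= 16 * G * pi <= 64 * G], which fails
   once the left side reaches [L]. *)
pose L := 64 * G + 1; have L0 : 0 < L by rewrite /L; lra.
pose m := (Num.bound (L `^ q^-1)).+1.
have mp : 0 < m%:R :> R by rewrite ltr0n.
have hm : L <= m%:R `^ q.
  have h : L `^ q^-1 <= m%:R.
    by rewrite -natr1 (le_trans (ltW (archi_boundP (powR_ge0 _ _))))// lerDl.
  have := ge0_ler_powR (ltW q0) _ _ h; rewrite -powRrM mulVf ?gt_eqF// powRr1 ?(ltW L0)//.
  by apply; rewrite nnegrE ?powR_ge0 ?(ltW mp).
have lo := @fejer_lower m isT; have up := @fejer_upper b G (m ^ 4)%N bh G0 hG.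
have := le_trans lo up; set N : R := (m ^ 4)%:R.
have Np : 0 < N by rewrite ltr0n expn_gt0.
have eN : N `^ (- b) = (m%:R `^ (q + 1))^-1.
  by rewrite /N natrX -powR_mulrn ?(ltW mp)// -powRrM mulrN powRN /q subrK.
rewrite eN powRD; last by apply/implyP => _; rewrite gt_eqF.
rewrite powRr1 ?(ltW mp)// => h.
have pq : 0 < m%:R `^ q :> R by exact: powR_gt0.
have : m%:R `^ q <= 16 * G * pi.
  have h3 : (N / 2) ^+ 2 <= 4 * G * N ^+ 2 / (m%:R `^ q) * pi.
    move: h; rewrite ler_pdivrMr ?pi_gt0// ler_pdivrMr//; congr (_ <= _).
    by field; rewrite !gt_eqF.
  have h4 : N ^+ 2 * m%:R `^ q <= N ^+ 2 * (16 * G * pi).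
    move: h3; rewrite mulrAC ler_pdivlMr// => h3; lra.
  by rewrite ler_pM2l ?exprn_gt0 in h4.
have := @pihalf_lt2 R; rewrite ltr_pdivrMr// => pi4 h5.
have : 16 * G * pi <= 16 * G * 4 by rewrite ler_wpM2l ?mulr_ge0//; lra.
rewrite /L in hm; lra.
Qed.

End Sharpness.

(** * Integrals against the counting measure as bounds on finite sums *)

Section CountingIntegral.
Context {R : realType}.
Implicit Types (f g : int -> R) (P : R).

(** The integral of a nonnegative function is a supremum over simple functions below it, hence
    monotone without measurability. The spatial norms of [u] and [F] as functions of time are
    compared in this way. *)
Lemma nm_le_integral d (T : measurableType d) (mu : {measure set T -> \bar R})
    (f g : T -> \bar R) :
  (forall x, (0 <= f x)%E) -> (forall x, (f x <= g x)%E) ->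
  (\int[mu]_x f x <= \int[mu]_x g x)%E.
Proof.
move=> f0 fg; have g0 x : (0 <= g x)%E by exact: le_trans (f0 x) (fg x).
rewrite !ge0_integralTE//; apply: ereal_sup_le => _ [h hf <-].
by exists h => // x; exact: le_trans (hf x) (fg x).
Qed.

Lemma counting_set1 (k : int) : counting [set k] = 1%E :> \bar R.
Proof.
rewrite /counting asboolT; last exact: finite_set1.
by rewrite fset_set1 finmap.cardfs1.
Qed.

Lemma integral_seq f (r : seq int) : (forall n, 0 <= f n) ->
  (\int[counting]_n (\sum_(k <- r) f k * \1_[set k] n)%:E = (\sum_(k <- r) f k)%:E :> \bar R)%E.
Proof.
move=> f0; under eq_integral do rewrite -sumEFin.
rewrite ge0_integral_sum//; last by move=> k n _; rewrite lee_fin mulr_ge0.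
rewrite -sumEFin; apply: eq_bigr => k _.
under eq_integral do rewrite EFinM.
rewrite ge0_integralZl//; last by rewrite lee_fin.
by rewrite integral_indic// setIT [X in (_ * X)%E]counting_set1 mule1.
Qed.

Lemma sum_indic f (r : seq int) n : uniq r ->
  \sum_(k <- r) f k * \1_[set k] n = if n \in r then f n else 0.
Proof.
move=> ur; have e k : f k * \1_[set k] n = if k == n then f n else 0.
  rewrite indicE; case: eqVneq => [->|kn]; first by rewrite mem_set// mulr1.
  by rewrite memNset ?mulr0//= => h; move: kn; rewrite h eqxx.
under eq_bigr do rewrite e; case: ifPn => nr.
  rewrite (bigD1_seq n)//= eqxx big1 ?addr0// => k /negbTE kn.
  by rewrite kn.
rewrite big_seq big1// => k kr; case: eqVneq => // kn.
by move: nr; rewrite -kn kr.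
Qed.

Lemma integral_le_sumle f P : (forall n, 0 <= f n) ->
  (\int[counting]_n (f n)%:E <= P%:E)%E -> sumle f P.
Proof.
move=> f0 fP r ur; rewrite -lee_fin -integral_seq//; apply: le_trans fP.
apply: nm_le_integral => n; rewrite lee_fin.
  by apply: sumr_ge0 => k _; rewrite mulr_ge0.
by rewrite sum_indic//; case: ifP.
Qed.

Definition window N : seq int := [seq k%:Z - N%:Z | k <- iota 0 N.*2.+1].

Lemma mem_window N n : (n \in window N) = (absz n <= N)%N.
Proof.
apply/mapP/idP => [[k]|nN]; first by rewrite mem_iota => /andP[_ kN] ->; lia.
by exists (absz (n + N%:Z)); [rewrite mem_iota; lia|lia].
Qed.

Lemma sumle_integral f P : (forall n, 0 <= f n) -> sumle f P ->
  (\int[counting]_n (f n)%:E <= P%:E)%E.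
Proof.
move=> f0 fP.
pose g N n : \bar R := (\sum_(k <- window N) f k * \1_[set k] n)%:E.
have gE N n : g N n = (if n \in window N then f n else 0)%:E.
  by rewrite /g sum_indic//; exact: uniq_window.
have lg n : limn (g^~ n) = (f n)%:E.
  apply: cvg_lim => //; apply: cvg_near_cst; exists (absz n) => // N /= nN.
  by rewrite gE mem_window nN.
rewrite (eq_integral (fun n => limn (g^~ n))); last by move=> n _; rewrite lg.
have g0 N n : [set: int] n -> (0 <= g N n)%E.
  by move=> _; rewrite gE lee_fin; case: ifP.
have gn n : [set: int] n -> {homo g^~ n : a b / (a <= b)%N >-> (a <= b)%E}.
  move=> _ a b ab; rewrite !gE lee_fin !mem_window; case: ifPn => [na|].
    by rewrite (leq_trans na ab).
  by case: ifP.
rewrite (monotone_convergence _ measurableT _ g0 gn)//; apply: lime_le.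
  by apply: ereal_nondecreasing_is_cvgn => a b ab; apply: nm_le_integral => n; [exact: (g0 _ _ I)|exact: (gn n I)].
apply: nearW => N; rewrite integral_seq// lee_fin; apply: fP; exact: uniq_window.
Qed.

End CountingIntegral.

(** * The l^p norms in terms of finite sums *)

Section SequenceNorms.
Context {R : realType}.
Implicit Types (phi : int -> R[i]) (P p : R).

Lemma lnormE p phi : lnorm p%:E phi =
  poweR (\int[counting]_n (nc (phi n) `^ p)%:E) p^-1.
Proof.
rewrite /lnorm unlock; congr poweR; apply: eq_integral => n _.
by rewrite /= ger0_norm ?nc_ge0.
Qed.

Lemma lnorm_ge0 (r : \bar R) phi : (0 <= lnorm r phi)%E.
Proof. exact: Lnorm_ge0. Qed.

Lemma le_poweR_inv (x : \bar R) P p : 0 < p -> 0 <= P -> (0 <= x)%E ->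
  (poweR x p^-1 <= P%:E)%E = (x <= (P `^ p)%:E)%E.
Proof.
move=> p0 P0 x0; have ip0 : 0 <= p^-1 by rewrite invr_ge0 ltW.
have xin (y : \bar R) : (0 <= y)%E -> y \in `[0%E, +oo%E] by move=> y0; rewrite in_itv /= y0 leey.
apply/idP/idP => h.
  have := gt0_ler_poweR (ltW p0) (xin _ (poweR_ge0 _ _)) (xin P%:E _) h.
  by rewrite -poweRrM mulVf ?gt_eqF// poweRe1//= => -> //; rewrite lee_fin.
have := gt0_ler_poweR ip0 (xin _ x0) (xin (P `^ p)%:E _) h.
rewrite poweR_EFin -powRrM mulfV ?gt_eqF// powRr1// => -> //.
by rewrite lee_fin powR_ge0.
Qed.

Lemma lnorm_le p phi P : 0 < p -> 0 <= P ->
  (lnorm p%:E phi <= P%:E)%E <-> sumle (fun n => nc (phi n) `^ p) (P `^ p).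
Proof.
move=> p0 P0; rewrite lnormE le_poweR_inv//; last first.
  by apply: integral_ge0 => n _; rewrite lee_fin powR_ge0.
by split; [apply: integral_le_sumle|apply: sumle_integral] => n; exact: powR_ge0.
Qed.

(** [Lnorm] at [+oo] is an essential supremum only over a space of positive measure. For the
    counting measure it is then a supremum, because a nonempty set has measure at least 1. *)
Lemma counting_gt0 : (0 < counting [set: int] :> \bar R)%E.
Proof.
apply: (@lt_le_trans _ _ (counting [set 0 : int] : \bar R)).
  by rewrite counting_set1.
by apply: le_measure; rewrite ?inE//=.
Qed.

Lemma lnorm_infty_le phi P : 0 <= P ->
  (lnorm +oo%E phi <= P%:E)%E <-> forall n, nc (phi n) <= P.
Proof.
move=> P0; rewrite /lnorm unlock counting_gt0; split.
  move=> /ess_supP -[N [_ N0 hN]] n.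
  have [nN|] := pselect (N n); last first.
    by move=> /(contra_notP (hN n)) /=; rewrite lee_fin ger0_norm ?nc_ge0.
  have : (1 <= counting N :> \bar R)%E.
    rewrite -(counting_set1 n); apply: le_measure; rewrite ?inE//=.
    by move=> _ ->.
  by move: N0 => /= ->; rewrite lee_fin ler10.
by move=> h; apply/ess_supP; apply: nearW => n /=; rewrite lee_fin ger0_norm ?nc_ge0.
Qed.

Lemma sumle_powR1 phi P : sumle (fun n => nc (phi n) `^ 1) (P `^ 1) -> 0 <= P -> sumle (nf phi) P.
Proof.
move=> h P0; rewrite powRr1// in h; apply: sumle_mono h => n.
by rewrite powRr1 ?nc_ge0.
Qed.

Lemma lnorm1_sumle phi : (lnorm 1%:E phi < +oo)%E -> sumle (nf phi) (fine (lnorm 1%:E phi)).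
Proof.
move=> fin; have P0 : 0 <= fine (lnorm 1%:E phi) by rewrite fine_ge0 ?lnorm_ge0.
apply: sumle_powR1 => //; apply/lnorm_le => //.
by rewrite fineK// ge0_fin_numE ?lnorm_ge0.
Qed.

Lemma lnorm1_le phi P : sumle (nf phi) P -> (lnorm 1%:E phi <= P%:E)%E.
Proof.
move=> h; have P0 := sumle_ge0 h; apply/lnorm_le => //; rewrite powRr1//.
by apply: sumle_mono h => n; rewrite powRr1 ?nc_ge0.
Qed.

End SequenceNorms.

(** * The decay estimate and its optimal exponent *)

Section DecayEstimate.
Context {R : realType}.
Implicit Types (t : R).

Lemma kap_le_powR t : t != 0 -> kap t <= `|t| `^ (- 4^-1).
Proof.
move=> t0; have tp : 0 < `|t| by rewrite normr_gt0.
apply: ler_X4; rewrite ?kap_ge0 ?powR_ge0// kap4 powR4//.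
by rewrite lef_pV2 ?posrE ?onep_gt0// lerDr.
Qed.

Lemma propagator_decay t (phi : int -> R[i]) : t != 0 -> (lnorm 1%:E phi < +oo)%E ->
  (lnorm +oo (propagator t phi) <= (42 * `|t| `^ (- 4^-1))%:E * lnorm 1%:E phi)%E.
Proof.
move=> t0 fin.
have fN : lnorm 1%:E phi \is a fin_num by rewrite ge0_fin_numE ?lnorm_ge0.
have P0 : 0 <= fine (lnorm 1%:E phi) by rewrite fine_ge0 ?lnorm_ge0.
rewrite -(fineK fN) -EFinM; apply/lnorm_infty_le.
  by rewrite mulr_ge0// mulr_ge0// powR_ge0.
move=> n; apply: le_trans (propagator_le t n (lnorm1_sumle fin)) _.
by rewrite ler_wpM2r// ler_pM2l// kap_le_powR.
Qed.

Lemma decay_rate4 : decay_rate (4^-1 : R).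
Proof. by exists 42 => t t0 phi; exact: propagator_decay. Qed.

Lemma opnorm_decay t : t != 0 ->
  (opnorm_l1_linfty (propagator t) <= (42 * `|t| `^ (- 4^-1))%:E)%E.
Proof.
move=> t0; apply: ge_ereal_sup => _ [phi /= h <-].
apply: le_trans (propagator_decay t0 (le_lt_trans h (ltry _))) _.
rewrite -[leRHS]mule1; apply: lee_pmul => //; rewrite ?lnorm_ge0// lee_fin mulr_ge0//.
Qed.

(** The point mass at 0 evolves into the kernel, and the real part of the kernel at site 0 and
    integer times contradicts any larger exponent. The maximum with 0 is there because [c] may be
    negative. *)
Lemma decay_rate_le (a : R) : decay_rate a -> a <= 4^-1.
Proof.
move=> [c hc]; rewrite leNgt; apply/negP => a4.
apply: (kerA_decay_sharp (c := Num.max c 0) a4) => j j0.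
have jN0 : j%:R != 0 :> R by rewrite pnatr_eq0 -lt0n.
have h1 := lnorm1_le (@sumle_delta0 R).
have m0 : 0 <= Num.max c 0 * j%:R `^ (- a) by rewrite mulr_ge0 ?powR_ge0// le_max lexx orbT.
have : (lnorm +oo (propagator j%:R (@delta0 R)) <= (Num.max c 0 * j%:R `^ (- a))%:E)%E.
  apply: le_trans (hc _ jN0 _ (le_lt_trans h1 (ltry _))) _.
  rewrite normr_nat; apply: (@le_trans _ _ ((Num.max c 0 * j%:R `^ (- a))%:E * lnorm 1%:E (@delta0 R)))%E.
    apply: lee_wpmul2r; first exact: lnorm_ge0.
    by rewrite lee_fin ler_wpM2r ?powR_ge0// le_max lexx.
  by rewrite -[leRHS]mule1; apply: lee_wpmul2l.
move=> /(lnorm_infty_le _ m0) /(_ 0); rewrite propagator_delta0 => h.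
exact: le_trans (le_Re_nc (kern j%:R 0)) h.
Qed.

Lemma decay_rate_sup : has_sup [set a : R | decay_rate a] /\
  sup [set a : R | decay_rate a] = 4^-1.
Proof.
have ub : ubound [set a : R | decay_rate a] 4^-1 by move=> a /decay_rate_le.
have hs : has_sup [set a : R | decay_rate a].
  by split; [exists 4^-1; exact: decay_rate4|exists 4^-1].
split => //; apply/eqP; rewrite eq_le; apply/andP; split.
  by apply: ge_sup => //; exists 4^-1; exact: decay_rate4.
by apply: ub_le_sup; [exact: hs.2|exact: decay_rate4].
Qed.

End DecayEstimate.

(** * Absolute continuity and differential inequalities almost everywhere *)

Section AbsoluteContinuity.
Context {R : realType}.
Local Notation AC := (@absolutely_continuous_on R).
Local Notation mu := (@lebesgue_measure R).
Implicit Types (f g : R -> R) (a b c d x y : R).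

(** Sums, multiples and products of absolutely continuous functions are all instances of this
    domination. *)
Lemma ac_dom f1 f2 g a b L : AC f1 a b -> AC f2 a b -> 0 <= L ->
  (forall x y, a <= x -> x <= y -> y <= b ->
     `|g y - g x| <= L * (`|f1 y - f1 x| + `|f2 y - f2 x|)) -> AC g a b.
Proof.
move=> h1 h2 L0 hg e e0.
have e'0 : 0 < e / (2 * (L + 1)) by rewrite divr_gt0// mulr_gt0// ltr_wpDl.
have [d1 d10 {}h1] := h1 _ e'0; have [d2 d20 {}h2] := h2 _ e'0.
exists (Num.min d1 d2); first by rewrite lt_min d10.
move=> m I hI tI; rewrite lt_min => /andP[s1 s2].
have {}h1 := h1 m I hI tI s1; have {}h2 := h2 m I hI tI s2.
apply: (@le_lt_trans _ _ (L * (\sum_(k < m) `|f1 (I k).2 - f1 (I k).1|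
   + \sum_(k < m) `|f2 (I k).2 - f2 (I k).1|))).
  rewrite -big_split mulr_sumr /=; apply: ler_sum => k _.
  by have [h3 [h4 h5]] := hI k; exact: hg.
apply: (@le_lt_trans _ _ (L * (e / (2 * (L + 1)) + e / (2 * (L + 1))))).
  by rewrite ler_wpM2l// lerD// ltW.
have -> : L * (e / (2 * (L + 1)) + e / (2 * (L + 1))) = e * (L / (L + 1)).
  by field; rewrite gt_eqF// ltr_wpDl.
rewrite gtr_pMr// ltr_pdivrMr ?ltr_wpDl// mul1r; lra.
Qed.

Lemma ac_lip f a b L : 0 <= L -> (forall x y, a <= x -> x <= y -> y <= b ->
  `|f y - f x| <= L * (y - x)) -> AC f a b.
Proof.
move=> L0 hf e e0; exists (e / (L + 1)); first by rewrite divr_gt0// ltr_wpDl.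
move=> m I hI _; rewrite ltr_pdivlMr ?ltr_wpDl// => hs.
have s0 : 0 <= \sum_(k < m) ((I k).2 - (I k).1).
  by apply: sumr_ge0 => k _; have [_ [h _]] := hI k; rewrite subr_ge0.
apply: (@le_lt_trans _ _ (L * \sum_(k < m) ((I k).2 - (I k).1))); last nra.
by rewrite mulr_sumr; apply: ler_sum => k _; have [h3 [h4 h5]] := hI k; exact: hf.
Qed.

Lemma ac_cst c a b : AC (fun=> c) a b.
Proof. by apply: (@ac_lip _ _ _ 0) => // x y _ _ _; rewrite subrr normr0 mul0r. Qed.

Lemma acD f g a b : AC f a b -> AC g a b -> AC (fun x => f x + g x) a b.
Proof.
move=> hf hg; apply: (ac_dom hf hg ler01) => x y _ _ _; rewrite mul1r.
by apply: le_trans (ler_normD _ _); rewrite le_eqVlt; apply/orP; left; apply/eqP; congr (`|_|); ring.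
Qed.

Lemma acZ f c a b : AC f a b -> AC (fun x => c * f x) a b.
Proof.
move=> hf; apply: (ac_dom hf hf (normr_ge0 c)) => x y _ _ _.
by rewrite -mulrBr normrM ler_wpM2l// lerDl.
Qed.

Lemma acM f g a b L : 0 <= L -> (forall x, a <= x <= b -> `|f x| <= L) ->
  (forall x, a <= x <= b -> `|g x| <= L) ->
  AC f a b -> AC g a b -> AC (fun x => f x * g x) a b.
Proof.
move=> L0 fL gL hf hg; apply: (ac_dom hf hg L0) => x y ax xy yb.
have -> : f y * g y - f x * g x = (f y - f x) * g y + f x * (g y - g x) by ring.
apply: le_trans (ler_normD _ _) _; rewrite !normrM mulrDr; apply: lerD.
  by rewrite mulrC ler_wpM2r// gL// (le_trans ax xy).
by rewrite ler_wpM2r// fL// ax (le_trans xy).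
Qed.

Lemma ac_sum (T : Type) (r : seq T) (F : T -> R -> R) a b :
  (forall i, AC (F i) a b) -> AC (fun x => \sum_(i <- r) F i x) a b.
Proof.
move=> hF; elim: r => [|i r IH].
  by under eq_fun do rewrite big_nil; exact: ac_cst.
by under eq_fun do rewrite big_cons; exact: (acD (hF i) IH).
Qed.

Definition clamp c d x : R := Num.max c (Num.min x d).

Lemma clampE c d x : c <= d ->
  clamp c d x = if x <= c then c else if x <= d then x else d.
Proof.
move=> cd; rewrite /clamp; have [xc|cx] := leP x c.
  by rewrite (min_idPl (le_trans xc cd)) (max_idPl xc).
have [xd|dx] := leP x d; first by rewrite (max_idPr (ltW cx)).
by rewrite (max_idPr cd).
Qed.

Lemma clamp_homo c d x y : c <= d -> x <= y -> clamp c d x <= clamp c d y.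
Proof. by move=> cd xy; rewrite !clampE//; have [?|?] := leP x c; have [?|?] := leP y c;
  have [?|?] := leP x d; have [?|?] := leP y d; lra. Qed.

Lemma clamp_range c d x : c <= d -> c <= clamp c d x <= d.
Proof. by move=> cd; rewrite clampE//; have [h1|h1] := leP x c; [|have [h2|h2] := leP x d]; apply/andP; split; lra. Qed.

Lemma clamp_lip c d x y : c <= d -> x <= y -> clamp c d y - clamp c d x <= y - x.
Proof. by move=> cd xy; rewrite !clampE//; have [?|?] := leP x c; have [?|?] := leP y c;
  have [?|?] := leP x d; have [?|?] := leP y d; lra. Qed.

(** Clamping is monotone and 1-Lipschitz, so the image intervals have no larger total length. They
    also stay disjoint: if two images share an interior point, neither interval is degenerate and
    the intervals themselves overlap. *)
Lemma ac_clamp f a b c d : c <= d -> AC f c d -> AC (fun x => f (clamp c d x)) a b.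
Proof.
move=> cd hf e e0; have [dl dl0 {}hf] := hf e e0; exists dl => // m I hI tI sI.
apply: (hf m (fun k => (clamp c d (I k).1, clamp c d (I k).2))) => /=.
- move=> k; have [h1 [h2 h3]] := hI k.
  have /andP[q1 _] := clamp_range (I k).1 cd; have /andP[_ q2] := clamp_range (I k).2 cd.
  by split => //; split => //; exact: clamp_homo.
- move=> i j _ _ [z []] /=; rewrite !in_itv /= => /andP[z1 z2] /andP[z3 z4].
  have [//|ij] := eqVneq i j; exfalso.
  have [_ [hi _]] := hI i; have [_ [hj _]] := hI j.
  have ilt : (I i).1 < (I i).2.
    by rewrite ltNge; apply/negP => h; have := clamp_homo cd h; lra.
  have jlt : (I j).1 < (I j).2.
    by rewrite ltNge; apply/negP => h; have := clamp_homo cd h; lra.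
  have : Num.max (I i).1 (I j).1 < Num.min (I i).2 (I j).2.
    rewrite gt_max !lt_min ilt jlt /= andbT; apply/andP; split; rewrite ltNge; apply/negP => h.
      by have := clamp_homo cd h; lra.
    by have := clamp_homo cd h; lra.
  move=> hm; have : i = j; last by move/eqP: ij.
  move: hm; set p := Num.max _ _; set q := Num.min _ _ => hm.
  have [p1 p2] : (I i).1 <= p /\ (I j).1 <= p by rewrite !le_max !lexx orbT.
  have [q1 q2] : q <= (I i).2 /\ q <= (I j).2 by rewrite !ge_min !lexx orbT.
  by apply: tI => //; exists ((p + q) / 2); split; rewrite /= in_itv /=; apply/andP; split; lra.
- by apply: le_lt_trans sI; apply: ler_sum => k _; have [_ [h _]] := hI k; exact: clamp_lip.
Qed.

(* Cousin's covering argument; [O] will be a small open neighbourhood of the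
   null set where the derivative is not controlled. *)
Lemma cousin_cover (f G : R -> R) (O : set R) a b e : a <= b -> 0 <= e ->
  (forall x y, x <= y -> G x <= G y) ->
  (forall z, a <= z <= b -> exists2 h, 0 < h & forall s t, z - h < s <= z -> z <= t < z + h ->
     f t - f s <= G t - G s + e * (t - s) \/ `[s, t]%classic `<=` O) ->
  exists r : seq (R * R), [/\ all (fun p => (a <= p.1) && (p.1 <= p.2) && (p.2 <= b)) r,
    pairwise (fun p q => q.2 <= p.1) r,
    forall p, p \in r -> `[p.1, p.2]%classic `<=` O &
    f b - f a <= G b - G a + e * (b - a) + \sum_(p <- r) `|f p.2 - f p.1|].
Proof.
move=> ab e0 Gm loc.
pose good x (r : seq (R * R)) := [/\ all (fun p => (a <= p.1) && (p.1 <= p.2) && (p.2 <= x)) r,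
    pairwise (fun p q => q.2 <= p.1) r,
    forall p, p \in r -> `[p.1, p.2]%classic `<=` O &
    f x - f a <= G x - G a + e * (x - a) + \sum_(p <- r) `|f p.2 - f p.1|].
(* Compactness in the form of a supremum: the local hypothesis at [c = sup S] extends a covering
   past [c] unless [c = b]. *)
pose S := [set x | a <= x <= b /\ exists r, good x r].
have Sa : S a.
  by split; [rewrite lexx|exists [::]; split => //; rewrite big_nil !subrr mulr0 !addr0].
have hS : has_sup S by split; [exists a|exists b => x [/andP[_ xb] _]].
pose c := sup S.
have ac : a <= c by apply: ub_le_sup => //; exact: hS.2.
have cb : c <= b by apply: ge_sup; [exists a|move=> x [/andP[_ xb] _]].
have [h h0 step] := loc c (introT andP (conj ac cb)).
have [s [sab [r [r1 r2 r3 r4]]] sc] : exists2 s, S s & c - h < s.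
  by apply: sup_adherent.
have sc' : s <= c by apply: ub_le_sup; [exact: hS.2|split => //; exists r].
have ext t : c <= t -> t < c + h -> t <= b -> S t.
  move=> ct th tb; have st : s <= t by exact: le_trans ct.
  split; first by rewrite (le_trans ac ct).
  have r1' : all (fun p => (a <= p.1) && (p.1 <= p.2) && (p.2 <= t)) r.
    by apply: sub_all r1 => p /andP[-> pt] /=; exact: le_trans st.
  have Gst := Gm _ _ st; have et : 0 <= e * (t - s) by rewrite mulr_ge0// subr_ge0.
  have [||hst|hst] := step s t; [by rewrite sc sc'|by rewrite ct th| |].
    by exists r; split => //; move: r4 hst; lra.
  exists ((s, t) :: r); split => /=.
  - by rewrite r1' (andP sab).1 st lexx.
  - rewrite r2 andbT; apply: sub_all r1 => p /andP[_]; by [].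
  - by move=> p; rewrite in_cons => /orP[/eqP -> //|]; exact: r3.
  - by rewrite big_cons /=; have := ler_norm (f t - f s); move: r4; lra.
have [cltb|bc] := ltP c b; last first.
  have cb' : c = b by apply/eqP; rewrite eq_le cb bc.
  have bch : b < c + h by rewrite cb' ltrDl.
  by have [_ [r' [q1 q2 q3 q4]]] := ext b cb bch (lexx b); exists r'.
have : S (Num.min (c + h / 2) b).
  apply: ext; last by rewrite ge_min lexx orbT.
    by rewrite le_min cb lerDl divr_ge0// ltW.
  by rewrite gt_min ltrD2l ltr_pdivrMr// ltr_pMr// ltr1n.
move=> /(ub_le_sup hS.2); rewrite -/c ge_min => /orP[|]; last by rewrite leNgt cltb.
by rewrite gerDl leNgt divr_gt0.
Qed.

Lemma sum_length_le (O : set R) (r : seq (R * R)) : open O ->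
  all (fun p => p.1 <= p.2) r -> pairwise (fun p q => q.2 <= p.1) r ->
  (forall p, p \in r -> `[p.1, p.2]%classic `<=` O) ->
  ((\sum_(p <- r) (p.2 - p.1))%:E <= mu O)%E.
Proof.
move=> oO.
(* The list runs from right to left, so the induction removes the rightmost interval and keeps the
   part of [O] to the left of it. *)
suff h x : all (fun p => p.1 <= p.2) r -> all (fun p => p.2 <= x) r -> pairwise (fun p q => q.2 <= p.1) r ->
  (forall p, p \in r -> `[p.1, p.2]%classic `<=` O) ->
  ((\sum_(p <- r) (p.2 - p.1))%:E <= mu (O `&` `]-oo, x[%classic))%E.
  move=> r1 r2 r3.
  apply: le_trans (h (\big[Num.max/0]_(p <- r) p.2) r1 _ r2 r3) _.
    by apply/allP => p pr; exact: (@le_bigmax_seq _ R (R * R)%type r 0 p xpredT (fun p => p.2) pr isT).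
  by apply: le_measure; rewrite ?inE; [apply: measurableI => //; exact: open_measurable|exact: open_measurable|move=> z []].
elim: r x => [|p r IH] x /=; first by rewrite big_nil.
move=> /andP[p12 r1] /andP[p2x r2] /andP[rp r3] hO.
have {}IH := IH p.1 r1 rp r3 (fun q qr => hO q (mem_behead (s := p :: r) qr)).
rewrite big_cons addrC EFinD.
have m1 : measurable (O `&` `]-oo, p.1[%classic) by apply: measurableI => //; exact: open_measurable.
have m2 : measurable `[p.1, p.2[%classic by [].
apply: (@le_trans _ _ (mu (O `&` `]-oo, p.1[%classic) + mu `[p.1, p.2[%classic)%E).
  apply: leeD => //; rewrite lebesgue_measure_itv /= lte_fin; case: ltP => // h.
  by rewrite lee_fin subr_le0.
rewrite -measureU//; last first.
  by apply/seteqP; split => // z [] [_] /=; rewrite !in_itv /= => z1 /andP[z2 _]; move: z1; rewrite ltNge z2.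
apply: le_measure; rewrite ?inE; [exact: measurableU|by apply: measurableI => //; exact: open_measurable|].
move=> z [[Oz]|] /=; rewrite !in_itv /=.
  by move=> zp; split => //; apply: lt_le_trans zp (le_trans p12 p2x).
move=> /andP[z1 z2]; split; last exact: lt_le_trans z2 p2x.
by apply: (hO p (mem_head _ _)); rewrite /= in_itv /= z1 ltW.
Qed.

Lemma ac_sum_le f a b e (r : seq (R * R)) d :
  (forall (m : nat) (I : 'I_m -> R * R),
      (forall k, a <= (I k).1 /\ (I k).1 <= (I k).2 /\ (I k).2 <= b) ->
      trivIset [set: 'I_m] (fun k => [set` `](I k).1, (I k).2[]) ->
      \sum_(k < m) ((I k).2 - (I k).1) < d ->
      \sum_(k < m) `|f (I k).2 - f (I k).1| < e) ->
  all (fun p => (a <= p.1) && (p.1 <= p.2) && (p.2 <= b)) r ->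
  pairwise (fun p q => q.2 <= p.1) r -> \sum_(p <- r) (p.2 - p.1) < d ->
  \sum_(p <- r) `|f p.2 - f p.1| < e.
Proof.
move=> hf r1 r2 r3; pose I (k : 'I_(size r)) := nth (0, 0) r k.
have sE (F : R * R -> R) : \sum_(p <- r) F p = \sum_(k < size r) F (I k).
  by rewrite (big_nth (0, 0)) big_mkord.
rewrite (sE (fun p => `|f p.2 - f p.1|)); apply: hf; last by rewrite -(sE (fun p => p.2 - p.1)).
- by move=> k; have /andP[/andP[h1 h2] h3] := allP r1 _ (mem_nth (0, 0) (ltn_ord k)).
- have aux (i j : 'I_(size r)) : (i < j)%N -> (I j).2 <= (I i).1.
    move=> ij; move/(pairwiseP (0, 0)) : r2 => /(_ i j).
    by apply => //; rewrite inE ltn_ord.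
  move=> i j _ _ [z []] /=; rewrite !in_itv /= => /andP[z1 z2] /andP[z3 z4].
  by apply/val_inj; case: (ltngtP i j) => [/aux h|/aux h|//]; exfalso; lra.
Qed.

Lemma derive_upper f x l e : is_derive x 1 f l -> l < e ->
  exists2 h, 0 < h & forall y, `|y - x| < h ->
    (x <= y -> f y - f x <= e * (y - x)) /\ (y <= x -> f x - f y <= e * (x - y)).
Proof.
move=> /is_derive1_caratheodory [g [hg cg gx]] le.
have : \forall y \near x, g y < e by move: cg => /cvgr_lt; rewrite gx => /(_ e le).
move=> /nbhs_ballP [h /= h0 hb]; exists h => // y yx.
have gy : g y < e by apply: hb; rewrite /ball /= distrC.
split=> xy; first by rewrite hg ler_wpM2r ?subr_ge0// ltW.
rewrite -opprB hg -mulrN opprB ler_wpM2r ?subr_ge0// ltW//.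
Qed.

(** Let [G] be the primitive of [g]. Off a null set [f - G] has derivative at most 0, so locally it
    grows at a rate of at most [e']. The null set lies in an open set of measure below [d], where
    absolute continuity bounds the total increment of [f] by [e']. The covering joins the two cases,
    with total error [e' * (b - a) + e' = e]. *)
Lemma ac_increment_le f g a b : a <= b -> AC f a b -> (forall x, 0 <= g x) ->
  mu.-integrable setT (EFin \o g) ->
  {ae mu, forall t : R, exists2 l : R, is_derive t 1 f l & l <= g t} ->
  ((f b - f a)%:E <= \int[mu]_t (g t)%:E)%E.
Proof.
move=> ab acf g0 ig aef.
have igy y : mu.-integrable `]-oo, y]%classic (EFin \o g).
  exact: (integrableS (E := setT)).
have lig : locally_integrable [set: R] g.
  have := @integrable_locally R g setT measurableT ig.
  by rewrite patch_setT.
pose G x := \int[mu]_(t in `]-oo, x]) g t.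
have aeG := FTC1Ny igy lig.
have Gm x y : x <= y -> G x <= G y.
  move=> xy; rewrite -subr_ge0 /G Rintegral_itvB ?bnd_simp//.
  by apply: Rintegral_ge0.
have Gtot : ((G b - G a)%:E <= \int[mu]_t (g t)%:E)%E.
  rewrite /G Rintegral_itvB ?bnd_simp// /Rintegral fineK.
    by apply: ge0_subset_integral => //; [exact: (measurable_int mu ig)|move=> x _; rewrite lee_fin g0].
  apply: integrable_fin_num => //; exact: (integrableS (E := setT)).
apply/lee_addgt0Pr => e e0.
have : {ae mu, forall t : R, (exists2 l : R, is_derive t 1 f l & l <= g t) /\
    (derivable G t 1 /\ (G^`())%classic t = g t)}.
  have fF : Filter (almost_everywhere mu) by exact: ae_filter_ringOfSetsType.
  by apply: filterS2 aef aeG => t h1 h2; split.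
move=> [N [mN N0 hN]].
pose e' := e / (b - a + 1).
have ba0 : 0 < b - a + 1 by lra.
have e'0 : 0 < e' by rewrite divr_gt0.
have [d d0 hd] := acf _ e'0.
have [|O [oO NO Od]] := @lebesgue_regularity_outer R N d mN _ d0; first by rewrite [ltLHS]N0.
have muO : (mu O < d%:E)%E.
  apply: le_lt_trans Od; rewrite -[in leLHS](setDUK NO) measureU//.
  - by rewrite [X in (X + _)%E]N0 add0e.
  - by apply: measurableD => //; exact: open_measurable.
  - by rewrite setDE setIA setIAC setICr set0I.
have [z zab|r [r1 r2 r3 r4]] := @cousin_cover f G O a b e' ab (ltW e'0) Gm.
- have [Oz|nOz] := pselect (O z).
    have := oO; rewrite openE => /(_ z Oz) /nbhs_ballP [h /= h0 hb].
    exists h => // s t /andP[s1 s2] /andP[t1 t2]; right => w /=; rewrite in_itv /= => /andP[w1 w2].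
    by apply: hb; rewrite /ball /= ltr_norml; apply/andP; split; lra.
  have [|[l dl lg] [dG eG]] := @contrapT ((exists2 l : R, is_derive z 1 f l & l <= g z) /\
    (derivable G z 1 /\ (G^`())%classic z = g z)).
    by move=> h; apply: nOz; apply: NO; apply: hN.
  have dG' : is_derive z 1 G (g z) by split => //; rewrite -eG derive1E.
  have [|h h0 hh] := @derive_upper (fun t => f t - G t) z (l - g z) e' (drvB dl dG'); first by lra.
  exists h => // s t /andP[s1 s2] /andP[t1 t2]; left.
  have [|_ /(_ s2) k1] := hh s; first by rewrite ltr_norml; apply/andP; split; lra.
  have [|/(_ t1) k2 _] := hh t; first by rewrite ltr_norml; apply/andP; split; lra.
  lra.
have r1' : all (fun p => p.1 <= p.2) r by apply: sub_all r1 => p /andP[/andP[]].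
have len : \sum_(p <- r) (p.2 - p.1) < d.
  by rewrite -lte_fin; apply: le_lt_trans muO; exact: sum_length_le.
have var := ac_sum_le hd r1 r2 len.
apply: (@le_trans _ _ ((G b - G a)%:E + e%:E)%E); last by rewrite leeD2r.
rewrite -EFinD lee_fin; have -> : e = e' * (b - a + 1) by rewrite /e' divfK// gt_eqF.
lra.
Qed.

End AbsoluteContinuity.

(** * Discrete Hardy-Littlewood-Sobolev inequality, from l^(8/7) to l^8 *)

Section HardyLittlewoodSobolev.
Context {R : realType}.
Implicit Types (r : seq int) (b y : int -> R) (j k : int) (beta : R) (i n m : nat).

Definition kapn i : R := i.+1%:R `^ (- 4^-1).

Lemma kapn_ge0 i : 0 <= kapn i. Proof. exact: powR_ge0. Qed.

Lemma kap_int j : kap (j%:~R : R) = kapn (absz j).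
Proof.
rewrite /kap /kapn -intr_norm; congr (_ `^ _).
by rewrite -[in LHS](mulr1z 1) -intrD -abszE -natr1 intrD mulr1z addrC.
Qed.

Lemma kapn4 i : kapn i ^+ 4 = i.+1%:R^-1.
Proof. by apply: powR4; rewrite ltr0n. Qed.

Lemma kapn8 i : kapn i ^+ 8 = (i.+1%:R ^+ 2)^-1.
Proof. by rewrite (_ : 8 = 4 * 2)%N// exprM kapn4 exprVn. Qed.

Lemma sum_tail n m : (0 < n)%N -> \sum_(n <= i < m) kapn i ^+ 8 <= n%:R^-1.
Proof.
move=> n0; have [mn|nm] := leqP m n; first by rewrite big_geq// invr_ge0.
suff h d : \sum_(n <= i < n + d) kapn i ^+ 8 <= n%:R^-1 - (n + d)%:R^-1.
  have := h (m - n)%N; rewrite subnKC ?(ltnW nm)// => /le_trans; apply.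
  by rewrite gerBl invr_ge0.
elim: d => [|d IH]; first by rewrite addn0 big_geq// subrr.
rewrite addnS big_nat_recr ?leq_addr//= kapn8 -natr1.
have aux (x : R) : 0 < x -> ((x + 1) ^+ 2)^-1 <= x^-1 - (x + 1)^-1.
  move=> x0; have -> : x^-1 - (x + 1)^-1 = (x * (x + 1))^-1.
    by field; apply/andP; split; rewrite gt_eqF ?addr_gt0.
  by rewrite lef_pV2 ?posrE ?exprn_gt0 ?mulr_gt0 ?addr_gt0// expr2 ler_pM2r ?addr_gt0// lerDl.
have := aux (n + d)%:R; rewrite ltr0n addn_gt0 n0 => /(_ isT).
move: IH; lra.
Qed.

(** The two terms balance where [kapn i = beta ^+ 2], that is near [i = beta ^- 8]. Below this index
    the first term sums to at most [4 * beta], above it the second sums to at most [beta]. *)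
Lemma sum_min beta m : 0 < beta <= 1 ->
  \sum_(i < m) Num.min (beta ^+ 7 * kapn i) (kapn i ^+ 8 / beta ^+ 7) <= 5 * beta.
Proof.
move=> /andP[b0 b1].
have b80 : 0 < beta ^+ 8 by rewrite exprn_gt0.
have b70 : 0 < beta ^+ 7 by rewrite exprn_gt0.
have ib8 : 1 <= (beta ^+ 8)^-1 by rewrite invf_ge1// exprn_ile1// ltW.
have i0 : 0 <= (beta ^+ 8)^-1 by rewrite invr_ge0 ltW.
pose n := (Num.truncn (beta ^+ 8)^-1).+1.
have /andP[tlo thi] := truncn_itv i0.
have nlo : (beta ^+ 8)^-1 <= n%:R by exact: ltW.
have nhi : n%:R <= 2 * (beta ^+ 8)^-1 by rewrite /n -natr1; lra.
have np : 0 < n%:R :> R by rewrite ltr0n.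
pose g i := Num.min (beta ^+ 7 * kapn i) (kapn i ^+ 8 / beta ^+ 7).
have g0 i : 0 <= g i.
  by rewrite le_min mulr_ge0 ?divr_ge0 ?exprn_ge0 ?kapn_ge0// ltW.
have -> : \sum_(i < m) Num.min (beta ^+ 7 * kapn i) (kapn i ^+ 8 / beta ^+ 7) = \sum_(0 <= i < m) g i.
  by rewrite big_mkord.
apply: (@le_trans _ _ (\sum_(0 <= i < n) g i + \sum_(n <= i < n + m) g i)).
  rewrite -big_cat_nat ?leq_addr//= [leRHS](big_cat_nat (n := m)) ?leq_addl//=.
  by rewrite lerDl sumr_ge0.
have near_le : \sum_(0 <= i < n) g i <= 4 * beta.
  apply: (@le_trans _ _ (beta ^+ 7 * \sum_(i < n) kapn i)).
    by rewrite big_mkord mulr_sumr; apply: ler_sum => i _; rewrite ge_min lexx.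
  have h : n%:R * n%:R `^ (- 4^-1) <= 2 * (beta ^+ 6)^-1.
    apply: ler_X4; rewrite ?mulr_ge0 ?powR_ge0 ?invr_ge0 ?exprn_ge0 ?(ltW b0)//.
    rewrite !exprMn powR4// exprSr mulfK ?gt_eqF// exprVn -exprM.
    apply: (@le_trans _ _ ((2 * (beta ^+ 8)^-1) ^+ 3)).
      by rewrite lerXn2r ?nnegrE ?mulr_ge0// ltW.
    rewrite exprMn exprVn -exprM ler_pM2r ?invr_gt0 ?exprn_gt0//.
    have -> : (2 : R) ^+ 3 = 8 by ring.
    have -> : (2 : R) ^+ 4 = 16 by ring.
    lra.
  have h4 : (4^-1 : R) <= 2^-1 by lra.
  have := ler_wpM2l (ltW b70) (sum_powR n h4); rewrite -/(kapn _) => h1.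
  apply: le_trans h1 _.
  have -> : 4 * beta = beta ^+ 7 * (2 * (2 * (beta ^+ 6)^-1)).
    by field; rewrite gt_eqF.
  by rewrite ler_pM2l// -mulrA ler_pM2l.
have far_le : \sum_(n <= i < n + m) g i <= beta.
  apply: (@le_trans _ _ (\sum_(n <= i < n + m) kapn i ^+ 8 / beta ^+ 7)).
    by apply: ler_sum => i _; rewrite ge_min lexx orbT.
  rewrite -mulr_suml ler_pdivrMr// -exprS; apply: le_trans (@sum_tail n _ _) _ => //.
  by rewrite -[leRHS]invrK lef_pV2 ?posrE ?invr_gt0.
lra.
Qed.

(** Write [x] for the kernel value. If [x <= b k * b j], the term is at most [b k * b j ^+ 8], and
    these sum to [b k]. Otherwise [b j] is below both [b k] and [x / b k], which gives the minimum
    summed in [sum_min], once on each side of [k]: 11 = 1 + 2 * 5. *)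
Lemma lower_interaction r b k : uniq r -> (forall j, 0 <= b j) ->
  \sum_(j <- r) b j ^+ 8 <= 1 -> 0 < b k <= 1 ->
  \sum_(j <- r | b j <= b k) b j ^+ 7 * kap (j - k)%:~R <= 11 * b k.
Proof.
move=> ur b0 bs /andP[bk0 bk1].
pose g i := Num.min (b k ^+ 7 * kapn i) (kapn i ^+ 8 / b k ^+ 7).
have bk7 : 0 < b k ^+ 7 by rewrite exprn_gt0.
have g0 i : 0 <= g i.
  by rewrite le_min mulr_ge0 ?divr_ge0 ?exprn_ge0 ?kapn_ge0// ltW.
apply: (@le_trans _ _ (\sum_(j <- r) (b k * b j ^+ 8 + g (absz (j - k))))).
  rewrite big_mkcond /=; apply: ler_sum => j _; case: ifPn => [jk|_]; last first.
    by rewrite addr_ge0// mulr_ge0 ?exprn_ge0.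
  rewrite kap_int; set x := kapn _; have x0 : 0 <= x by exact: kapn_ge0.
  have [h|h] := leP x (b k * b j).
    apply: (@le_trans _ _ (b k * b j ^+ 8)); last by rewrite lerDl.
    rewrite [b j ^+ 8]exprSr mulrCA; apply: ler_wpM2l h; exact: exprn_ge0.
  apply: (@le_trans _ _ (g (absz (j - k)))); last by rewrite lerDr mulr_ge0 ?exprn_ge0.
  rewrite le_min -/x; apply/andP; split.
    by rewrite ler_wpM2r// lerXn2r ?nnegrE ?b0// ltW.
  rewrite ler_pdivlMr// [x ^+ 8]exprSr mulrAC -exprMn ler_wpM2r//.
  by rewrite lerXn2r ?nnegrE ?mulr_ge0 ?(ltW bk0)// mulrC ltW.
rewrite big_split -mulr_sumr /=.
have h1 : b k * (\sum_(j <- r) b j ^+ 8) <= b k by rewrite ler_piMr// ltW.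
pose M := (\max_(j <- r) absz (j - k)).+1.
have h2 : \sum_(j <- r) g (absz (j - k)) <= 2 * \sum_(i < M) g i.
  apply: sum_absdiff_le => //; apply/allP => j jr /=.
  by rewrite ltnS (leq_bigmax_seq (F := fun j => absz (j - k))).
have h3 : \sum_(i < M) g i <= 5 * b k by apply: sum_min; rewrite bk0.
lra.
Qed.

(* Discrete Hardy-Littlewood-Sobolev, exponents 8/7 -> 8; the weights [b ^+ 7]
   keep the exponents integral. *)
Lemma hls_quadratic r b : uniq r -> (forall j, 0 <= b j) -> \sum_(j <- r) b j ^+ 8 <= 1 ->
  \sum_(k <- r) \sum_(j <- r) b k ^+ 7 * (b j ^+ 7 * kap (j - k)%:~R) <= 22.
Proof.
move=> ur b0 bs.
have bk1 k : k \in r -> b k <= 1.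
  move=> kr; have : b k ^+ 8 <= 1.
    by apply: le_trans bs; rewrite (bigD1_seq k)//= lerDl sumr_ge0// => j _; rewrite exprn_ge0.
  by rewrite expr_le1.
pose T k := \sum_(j <- r | b j <= b k) b j ^+ 7 * kap (j - k)%:~R.
have tk k : k \in r -> b k ^+ 7 * T k <= 11 * b k ^+ 8.
  move=> kr; have := b0 k; rewrite le_eqVlt => /predU1P[<-|bk0].
    by rewrite !expr0n /= mul0r mulr0.
  rewrite [b k ^+ 8]exprSr mulrCA ler_wpM2l ?exprn_ge0//.
  by apply: lower_interaction => //; rewrite bk0 bk1.
have t0 k j : 0 <= b k ^+ 7 * (b j ^+ 7 * kap (j - k)%:~R).
  by rewrite mulr_ge0 ?mulr_ge0 ?exprn_ge0 ?kap_ge0.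
(* Each pair is charged to the index with the larger weight; the kernel is symmetric, so the two
   halves agree and 22 = 2 * 11. *)
have split_le : \sum_(k <- r) \sum_(j <- r) b k ^+ 7 * (b j ^+ 7 * kap (j - k)%:~R)
    <= \sum_(k <- r) b k ^+ 7 * T k + \sum_(k <- r) b k ^+ 7 * T k.
  rewrite [X in _ <= _ + X](_ : _ = \sum_(k <- r) \sum_(j <- r | b k <= b j) b k ^+ 7 * (b j ^+ 7 * kap (j - k)%:~R)).
    rewrite -big_split /=; apply: ler_sum => k _.
    rewrite /T mulr_sumr [X in X + _]big_mkcond [X in _ + X]big_mkcond -big_split /=.
    apply: ler_sum => j _; have := t0 k j; case: (leP (b j) (b k)) => [h|/ltW ->]; last by rewrite add0r.
    by move=> ?; rewrite lerDl; case: ifP.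
  under eq_bigr do rewrite /T mulr_sumr big_mkcond.
  rewrite exchange_big /=; apply: eq_bigr => k _; rewrite [RHS]big_mkcond /=.
  apply: eq_bigr => j _; case: ifP => // _.
  by rewrite -opprB mulrNz kapN; ring.
apply: le_trans split_le _.
have : \sum_(k <- r) b k ^+ 7 * T k <= 11.
  apply: (@le_trans _ _ (\sum_(k <- r) 11 * b k ^+ 8)).
    by rewrite big_seq [leRHS]big_seq; apply: ler_sum => k kr; exact: tk.
  by rewrite -mulr_sumr; lra.
lra.
Qed.

(** Both sequences are dominated by [2 * m], where [m] is half their maximum and again has l^8 norm
    at most 1. Since the kernel is positive, the quadratic bound for [m] suffices, and the two
    seventh powers give [2 ^ 14]. *)
Lemma hls_bilinear r b c : uniq r -> (forall j, 0 <= b j) -> (forall j, 0 <= c j) ->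
  \sum_(j <- r) b j ^+ 8 <= 1 -> \sum_(j <- r) c j ^+ 8 <= 1 ->
  \sum_(k <- r) c k ^+ 7 * (\sum_(j <- r) b j ^+ 7 * kap (j - k)%:~R) <= 22 * 2 ^+ 14.
Proof.
move=> ur b0 c0 bs cs.
pose m j := Num.max (b j) (c j) / 2.
have m0 j : 0 <= m j by rewrite divr_ge0// le_max b0.
have ms : \sum_(j <- r) m j ^+ 8 <= 1.
  apply: (@le_trans _ _ (\sum_(j <- r) (b j ^+ 8 / 2 + c j ^+ 8 / 2))).
    apply: ler_sum => j _; rewrite /m exprMn.
    have h8 : 2^-1 ^+ 8 <= 2^-1 :> R by rewrite exprS ler_piMr// exprn_ile1// invf_le1// ler1n.
    have e1 : 0 <= b j ^+ 8 by exact: exprn_ge0.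
    have e2 : 0 <= c j ^+ 8 by exact: exprn_ge0.
    apply: (@le_trans _ _ (Num.max (b j) (c j) ^+ 8 * 2^-1)).
      by rewrite ler_wpM2l// exprn_ge0// le_max b0.
    by have [_|_] := leP (b j) (c j); lra.
  by rewrite big_split -!mulr_suml /=; lra.
have := hls_quadratic ur m0 ms => h.
apply: (@le_trans _ _ (2 ^+ 14 * \sum_(k <- r) \sum_(j <- r) m k ^+ 7 * (m j ^+ 7 * kap (j - k)%:~R))); last first.
  by rewrite [leRHS]mulrC ler_wpM2l// exprn_ge0.
rewrite mulr_sumr; apply: ler_sum => k _; rewrite !mulr_sumr; apply: ler_sum => j _.
have -> : 2 ^+ 14 * (m k ^+ 7 * (m j ^+ 7 * kap (j - k)%:~R))
   = (2 * m k) ^+ 7 * ((2 * m j) ^+ 7 * kap (j - k)%:~R) by ring.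
rewrite /m ![2 * (_ / 2)]mulrC !divfK//.
apply: ler_pM; rewrite ?mulr_ge0 ?exprn_ge0 ?kap_ge0//.
  by rewrite lerXn2r ?nnegrE ?c0 ?le_max ?c0 ?lexx ?orbT.
by rewrite ler_wpM2r ?kap_ge0// lerXn2r ?nnegrE ?b0 ?le_max ?b0 ?lexx.
Qed.

(** As [c] runs over the nonnegative unit ball of l^8, [c ^+ 7] runs over that of l^(8/7), so this
    is duality with integral exponents. The extremal [c] is [z] divided by its l^8 norm. *)
Lemma dual8 (I : Type) (r : seq I) (z : I -> R) (C : R) : (forall q : I, 0 <= z q) -> 0 <= C ->
  (forall c : I -> R, (forall q : I, 0 <= c q) -> \sum_(q <- r) c q ^+ 8 <= 1 ->
     \sum_(q <- r) c q ^+ 7 * z q <= C) ->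
  \sum_(q <- r) z q ^+ 8 <= C ^+ 8.
Proof.
move=> z0 C0 hC; set S := \sum_(q <- r) z q ^+ 8.
have S0 : 0 <= S by apply: sumr_ge0 => q _; exact: exprn_ge0.
move: S0; rewrite le_eqVlt => /predU1P[<-|S0]; first exact: exprn_ge0.
pose s := S `^ 8^-1; have s0 : 0 < s by exact: powR_gt0.
have s8 : s ^+ 8 = S by rewrite -powR_mulrn ?ltW// -powRrM mulVf// powRr1// ltW.
have := hC (fun q => z q / s) (fun q => divr_ge0 (z0 q) (ltW s0)).
under eq_bigr do rewrite exprMn exprVn s8.
rewrite -mulr_suml divff ?gt_eqF// => /(_ (lexx _)).
under eq_bigr do rewrite exprMn mulrAC -exprSr.
rewrite -mulr_suml exprVn -/S => h.
have sC : s <= C by move: h; rewrite -s8 [s ^+ 8]exprS mulfK// expf_neq0// gt_eqF.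
by rewrite -s8 lerXn2r ?nnegrE// ltW.
Qed.

Lemma hls_potential r b : uniq r -> (forall j, 0 <= b j) -> \sum_(j <- r) b j ^+ 8 <= 1 ->
  \sum_(k <- r) (\sum_(j <- r) b j ^+ 7 * kap (j - k)%:~R) ^+ 8 <= (22 * 2 ^+ 14) ^+ 8.
Proof.
move=> ur b0 bs; apply: dual8.
- by move=> k; apply: sumr_ge0 => j _; rewrite mulr_ge0 ?exprn_ge0 ?kap_ge0.
- by rewrite mulr_ge0// exprn_ge0.
- by move=> c c0 cs; exact: hls_bilinear.
Qed.

End HardyLittlewoodSobolev.

(** * Superpositions of propagated point masses *)

Section Families.
Context {R : realType}.
Local Notation C := R[i].
Implicit Types (r : seq int) (b : int -> R) (j k n : int) (N : nat) (s t A : R).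

Lemma kap_shift (x y : R) : `|x - y| <= 1 -> kap x <= 2 * kap y.
Proof.
move=> xy; apply: ler_X4; rewrite ?mulr_ge0 ?kap_ge0// exprMn !kap4.
have h : 1 + `|y| <= 16 * (1 + `|x|).
  have : `|y| <= `|x| + `|x - y| by rewrite -[X in `|X| <= _](subKr x) ler_normB.
  by have := normr_ge0 x; lra.
have -> : (2 : R) ^+ 4 = 16 by ring.
by rewrite ler_pdivlMr ?onep_gt0// mulrC ler_pdivrMr ?onep_gt0.
Qed.

Lemma sum_sub_le (f : int -> R) r w : (forall n, 0 <= f n) -> uniq r -> uniq w ->
  {subset r <= w} -> \sum_(n <- r) f n <= \sum_(n <- w) f n.
Proof.
move=> f0 ur uw rw.
have -> : \sum_(n <- r) f n = \sum_(n <- w | n \in r) f n.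
  rewrite -[RHS]big_filter; apply: perm_big; apply: uniq_perm => //.
    by rewrite filter_uniq.
  by move=> n; rewrite mem_filter andb_idr// => /rw.
by rewrite big_mkcond /=; apply: ler_sum => n _; case: ifP.
Qed.

Lemma sumle_of_wsum (f : int -> R) A : (forall n, 0 <= f n) ->
  (forall N0, exists2 N, (N0 <= N)%N & wsum N f <= A) -> sumle f A.
Proof.
move=> f0 hA r ur; have [N hN] := hA (\max_(n <- r) absz n)%N.
apply: le_trans; rewrite wsum_seq; apply: sum_sub_le => //; first exact: uniq_window.
move=> n nr; rewrite -/(window N) mem_window; apply: leq_trans hN.
exact: (leq_bigmax_seq (F := absz)).
Qed.

Lemma nc_sqr_conj (z : C) : nc z ^+ 2 = complex.Re (z * (z^*)%C).
Proof. by rewrite nc_sqr; case: z => a b /=; ring. Qed.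

Lemma conj_sum (I : Type) (r : seq I) (f : I -> C) :
  ((\sum_(i <- r) f i)^*)%C = \sum_(i <- r) ((f i)^*)%C.
Proof. exact: raddf_sum. Qed.

Lemma wsum_sum (I : Type) (r : seq I) (f : I -> int -> C) N :
  wsum N (fun n => \sum_(i <- r) f i n) = \sum_(i <- r) wsum N (f i).
Proof. by rewrite /wsum exchange_big. Qed.

Lemma nc_conj (z : C) : nc (z^*)%C = nc z.
Proof. by case: z => a b /=; rewrite sqrrN. Qed.

Lemma Re_wsum N (f : int -> C) : complex.Re (wsum N f) = wsum N (fun n => complex.Re (f n)).
Proof. exact: Re_sum. Qed.

(* The square norm of a superposition of propagated point masses, through the
   group law (the TT^* identity). *)
Lemma gram_bound (I : eqType) (fam : seq I) (beta : I -> C) (sg : I -> R) (m : I -> int) (Q : I -> I -> R) :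
  (forall i i', i \in fam -> i' \in fam -> nc (kern (sg i - sg i') (m i' - m i)) <= Q i i') ->
  sumle (fun n => nc (\sum_(i <- fam) beta i * kern (sg i) (n - m i)) ^+ 2)
    (\sum_(i <- fam) \sum_(i' <- fam) nc (beta i) * nc (beta i') * Q i i').
Proof.
move=> hQ.
pose P := \sum_(i <- fam) \sum_(i' <- fam) nc (beta i) * nc (beta i').
have P0 : 0 <= P by apply: sumr_ge0 => i _; apply: sumr_ge0 => i' _; rewrite mulr_ge0 ?nc_ge0.
have ex e : 0 < e -> sumle (fun n => nc (\sum_(i <- fam) beta i * kern (sg i) (n - m i)) ^+ 2)
    (\sum_(i <- fam) \sum_(i' <- fam) nc (beta i) * nc (beta i') * Q i i' + e * P).
  move=> e0; apply: sumle_of_wsum => [n|N0]; first exact: sqr_ge0.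
  have hN : exists N1, forall N, (N1 <= N)%N -> forall i i', i \in fam -> i' \in fam ->
     nc (kern (- sg i' + sg i) (m i' - m i) - wsum N (fun n => kern (sg i) (n - m i) * kern (- sg i') (n - m i'))) <= e.
    have aux (l1 l2 : seq I) : exists N1, forall N, (N1 <= N)%N -> forall i i', i \in l1 -> i' \in l2 ->
     nc (kern (- sg i' + sg i) (m i' - m i) - wsum N (fun n => kern (sg i) (n - m i) * kern (- sg i') (n - m i'))) <= e.
      elim: l1 => [|i l1 [N1 h1]]; first by exists 0%N.
      have [N2 h2] : exists N2, forall N, (N2 <= N)%N -> forall i', i' \in l2 ->
         nc (kern (- sg i' + sg i) (m i' - m i) - wsum N (fun n => kern (sg i) (n - m i) * kern (- sg i') (n - m i'))) <= e.
        elim: l2 {h1} => [|i' l2 [N2 h2]]; first by exists 0%N.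
        have [N3 h3] := kern_group (sg i) (- sg i') (m i') (m i) e0.
        exists (maxn N2 N3) => N; rewrite geq_max => /andP[g2 g3] i''.
        by rewrite in_cons => /orP[/eqP ->|/h2]; [exact: h3|exact].
      exists (maxn N1 N2) => N; rewrite geq_max => /andP[g1 g2] i1 i' .
      by rewrite in_cons => /orP[/eqP -> /(h2 N g2)//|/(h1 N g1)]; apply.
    exact: aux.
  have [N1 {}hN] := hN; exists (maxn N0 N1); first exact: leq_maxl.
  set N := maxn N0 N1; have {}hN := hN N (leq_maxr _ _).
  have -> : wsum N (fun n => nc (\sum_(i <- fam) beta i * kern (sg i) (n - m i)) ^+ 2)
     = complex.Re (\sum_(i <- fam) \sum_(i' <- fam) beta i * (beta i')^*%C *
        wsum N (fun n => kern (sg i) (n - m i) * kern (- sg i') (n - m i'))).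
    under [in RHS]eq_bigr do under eq_bigr do rewrite -wsumZ.
    under [in RHS]eq_bigr do rewrite -wsum_sum.
    rewrite -wsum_sum Re_wsum; congr wsum; apply/funext => n.
    rewrite nc_sqr_conj conj_sum mulr_suml; congr complex.Re; apply: eq_bigr => i _.
    rewrite mulr_sumr; apply: eq_bigr => i' _; rewrite kernN rmorphM /=; ring.
  apply: le_trans (ler_norm _) _; apply: le_trans (le_Re_nc _) _.
  apply: le_trans (nc_sum _ _) _; rewrite /P mulr_sumr -big_split /= big_seq [leRHS]big_seq.
  apply: ler_sum => i ir; apply: le_trans (nc_sum _ _) _.
  rewrite mulr_sumr -big_split /= big_seq [leRHS]big_seq; apply: ler_sum => i' ir'.
  rewrite ncM ncM nc_conj [e * _]mulrC -mulrDr ler_wpM2l ?mulr_ge0 ?nc_ge0//.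
  have := hN i i' ir ir'; have := hQ i i' ir ir'; rewrite addrC => h1 h2.
  set z := wsum _ _ in h2 *; rewrite -[z](subKr (kern (- sg i' + sg i) (m i' - m i))).
  by apply: le_trans (ncB _ _) _; rewrite addrC in h1; rewrite lerD // addrC.
move=> r ur; apply/ler_addgt0Pr => e e0.
have P1 : 0 < P + 1 by rewrite ltr_wpDl.
have := ex (e / (P + 1)) (divr_gt0 e0 P1) r ur; move/le_trans; apply.
rewrite lerD2l mulrAC ler_pdivrMr// ler_pM2l//; lra.
Qed.

(** The Gram matrix is at most [42 * kap (sg j - sg k)]. A time shift of at most 1 costs a factor 2,
    and [hls_quadratic] sums the result. *)
Lemma family_energy r b (beta : int -> C) (sg : int -> R) (m : int -> int) :
  uniq r -> (forall j, 0 <= b j) -> \sum_(j <- r) b j ^+ 8 <= 1 ->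
  (forall j, nc (beta j) <= b j ^+ 7) ->
  (forall j k, j \in r -> k \in r -> `|(sg j - sg k) - (j - k)%:~R| <= 1) ->
  sumle (fun n => nc (\sum_(j <- r) beta j * kern (sg j) (n - m j)) ^+ 2) (84 * 22).
Proof.
move=> ur b0 bs bb hs.
have := @gram_bound _ r beta sg m (fun j k => 84 * kap (j - k)%:~R) _.
have hQ j k : j \in r -> k \in r -> nc (kern (sg j - sg k) (m k - m j)) <= 84 * kap (j - k)%:~R.
  move=> jr kr; apply: le_trans (kern_le _ _) _.
  by have := kap_shift (hs j k jr kr); lra.
move=> /(_ hQ) h r' ur'; apply: le_trans (h r' ur') _.
apply: le_trans (ler_wpM2l _ (hls_quadratic ur b0 bs)) => //.
rewrite exchange_big mulr_sumr; apply: ler_sum => k _; rewrite mulr_sumr; apply: ler_sum => j _.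
have -> : 84 * (b k ^+ 7 * (b j ^+ 7 * kap (j - k)%:~R))
  = b j ^+ 7 * b k ^+ 7 * (84 * kap (j - k)%:~R) by ring.
by rewrite ler_wpM2r ?mulr_ge0 ?kap_ge0// ler_pM ?nc_ge0.
Qed.

Lemma family_sup r b (beta : int -> C) (t : int -> R) (m : int -> int) k s n :
  (forall j, 0 <= b j) -> (forall j, nc (beta j) <= b j ^+ 7) ->
  (forall j, j \in r -> j%:~R <= t j <= (j + 1)%:~R) -> k%:~R <= s <= (k + 1)%:~R ->
  nc (\sum_(j <- r) beta j * kern (t j - s) (n - m j)) <=
  84 * \sum_(j <- r) b j ^+ 7 * kap (j - k)%:~R.
Proof.
move=> b0 bb ht hs; apply: le_trans (nc_sum _ _) _; rewrite mulr_sumr big_seq [leRHS]big_seq.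
apply: ler_sum => j jr; rewrite ncM mulrCA ler_pM ?nc_ge0//.
apply: le_trans (kern_le _ _) _.
have : `|(t j - s) - (j - k)%:~R| <= 1.
  move: (ht j jr) hs; rewrite !intrD intrN mulr1z => /andP[h1 h2] /andP[h3 h4].
  by rewrite ler_norml; apply/andP; split; lra.
by move=> /kap_shift; lra.
Qed.

End Families.

(** * Hoelder's inequality for finite sums *)

Section FiniteHoelder.
Context {R : realType}.
Implicit Types (p q S B : R).

Lemma powR_div (x s p : R) : 0 <= x -> 0 < s -> (x / s) `^ p = x `^ p / s `^ p.
Proof.
move=> x0 s0; rewrite powRM ?invr_ge0 ?(ltW s0)//; congr (_ * _).
by rewrite -powR_inv1 ?(ltW s0)// -powRrM mulN1r powRN.
Qed.

Lemma le_sum_mem (I : eqType) (r : seq I) (f : I -> R) i :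
  (forall i, 0 <= f i) -> i \in r -> f i <= \sum_(j <- r) f j.
Proof.
move=> f0; elim: r => // j r IH; rewrite in_cons big_cons => /orP[/eqP <-|/IH h].
  by rewrite lerDl sumr_ge0.
by rewrite (le_trans h)// lerDr.
Qed.

Lemma hoelder_fin (I : eqType) (r : seq I) (a b : I -> R) p q S B :
  (forall i, 0 <= a i) -> (forall i, 0 <= b i) -> 0 < p -> 0 < q -> p^-1 + q^-1 = 1 ->
  0 <= S -> 0 <= B -> \sum_(i <- r) a i `^ p <= S `^ p -> \sum_(i <- r) b i `^ q <= B `^ q ->
  \sum_(i <- r) a i * b i <= S * B.
Proof.
move=> a0 b0 p0 q0 pq.
have zero (c : I -> R) (e : R) i : (forall i, 0 <= c i) -> 0 < e -> i \in r ->
    \sum_(i <- r) c i `^ e <= 0 `^ e -> c i = 0.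
  move=> c0 e0 ir; rewrite powR0 ?gt_eqF// => h; apply: (@powR_eq0_eq0 _ _ e).
  apply/eqP; rewrite eq_le powR_ge0 andbT; apply: le_trans h.
  by apply: (le_sum_mem (f := fun i => c i `^ e)) ir => j; exact: powR_ge0.
rewrite le_eqVlt => /predU1P[<- _ h _|S0].
  rewrite mul0r big_seq big1// => i ir.
  by rewrite (zero a p i a0 p0 ir h) mul0r.
rewrite le_eqVlt => /predU1P[<- _ h|B0 ha hb].
  rewrite mulr0 big_seq big1// => i ir.
  by rewrite (zero b q i b0 q0 ir h) mulr0.
have Sp : 0 < S `^ p by exact: powR_gt0.
have Bq : 0 < B `^ q by exact: powR_gt0.
have key : \sum_(i <- r) (a i / S) * (b i / B) <= 1.
  apply: (@le_trans _ _ (\sum_(i <- r) (a i `^ p / S `^ p / p + b i `^ q / B `^ q / q))).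
    apply: ler_sum => i _.
    have := @conjugate_powR _ (a i / S) (b i / B) p q (divr_ge0 (a0 i) (ltW S0)) (divr_ge0 (b0 i) (ltW B0)) p0 q0 pq.
    by rewrite !powR_div.
  rewrite big_split /= -!mulr_suml -pq; apply: lerD.
    by rewrite ler_piMl ?invr_ge0 ?(ltW p0)// ler_pdivrMr// mul1r.
  by rewrite ler_piMl ?invr_ge0 ?(ltW q0)// ler_pdivrMr// mul1r.
have e : \sum_(i <- r) a i * b i = S * B * \sum_(i <- r) (a i / S) * (b i / B).
  by rewrite mulr_sumr; apply: eq_bigr => i _; field; rewrite !gt_eqF.
by rewrite e ler_piMr// mulr_ge0 ?ltW.
Qed.

End FiniteHoelder.

(** * Functions of time that are constant on unit cells *)

Section StepFunctions.
Context {R : realType}.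
Local Notation mu := (@lebesgue_measure R).
Implicit Types (v : int -> R) (r : seq int) (k : int) (s P : R).

Definition step v r s : R := if Num.floor s \in r then v (Num.floor s) else 0.

Definition cell k : set R := `[k%:~R, (k + 1)%:~R[%classic.

Lemma in_cell k s : cell k s <-> Num.floor s = k.
Proof.
rewrite /cell /= in_itv /=; split=> [h|<-]; first exact: floor_def.
exact: floor_itv.
Qed.

Lemma measurable_cell k : measurable (cell k).
Proof. exact: measurable_itv. Qed.

Lemma measure_cell k : mu (cell k) = 1%E.
Proof.
by rewrite /cell lebesgue_measure_itv /= lte_fin ltr_int ltrDl ltr01 -EFinB intrD mulr1z addrAC subrr add0r.
Qed.

Lemma stepE v r s : uniq r -> step v r s = \sum_(k <- r) v k * \1_(cell k) s.
Proof.
move=> ur; rewrite /step -sum_indic//; apply: eq_bigr => k _; congr (_ * _).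
rewrite !indicE; congr (nat_of_bool _)%:R; apply/idP/idP; rewrite !inE => h.
  exact/in_cell.
by move/in_cell : h.
Qed.

Lemma measurable_step v r : uniq r -> measurable_fun [set: measurableTypeR R] (step v r).
Proof.
move=> ur; rewrite (_ : step v r = fun s => \sum_(k <- r) v k * \1_(cell k) s); last first.
  by apply/funext => s; exact: stepE.
apply: measurable_sum => k; apply: measurable_funM => //.
by apply: measurable_indic; exact: measurable_cell.
Qed.

Lemma integral_step v r : uniq r -> (forall k, 0 <= v k) ->
  (\int[mu]_s (step v r s)%:E = (\sum_(k <- r) v k)%:E)%E.
Proof.
move=> ur v0; under eq_integral do rewrite stepE// -sumEFin.
rewrite ge0_integral_sum//; last 2 first.
- move=> k; apply/measurable_EFinP; apply: measurable_funM => //.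
  by apply: measurable_indic; exact: measurable_cell.
- by move=> k s _; rewrite lee_fin mulr_ge0.
rewrite -sumEFin; apply: eq_bigr => k _.
under eq_integral do rewrite EFinM.
rewrite ge0_integralZl//; last 2 first.
- by apply/measurable_EFinP; apply: measurable_indic; exact: measurable_cell.
- by rewrite lee_fin.
by rewrite integral_indic ?setIT//; [rewrite [X in (_ * X)%E]measure_cell mule1|exact: measurable_cell].
Qed.

Lemma integral_floor_le v P : (forall k, 0 <= v k) -> sumle v P ->
  (\int[mu]_s (v (Num.floor s))%:E <= P%:E)%E.
Proof.
move=> v0 vP.
pose g N s : \bar R := (step v (window N) s)%:E.
have uw N : uniq (window N) by exact: uniq_window.
have lg s : limn (g^~ s) = (v (Num.floor s))%:E.
  apply: cvg_lim => //; apply: cvg_near_cst; exists (absz (Num.floor s)) => // N /= nN.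
  by rewrite /g /step mem_window nN.
have -> : (\int[mu]_s (v (Num.floor s))%:E = \int[mu]_s limn (g^~ s))%E.
  by apply: eq_integral => s _; rewrite lg.
have mg N : measurable_fun [set: measurableTypeR R] (g N).
  by apply/measurable_EFinP; exact: measurable_step.
have g0 N s : [set: R] s -> (0 <= g N s)%E.
  by move=> _; rewrite /g lee_fin /step; case: ifP.
have gn s : [set: R] s -> {homo g^~ s : a b / (a <= b)%N >-> (a <= b)%E}.
  move=> _ a b ab; rewrite /g lee_fin /step !mem_window; case: ifPn => [na|].
    by rewrite (leq_trans na ab).
  by case: ifP.
rewrite (monotone_convergence _ measurableT mg g0 gn)//; apply: lime_le.
  apply: ereal_nondecreasing_is_cvgn => a b ab.
  by apply: nm_le_integral => s; [exact: (g0 _ _ I)|exact: (gn s I)].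
by apply: nearW => N; rewrite integral_step// lee_fin; apply: vP.
Qed.

End StepFunctions.

(** * Interpolation of exponents below the admissible line *)

Section Exponents.
Context {R : realType}.
Local Notation C := R[i].
Local Notation mu := (@lebesgue_measure R).
Implicit Types (q r : \bar R) (A x y : R) (w : int -> C) (beta : int -> R) (N : nat).

(** The weight of the l^2 bound when l^r is interpolated between l^2 and l^oo; it is 0 at
    [r = +oo]. *)
Definition theta r : R := if r is r0%:E then 2 / r0 else 0.

Lemma theta_range r : (2%:E <= r)%E -> 0 <= theta r <= 1.
Proof.
case: r => [r0||] //=; rewrite ?lexx ?ler01// lee_fin => h.
have r00 : 0 < r0 by lra.
by rewrite divr_ge0 ?(ltW r00)//= ler_pdivrMr// mul1r.
Qed.

(** The admissibility condition multiplied by [8 * q0]. Pairs strictly below the line give an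
    exponent above 8, which is harmless since it is applied to ratios at most 1. *)
Lemma strichartz_exponent (q0 : R) r : strichartz_pair q0%:E r -> 8 <= q0 * (1 - theta r).
Proof.
move=> [q2 r2 _]; rewrite lee_fin in q2; have q00 : 0 < q0 by lra.
rewrite inver gt_eqF//.
case: r r2 => [r0||] //= r2.
  rewrite lee_fin in r2; have r00 : 0 < r0 by lra.
  rewrite -EFinM inver gt_eqF ?mulr_gt0// -EFinD lee_fin => h.
  have h2 : q0 * (q0^-1 + (4 * r0)^-1) <= q0 * 8^-1 by rewrite ler_pM2l.
  have e : q0 * (q0^-1 + (4 * r0)^-1) = 1 + q0 / (4 * r0) by rewrite mulrDr divff ?gt_eqF.
  have e2 : q0 * (1 - 2 / r0) = q0 - 8 * (q0 / (4 * r0)) by field; rewrite gt_eqF.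
  by rewrite e2; rewrite e in h2; lra.
rewrite gt0_muley ?lte_fin// invey adde0 lee_fin => h.
rewrite subr0 mulr1; have := ler_wpM2l (ltW q00) h; rewrite divff ?gt_eqF//; lra.
Qed.

(** For [A > 0] this is [A ^ theta * x ^ (1 - theta)], the l^r bound for a sequence with l^2 norm at
    most [A] and values at most [x]. *)
Definition interp A r x : R := A * (x / A) `^ (1 - theta r).

Lemma interp_ge0 A r x : 0 <= A -> 0 <= interp A r x.
Proof. by move=> A0; rewrite mulr_ge0// powR_ge0. Qed.

Lemma powR_le1 x y : 0 <= x <= 1 -> 0 <= y -> x `^ y <= 1.
Proof.
move=> /andP[x0 x1] y0; have := ge0_ler_powR y0 x0 ler01 x1.
by rewrite powR1.
Qed.

Lemma ratio_range A x : 0 < A -> 0 <= x <= A -> 0 <= x / A <= 1.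
Proof. by move=> A0 /andP[x0 xA]; rewrite divr_ge0 ?(ltW A0)//= ler_pdivrMr// mul1r. Qed.

Lemma interp_le A r x : (2%:E <= r)%E -> 0 < A -> 0 <= x <= A -> interp A r x <= A.
Proof.
move=> r2 A0 xA; rewrite /interp ler_piMr ?(ltW A0)// powR_le1 ?ratio_range// subr_ge0.
by have /andP[] := theta_range r2.
Qed.

Lemma interp_powR A (q0 : R) r x : strichartz_pair q0%:E r -> 0 < A -> 0 <= x <= A ->
  interp A r x `^ q0 <= A `^ q0 * (x / A) ^+ 8.
Proof.
move=> hp A0 xA; have h8 := strichartz_exponent hp.
have := ratio_range A0 xA; rewrite /interp; move: (x / A) => y /andP[y0 y1].
rewrite powRM ?(ltW A0) ?powR_ge0// ler_wpM2l ?powR_ge0// -powRrM mulrC -powR_mulrn//.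
move: y0; rewrite le_eqVlt => /predU1P[<-|y0].
  by rewrite !powR0 ?pnatr_eq0// gt_eqF//; lra.
by apply: ger_powR => //; rewrite y0.
Qed.

Lemma lnorm_class A x r w : (2%:E <= r)%E -> 0 < A -> 0 <= x <= A ->
  sumle (fun n => nc (w n) ^+ 2) (A ^+ 2) -> (forall n, nc (w n) <= x) ->
  (lnorm r w <= (interp A r x)%:E)%E.
Proof.
move=> r2 A0 xA w2 wx; have /andP[x0 xA'] := xA.
have An : A != 0 by rewrite gt_eqF.
case: r r2 => [r0||] // r2; last first.
  apply/lnorm_infty_le; first exact/interp_ge0/ltW.
  by move=> n; rewrite /interp subr0 powRr1 ?divr_ge0 ?(ltW A0)// mulrC divfK.
rewrite lee_fin in r2; have r00 : 0 < r0 by lra.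
apply/lnorm_le => //; first exact/interp_ge0/ltW.
have /andP[y0 y1] := ratio_range A0 xA.
have -> : interp A r0%:E x `^ r0 = A `^ r0 * (x / A) `^ (r0 - 2).
  rewrite /interp powRM ?(ltW A0) ?powR_ge0// -powRrM; congr (_ * _ `^ _).
  by rewrite /theta; field; rewrite gt_eqF.
have -> : A `^ r0 * (x / A) `^ (r0 - 2) = (A `^ r0 * (x / A) `^ (r0 - 2) / A ^+ 2) * A ^+ 2.
  by rewrite divfK// expf_neq0.
have c0 : 0 <= A `^ r0 * (x / A) `^ (r0 - 2) / A ^+ 2.
  by rewrite divr_ge0 ?mulr_ge0 ?powR_ge0 ?exprn_ge0 ?ltW.
apply: sumle_mono (sumleZ c0 w2) => n /=.
have n0 := nc_ge0 (w n).
have -> : nc (w n) `^ r0 = A `^ r0 * ((nc (w n) / A) `^ (r0 - 2) * (nc (w n) / A) ^+ 2).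
  rewrite -powR_mulrn ?divr_ge0 ?(ltW A0)// -powRD; last first.
    by apply/implyP; rewrite subrK gt_eqF.
  by rewrite subrK powR_div// mulrCA divff ?mulr1// gt_eqF ?powR_gt0.
rewrite [X in _ <= X](_ : _ = A `^ r0 * ((x / A) `^ (r0 - 2) * (nc (w n) / A) ^+ 2)); last first.
  by field; rewrite An.
rewrite ler_wpM2l ?powR_ge0// ler_wpM2r ?sqr_ge0//.
apply: ge0_ler_powR; rewrite ?nnegrE ?subr_ge0 ?divr_ge0 ?(ltW A0)//.
by rewrite ler_pM2r ?invr_gt0.
Qed.

Lemma Lnorm_mono d (T : measurableType d) (m : {measure set T -> \bar R}) (q0 : R)
    (f g : T -> \bar R) : 0 < q0 -> (forall t, (`|f t| <= `|g t|)%E) ->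
  (Lnorm m q0%:E f <= Lnorm m q0%:E g)%E.
Proof.
move=> q00 fg; rewrite unlock.
have xin (y : \bar R) : (0 <= y)%E -> y \in `[0%E, +oo%E] by move=> y0; rewrite in_itv /= y0 leey.
have i0 (h : T -> \bar R) : (0 <= \int[m]_x poweR `|h x| q0)%E.
  by apply: integral_ge0 => t _; exact: poweR_ge0.
apply: (gt0_ler_poweR (r := q0^-1)); rewrite ?xin ?i0 ?invr_ge0 ?(ltW q00)//.
apply: nm_le_integral => t; first exact: poweR_ge0.
by apply: (gt0_ler_poweR (r := q0)); rewrite ?xin ?abse_ge0 ?(ltW q00).
Qed.

(* The interpolation between the two extreme pairs (oo, 2) and (8, oo):
   [beta k] bounds the sup norm of [u] on the time interval [k, k+1). *)
Lemma mixed_norm_le A beta q r (u : R -> int -> C) : strichartz_pair q r -> 0 < A ->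
  (forall k, 0 <= beta k <= A) -> sumle (fun k => beta k ^+ 8) (A ^+ 8) ->
  (forall t, sumle (fun n => nc (u t n) ^+ 2) (A ^+ 2)) ->
  (forall t n, nc (u t n) <= beta (Num.floor t)) -> (mixed_norm q r u <= A%:E)%E.
Proof.
move=> hp A0 bA b8 u2 ub; have [q2 r2 _ _] := hp.
have An : A != 0 by rewrite gt_eqF.
have pt t : (lnorm r (u t) <= (interp A r (beta (Num.floor t)))%:E)%E.
  exact: lnorm_class.
have norm_abs t : (`|lnorm r (u t)| = lnorm r (u t))%E by rewrite gee0_abs// lnorm_ge0.
rewrite /mixed_norm; case: q q2 hp => [q0||] // q2 hp; last first.
  rewrite unlock; case: ifP => // _; last by rewrite lee_fin ltW.
  apply/ess_supP; apply: nearW => t /=; rewrite norm_abs; apply: le_trans (pt t) _.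
  by rewrite lee_fin interp_le.
rewrite lee_fin in q2; have q00 : 0 < q0 by lra.
apply: (@le_trans _ _ (Lnorm mu q0%:E (fun t => (interp A r (beta (Num.floor t)))%:E))).
  apply: Lnorm_mono => // t; rewrite norm_abs; apply: le_trans (pt t) _.
  by rewrite gee0_abs// lee_fin interp_ge0 ?ltW.
rewrite unlock le_poweR_inv ?(ltW A0)//; last by apply: integral_ge0 => t _; exact: poweR_ge0.
under eq_integral do rewrite gee0_abs ?lee_fin ?interp_ge0 ?(ltW A0)// poweR_EFin.
apply: (integral_floor_le (v := fun k => interp A r (beta k) `^ q0)); first by move=> k; exact: powR_ge0.
have c0 : 0 <= A `^ q0 / A ^+ 8 by rewrite divr_ge0 ?powR_ge0 ?exprn_ge0 ?ltW.
rewrite -[X in sumle _ X](divfK (expf_neq0 8 An)).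
apply: sumle_mono (sumleZ c0 b8) => k; apply: le_trans (interp_powR hp A0 (bA k)) _.
by rewrite exprMn exprVn mulrA mulrAC.
Qed.

Lemma hoelder_conjugate_fin r : (2%:E <= r)%E -> exists2 p : R, 0 < p &
  hoelder_conjugate r = p%:E /\ (if r is r0%:E then p^-1 + r0^-1 = 1 else p = 1).
Proof.
case: r => [r0||] // r2; last by exists 1.
rewrite lee_fin in r2; exists (r0 / (r0 - 1)); first by rewrite divr_gt0; lra.
split.
  rewrite /hoelder_conjugate /= eqe gt_eqF; last by lra.
  by rewrite -EFinD inver gt_eqF// subr_gt0; lra.
by rewrite invf_div mulrBl mul1r subrK divff// gt_eqF//; lra.
Qed.

Lemma pointwise_pairing A x r (p : R) (a : int -> R) w N :
  (2%:E <= r)%E -> 0 < p -> (if r is r0%:E then p^-1 + r0^-1 = 1 else p = 1) ->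
  0 < A -> 0 <= x <= A -> sumle (fun n => nc (w n) ^+ 2) (A ^+ 2) ->
  (forall n, nc (w n) <= x) -> (forall n, 0 <= a n) ->
  wsum N (fun n => a n * nc (w n)) <= (wsum N (fun n => a n `^ p)) `^ p^-1 * interp A r x.
Proof.
move=> r2 p0 pr A0 xA w2 wx a0; have := lnorm_class r2 A0 xA w2 wx.
have i0 := interp_ge0 r x (ltW A0).
have s0 : 0 <= wsum N (fun n => a n `^ p) by apply: wsum_ge0 => n; exact: powR_ge0.
case: r r2 pr i0 => [r0||] // r2 pr i0.
  rewrite lee_fin in r2; have r00 : 0 < r0 by lra.
  move=> /(lnorm_le _ r00 i0) hw; rewrite !wsum_seq; apply: (@hoelder_fin _ _ _ _ _ p r0) => //.
  - by move=> n; exact: nc_ge0.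
  - exact: powR_ge0.
  - by rewrite -wsum_seq -powRrM mulVf ?gt_eqF// powRr1.
  - by apply: hw; exact: uniq_window.
move=> /(lnorm_infty_le _ i0) hw; rewrite pr invr1 powRr1; last by rewrite -pr.
under [X in _ <= wsum N X * _]eq_fun do rewrite powRr1//.
by rewrite /wsum mulr_suml; apply: ler_sum => k _; rewrite ler_wpM2l.
Qed.

End Exponents.

(** * Hoelder's inequality between the class and the source *)

Section Sources.
Context {R : realType}.
Local Notation C := R[i].
Local Notation mu := (@lebesgue_measure R).
Implicit Types (q r : \bar R) (A x y p : R) (w : int -> C) (beta : int -> R) (N : nat) (F : R -> int -> C).

Lemma nc_powR (z : C) : nc z = (complex.Re z ^+ 2 + complex.Im z ^+ 2) `^ 2^-1.
Proof. by rewrite -nc_sqr -powR_mulrn ?nc_ge0// -powRrM mulfV ?powRr1 ?nc_ge0. Qed.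

Lemma measurable_nc F n : measurable_source F ->
  measurable_fun [set: measurableTypeR R] (fun s => nc (F s n)).
Proof.
move=> mF; under eq_fun do rewrite nc_powR; have [m1 m2] := mF n.
apply: (measurableT_comp (measurable_powR 2^-1)).
by apply: measurable_funD; apply: measurable_funX.
Qed.

(** A finite window makes the measurability in time follow from that of each site. *)
Definition window_norm N p F s := wsum N (fun n => nc (F s n) `^ p) `^ p^-1.

Lemma measurable_window_norm N p F : measurable_source F ->
  measurable_fun [set: measurableTypeR R] (window_norm N p F).
Proof.
move=> mF; apply: (measurableT_comp (measurable_powR p^-1)).
apply: measurable_sum => k; apply: (measurableT_comp (measurable_powR p)).
exact: measurable_nc.
Qed.

Lemma window_norm_ge0 N p F s : 0 <= window_norm N p F s.
Proof. exact: powR_ge0. Qed.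

Lemma window_norm_le N p F s : 0 < p -> ((window_norm N p F s)%:E <= lnorm p%:E (F s))%E.
Proof.
move=> p0; have := lnorm_ge0 p%:E (F s).
case e : (lnorm p%:E (F s)) => [x||] // x0; last by rewrite leey.
rewrite lee_fin in x0.
have : (lnorm p%:E (F s) <= x%:E)%E by rewrite e.
move=> /(lnorm_le _ p0 x0) h; rewrite lee_fin /window_norm.
have := h _ (uniq_window N); rewrite -wsum_seq => hw.
have w0 : 0 <= wsum N (fun n => nc (F s n) `^ p) by apply: wsum_ge0 => n; exact: powR_ge0.
have ip : 0 <= p^-1 by rewrite invr_ge0 ltW.
by have := ge0_ler_powR ip w0 (powR_ge0 _ _) hw; rewrite -powRrM mulfV ?gt_eqF// powRr1.
Qed.

Lemma integral_window_norm q r F N A beta rr (p : R) : strichartz_pair q r -> 0 < A ->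
  (forall k, 0 <= beta k <= A) -> uniq rr -> \sum_(k <- rr) beta k ^+ 8 <= A ^+ 8 ->
  measurable_source F -> 0 < p ->
  (\int[mu]_s (window_norm N p F s * step (fun k => interp A r (beta k)) rr s)%:E <=
   A%:E * mixed_norm (hoelder_conjugate q) p%:E F)%E.
Proof.
move=> hp A0 bA ur b8 mF p0; have [q2 r2 _ _] := hp.
have An : A != 0 by rewrite gt_eqF.
pose h := step (fun k => interp A r (beta k)) rr.
have h0 s : 0 <= h s by rewrite /h /step; case: ifP => // _; rewrite interp_ge0// ltW.
have mh : measurable_fun [set: measurableTypeR R] h by exact: measurable_step.
have mw := measurable_window_norm N p mF.
have w0 := window_norm_ge0 N p F.
have wl s := window_norm_le N F s p0.
have labs s : (`|lnorm p%:E (F s)| = lnorm p%:E (F s))%E by rewrite gee0_abs// lnorm_ge0.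
case: q q2 hp => [q0||] // q2 hp; last first.
  rewrite hoelder_conjugatey /mixed_norm Lnorm1.
  apply: (@le_trans _ _ (\int[mu]_s (A%:E * (window_norm N p F s)%:E))%E).
    apply: nm_le_integral => s; rewrite lee_fin; first by rewrite mulr_ge0.
    rewrite mulrC ler_wpM2r// /step.
    by case: ifP => _; [exact: interp_le|exact: ltW].
  rewrite ge0_integralZl_EFin ?(ltW A0)//; last 2 first.
  - by move=> s _; rewrite lee_fin.
  - exact/measurable_EFinP.
  apply: lee_pmul; rewrite ?lee_fin ?(ltW A0)//; first by apply: integral_ge0 => s _; rewrite lee_fin.
  by apply: nm_le_integral => s; rewrite ?lee_fin// labs.
have [p1 p10 [-> hp1]] := hoelder_conjugate_fin q2.
rewrite lee_fin in q2; have q00 : 0 < q0 by lra.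
have := @hoelder _ _ _ mu (window_norm N p F) h p1 q0 mw mh p10 q00 hp1.
rewrite Lnorm1; under eq_integral do rewrite /= ger0_norm ?mulr_ge0//.
move=> /le_trans; apply; rewrite muleC; apply: lee_pmul; rewrite ?Lnorm_ge0//.
  rewrite unlock le_poweR_inv ?(ltW A0)//; last by apply: integral_ge0 => t _; exact: poweR_ge0.
  under eq_integral do rewrite /= ger0_norm// ?poweR_EFin.
  have e s : h s `^ q0 = step (fun k => interp A r (beta k) `^ q0) rr s.
    by rewrite /h /step; case: ifP => // _; rewrite powR0// gt_eqF.
  under eq_integral do rewrite e.
  rewrite integral_step//; last by move=> k; exact: powR_ge0.
  rewrite lee_fin.
  apply: (@le_trans _ _ (\sum_(k <- rr) A `^ q0 / A ^+ 8 * beta k ^+ 8)).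
    apply: ler_sum => k _; apply: le_trans (interp_powR hp A0 (bA k)) _.
    by rewrite exprMn exprVn mulrA mulrAC.
  by rewrite -mulr_sumr -[leRHS](divfK (expf_neq0 8 An)) ler_wpM2l// divr_ge0 ?powR_ge0 ?exprn_ge0 ?ltW.
apply: Lnorm_mono => // s; rewrite labs gee0_abs ?lee_fin//; exact: wl.
Qed.

(* Hoelder in space with the interpolated exponent, then in time. *)
Lemma source_dominant q r F N A beta rr : strichartz_pair q r -> 0 < A ->
  (forall k, 0 <= beta k <= A) -> uniq rr -> \sum_(k <- rr) beta k ^+ 8 <= A ^+ 8 ->
  measurable_source F ->
  exists g : R -> R, [/\ measurable_fun [set: measurableTypeR R] g, forall s, 0 <= g s,
    (\int[mu]_s (g s)%:E <= A%:E * mixed_norm (hoelder_conjugate q) (hoelder_conjugate r) F)%E &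
    forall k s w, k \in rr -> Num.floor s = k -> sumle (fun n => nc (w n) ^+ 2) (A ^+ 2) ->
      (forall n, nc (w n) <= beta k) -> wsum N (fun n => nc (F s n) * nc (w n)) <= g s].
Proof.
move=> hp A0 bA ur b8 mF; have [_ r2 _ _] := hp.
have [p p0 [-> hpr]] := hoelder_conjugate_fin r2.
exists (fun s => window_norm N p F s * step (fun k => interp A r (beta k)) rr s); split.
- by apply: measurable_funM; [exact: measurable_window_norm|exact: measurable_step].
- move=> s; rewrite mulr_ge0 ?window_norm_ge0// /step; case: ifP => // _.
  by rewrite interp_ge0// ltW.
- exact: integral_window_norm.
- move=> k s w kr sk w2 wb; rewrite /step sk kr.
  by apply: pointwise_pairing => // n; exact: nc_ge0.
Qed.

End Sources.

(** * Local bounds and derivatives of a solution *)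

Section SolutionFacts.
Context {R : realType}.
Local Notation C := R[i].
Local Notation mu := (@lebesgue_measure R).
Local Notation AC := (@absolutely_continuous_on R).
Implicit Types (a b c d s t x S : R) (n m : int) (N : nat) (u F : R -> int -> C) (phi : int -> C).

Lemma lnorm2_sumle phi x : 0 <= x -> (lnorm 2%:E phi <= x%:E)%E ->
  sumle (fun n => nc (phi n) ^+ 2) (x ^+ 2).
Proof.
move=> x0 /(lnorm_le _ (ltr0n _ 2) x0) h; rewrite powR_mulrn// in h.
by apply: sumle_mono h => n; rewrite powR_mulrn// nc_ge0.
Qed.

Lemma sumle_nc_le phi x n : 0 <= x -> sumle (fun n => nc (phi n) ^+ 2) (x ^+ 2) -> nc (phi n) <= x.
Proof.
move=> x0 /(_ [:: n] isT); rewrite big_seq1 => h.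
by rewrite -(ler_pXn2r (n := 2)) ?nnegrE ?nc_ge0.
Qed.

(** Continuity in l^2 bounds the values near each time, and compactness of [[-S, S]] makes the bound
    uniform. This is where the l^2 continuity of [u] enters; the boundary terms at [|n| = N] vanish
    because of it. *)
Lemma solution_bounded u F S : bischrodinger_solution u F ->
  exists2 a, 0 <= a & forall s n, `|s| <= S -> nc (u s n) <= a.
Proof.
move=> su.
have := (compact_near_coveringP `[- S, S]%classic).1 (@segment_compact R (- S) S).
move=> /(_ nat \oo (fun N s => forall n, nc (u s n) <= N%:R) _) H.
suff /H [N0 _ /(_ N0 (leqnn _)) h] : forall t, `[- S, S]%classic t ->
    \forall t' \near t & N \near \oo, forall n, nc (u t' n) <= N%:R.
  exists N0%:R => // s n sS.
  by apply: h; rewrite /= in_itv /= -ler_norml.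
move=> t _.
have ut := solution_l2 su t; have uc := solution_continuous su t.
pose x := fine (lnorm 2%:E (u t)).
have x0 : 0 <= x by rewrite fine_ge0 ?lnorm_ge0.
have ex : lnorm 2%:E (u t) = x%:E by rewrite fineK// ge0_fin_numE ?lnorm_ge0.
have hx n : nc (u t n) <= x by apply: sumle_nc_le => //; apply: lnorm2_sumle => //; rewrite ex.
have near1 : \forall s \near t, (lnorm 2%:E (fun n => u s n - u t n)%R <= 1%:E)%E.
  have : \forall y \near nbhs (0%E : \bar R), (y <= 1%:E)%E.
    exists 1 => //= y; rewrite /ball_ /= sub0r normrN => h; rewrite lee_fin; have := ler_norm y; lra.
  by move/uc.
exists ([set s | (lnorm 2%:E (fun n => u s n - u t n)%R <= 1%:E)%E],
        [set N | x + 1 <= N%:R]); first by split => //=; exact: nbhs_infty_ger.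
move=> [s N] /= [h1 h2] n; apply: le_trans h2.
have -> : u s n = u t n + (u s n - u t n) by rewrite addrC subrK.
apply: le_trans (ncD _ _) _; apply: lerD; first exact: hx.
by apply: (@sumle_nc_le (fun n => u s n - u t n)) => //; exact: lnorm2_sumle.
Qed.

(** One null set per site, and countably many sites. *)
Lemma solution_drv u F : bischrodinger_solution u F ->
  {ae mu, forall s : R, forall n, cdrv (u ^~ n) s (- ('i%C * bilaplacian (u s) n) + 'i%C * F s n)}.
Proof.
move=> su.
have fF : Filter (almost_everywhere mu) by exact: ae_filter_ringOfSetsType.
have one n : {ae mu, forall s : R, cdrv (u ^~ n) s (- ('i%C * bilaplacian (u s) n) + 'i%C * F s n)}.
  apply: filterS (solution_eq su n) => s [d1 [d2 e]].
  have -> : - ('i%C * bilaplacian (u s) n) + 'i%C * F s n =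
      (derive1 (re_at u n) s +i* derive1 (im_at u n) s)%C.
    move: e; set z := (derive1 (re_at u n) s +i* _)%C => e.
    have e' : bilaplacian (u s) n - F s n = 'i%C * z.
      by move/eqP: e; rewrite -addrA addr_eq0 => /eqP ->; rewrite opprD !opprK.
    rewrite -mulrN -mulrDr; have -> : - bilaplacian (u s) n + F s n = - ('i%C * z).
      by rewrite -e'; move: (bilaplacian _ _) => b; rewrite opprB addrC.
    by rewrite mulrN mulrA -expr2 sqr_i mulN1r opprK.
  by split; rewrite /= derive1E; apply: derivableP.
have h1 : {ae mu, forall s : R, forall N, cdrv (u ^~ (Posz N)) s (- ('i%C * bilaplacian (u s) (Posz N)) + 'i%C * F s (Posz N))}.
  exact: ae_foralln.
have h2 : {ae mu, forall s : R, forall N, cdrv (u ^~ (Negz N)) s (- ('i%C * bilaplacian (u s) (Negz N)) + 'i%C * F s (Negz N))}.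
  by apply: ae_foralln.
by apply: filterS2 h1 h2 => s g1 g2 [N|N].
Qed.

Lemma ae_notin (r : seq R) : {ae mu, forall s : R, s \notin r}.
Proof.
have cr : countable [set` r] by apply: finite_set_countable; exact: finite_seq.
exists [set` r]; split.
- by apply: countable_measurable => // t; exact: measurable_set1.
- exact: countable_lebesgue_measure0.
- by move=> s /= /negP; rewrite negbK.
Qed.

Lemma drv_near f (g : R -> R) x l : (\forall y \near x, f y = g y) -> is_derive x 1 f l -> is_derive x 1 g l.
Proof. exact: near_eq_is_derive. Qed.

End SolutionFacts.

(** * Moving all evaluation times along one parameter *)

Section Paths.
Context {R : realType}.
Local Notation C := R[i].
Local Notation AC := (@absolutely_continuous_on R).
Implicit Types (a b c d s t x S T : R) (n m : int) (N : nat) (u F : R -> int -> C) (f : R -> R).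

(* Moving [s] through the line moves [path t s] from 0 to [t], or backwards
   from [t] to 0 when [t < 0]; [chi] is the signed speed. *)
Definition path t s := clamp (Num.min 0 t) (Num.max 0 t) s.
Definition orient t : R := if 0 <= t then 1 else -1.
Definition chi t s : R := if 0 < s < t then 1 else if t < s < 0 then -1 else 0.

Lemma path_ends t f S : `|t| <= S ->
  orient t * f (path t S) - orient t * f (path t (- S)) = f t - f 0.
Proof.
rewrite ler_norml => /andP[h1 h2]; rewrite /path /orient.
have [t0|t0] /= := leP 0 t.
  rewrite !clampE// !mul1r; congr (f _ - f _).
    by have [h|h] := leP S 0; [lra|have [h'|h'] := leP S t; lra].
  by rewrite ifT//; lra.
rewrite !clampE ?(ltW t0)// !mulN1r opprK addrC; congr (f _ - f _).
  by rewrite ifT//; lra.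
by have [h|h] := leP S t; [lra|have [h'|h'] := leP S 0; lra].
Qed.

Lemma drv_const_clamp c d f e z x y s : c <= d -> x < s -> s < y ->
  (forall w, x < w -> w < y -> clamp c d w = z) ->
  is_derive s 1 (fun w : R => e * f (clamp c d w)) 0.
Proof.
move=> cd xs sy hz; apply: (@drv_near _ _ _ _ _ _ (drvC (e * f z) s)).
have : s \in `]x, y[ by rewrite in_itv /= xs.
by move=> /near_in_itvoo; apply: filterS => w; rewrite in_itv /= => /andP[h1 h2]; rewrite hz.
Qed.

Lemma drv_clamp c d f e l s : c < s -> s < d -> is_derive s 1 f l ->
  is_derive s 1 (fun w : R => e * f (clamp c d w)) (e * l).
Proof.
move=> cs sd df; apply: (@drv_near _ _ _ _ _ _ (drvZ e df)).
have : s \in `]c, d[ by rewrite in_itv /= cs.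
move=> /near_in_itvoo; apply: filterS => w; rewrite in_itv /= => /andP[h1 h2].
by rewrite clampE; [have [?|?] := leP w c; [lra|have [?|?] := leP w d; lra]|lra].
Qed.

(** Away from the corners 0 and [t] the path is locally constant or the identity. *)
Lemma path_drv t s f l : s != 0 -> s != t -> is_derive s 1 f l ->
  is_derive s 1 (fun y : R => orient t * f (path t y)) (chi t s * l).
Proof.
move=> s0 st df; rewrite /path /orient /chi.
have out c d e : c < d -> s < c \/ d < s -> is_derive s 1 (fun w : R => e * f (clamp c d w)) (0 * l).
  move=> cd; rewrite mul0r => -[h|h].
    by apply: (@drv_const_clamp _ _ _ _ c (s - 1) c); rewrite ?(ltW cd)//; [lra|move=> w h1 h2; rewrite clampE ?ifT//; lra].
  by apply: (@drv_const_clamp _ _ _ _ d d (s + 1)); rewrite ?(ltW cd)//; [lra|move=> w h1 h2; rewrite clampE ?ifF//; lra].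
have [t0|t0] /= := leP 0 t.
  case: ifP => [/andP[h1 h2]|]; first exact: drv_clamp.
  move=> h; case: ifP => [/andP[? ?]|_]; first lra.
  move: t0; rewrite le_eqVlt => /predU1P[t0|t0].
    rewrite -t0 mul0r; apply: (@drv_const_clamp _ _ _ _ 0 (s - 1) (s + 1)) => //; [lra|lra|].
    by move=> w _ _; rewrite clampE//; case: leP => // h1; rewrite ifF//; lra.
  apply: out => //; have [|sp] := ltP s 0; first by left.
  have {s0}sp : 0 < s by rewrite lt_neqAle eq_sym s0.
  by right; rewrite lt_neqAle eq_sym st leNgt; move: h; rewrite sp /= => ->.
case: ifP => [/andP[? ?]|_]; first lra.
case: ifP => [/andP[h1 h2]|h]; first exact: drv_clamp.
apply: out => //; have [|sp] := ltP 0 s; first by right.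
have {s0}sp : s < 0 by rewrite lt_neqAle s0.
by left; rewrite lt_neqAle st leNgt; move: h; rewrite sp andbT => ->.
Qed.

Lemma chi_le1 t s : `|chi t s| <= 1.
Proof. by rewrite /chi; case: ifP => _; [|case: ifP => _]; rewrite ?normrN ?normr1 ?normr0. Qed.

Lemma chi_out t s S : `|t| <= S -> S < `|s| -> chi t s = 0.
Proof.
rewrite ler_norml => /andP[h1 h2]; rewrite ltr_normr /chi => h.
by case: ifP => [/andP[? ?]|_]; [case/orP: h; lra|case: ifP => [/andP[? ?]|//]; case/orP: h; lra].
Qed.

Lemma ac_path f t a b : (forall c d, c <= d -> AC f c d) -> AC (fun s => orient t * f (path t s)) a b.
Proof.
have cd : Num.min 0 t <= Num.max 0 t by rewrite ge_min !le_max lexx.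
by move=> acf; apply: acZ; apply: (ac_clamp _ _ cd (acf _ _ cd)).
Qed.

Lemma lap_le (phi : int -> C) a n : (forall n, nc (phi n) <= a) -> nc (discrete_laplacian phi n) <= 4 * a.
Proof.
move=> h; rewrite /discrete_laplacian mulr2n.
apply: le_trans (ncB _ _) _.
have := ncD (phi (n + 1)) (phi (n - 1)); have := ncD (phi n) (phi n).
have := h (n + 1); have := h (n - 1); have := h n; lra.
Qed.

Lemma ac_kern T m n c d : AC (fun s => complex.Re (kern (T - s) (n - m))) c d /\
  AC (fun s => complex.Im (kern (T - s) (n - m))) c d.
Proof.
have hb s : nc ('i%C * bilaplacian (fun k => kern (T - s) (k - m)) n) <= 4 * (4 * 42).
  rewrite ncM nci mul1r; apply: lap_le => k; apply: lap_le => k'; exact: kern_le42.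
have hd s := cdrv_kern_rev T m n s.
split; apply: (@ac_lip _ _ _ _ (4 * (4 * 42))); rewrite ?mulr_ge0// => y z _ yz _.
  apply: (increment_norm yz (fun s _ => (hd s).1)) => s _.
  exact: le_trans (le_Re_nc _) (hb s).
apply: (increment_norm yz (fun s _ => (hd s).2)) => s _.
exact: le_trans (le_Im_nc _) (hb s).
Qed.

Definition pairing u T m N s : C := wsum N (fun n => u s n * kern (T - s) (n - m)).

Lemma ac_pairing u F T m N (al : C) c d : bischrodinger_solution u F ->
  AC (fun s => complex.Re (al * pairing u T m N s)) c d.
Proof.
move=> su; pose S := Num.max `|c| `|d|.
have [a a0 ua] := solution_bounded S su.
have inS s : c <= s <= d -> `|s| <= S.
  move=> /andP[h1 h2]; rewrite ler_norml lerNl /S !le_max !ler_normr lerN2 h1 h2 !orbT.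
  by [].
pose L := Num.max a 42.
have L0 : 0 <= L by rewrite le_max a0.
have bu s n : c <= s <= d -> nc (u s n) <= L by move=> /inS h; rewrite le_max ua.
have bk s n : nc (kern (T - s) (n - m)) <= L by rewrite le_max kern_le42 orbT.
have prod (f g : R -> R) : (forall s, c <= s <= d -> `|f s| <= L) -> (forall s, `|g s| <= L) ->
  AC f c d -> AC g c d -> AC (fun s => f s * g s) c d.
  by move=> h1 h2; apply: (acM L0) => // s _; exact: h2.
have term n : AC (fun s => complex.Re (u s n * kern (T - s) (n - m))) c d /\
              AC (fun s => complex.Im (u s n * kern (T - s) (n - m))) c d.
  have [ar ai] := solution_ac su n; have [kr ki] := ac_kern T m n c d.
  have b1 s : c <= s <= d -> `|complex.Re (u s n)| <= L by move=> h; exact: le_trans (le_Re_nc _) (bu _ _ h).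
  have b2 s : c <= s <= d -> `|complex.Im (u s n)| <= L by move=> h; exact: le_trans (le_Im_nc _) (bu _ _ h).
  have b3 s : `|complex.Re (kern (T - s) (n - m))| <= L by exact: le_trans (le_Re_nc _) (bk _ _).
  have b4 s : `|complex.Im (kern (T - s) (n - m))| <= L by exact: le_trans (le_Im_nc _) (bk _ _).
  split.
    rewrite (_ : (fun s => _) = fun s => complex.Re (u s n) * complex.Re (kern (T - s) (n - m)) +
      -1 * (complex.Im (u s n) * complex.Im (kern (T - s) (n - m)))); last first.
      by apply/funext => s; rewrite ReM mulN1r.
    exact: (acD (prod _ _ b1 b3 (ar c d) kr) (acZ (-1) (prod _ _ b2 b4 (ai c d) ki))).
  under eq_fun do rewrite ImM.
  exact: (acD (prod _ _ b1 b4 (ar c d) ki) (prod _ _ b2 b3 (ai c d) kr)).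
have sumR : AC (fun s => complex.Re (pairing u T m N s)) c d.
  under eq_fun do rewrite /pairing Re_sum.
  apply: (ac_sum _ (F := fun (k : 'I_(N.*2.+1)) s => complex.Re (u s (k%:Z - N%:Z) * kern (T - s) (k%:Z - N%:Z - m)))).
  by move=> k; have [] := term (k%:Z - N%:Z).
have sumI : AC (fun s => complex.Im (pairing u T m N s)) c d.
  under eq_fun do rewrite /pairing Im_sum.
  apply: (ac_sum _ (F := fun (k : 'I_(N.*2.+1)) s => complex.Im (u s (k%:Z - N%:Z) * kern (T - s) (k%:Z - N%:Z - m)))).
  by move=> k; have [] := term (k%:Z - N%:Z).
rewrite (_ : (fun s => _) = fun s => complex.Re al * complex.Re (pairing u T m N s) +
  - complex.Im al * complex.Im (pairing u T m N s)); last first.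
  by apply/funext => s; rewrite ReM mulNr.
exact: (acD (acZ (complex.Re al) sumR) (acZ (- complex.Im al) sumI)).
Qed.

Lemma drv_pairing u F T m N (al : C) s :
  (forall n, cdrv (u ^~ n) s (- ('i%C * bilaplacian (u s) n) + 'i%C * F s n)) ->
  is_derive s 1 (fun s => complex.Re (al * pairing u T m N s))
    (complex.Re (al * ('i%C * (wsum N (fun n => F s n * kern (T - s) (n - m)) + boundary u T m s N)))).
Proof. by move=> /(cdrv_pairing T m N) /(cdrvZ al) []. Qed.

Lemma pairing_end u T m N : (absz m <= N)%N -> pairing u T m N T = u T m.
Proof.
by move=> mN; rewrite /pairing subrr; under eq_fun do rewrite kern0; rewrite wsum_delta//; lia.
Qed.

End Paths.

(** * Duality between values of the solution and the source *)

Section Duality.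
Context {R : realType}.
Local Notation C := R[i].
Local Notation mu := (@lebesgue_measure R).
Local Notation AC := (@absolutely_continuous_on R).
Variables (I : eqType) (fam : seq I) (al : I -> C) (t : I -> R) (m : I -> int).
Implicit Types (s S X Y e : R) (n : int) (N : nat) (u F : R -> int -> C) (i : I).

(** What [F s] is paired with when the combination of pairings is differentiated along the paths:
    each kernel acts only for [s] between 0 and [t i]. *)
Definition test_wave s n : C :=
  \sum_(i <- fam) (chi (t i) s)%:C%C * (al i * kern (t i - s) (n - m i)).

Lemma boundary_small_uniform u F S e : bischrodinger_solution u F -> 0 <= S -> 0 < e ->
  exists N0, forall N, (N0 <= N)%N -> forall i, i \in fam -> forall s, `|s| <= S ->
    nc (boundary u (t i) (m i) s N) <= e.
Proof.
move=> su S0 e0; have [a a0 ua] := solution_bounded S su.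
elim: fam => [|i r [N1 h1]]; first by exists 0%N.
have [N2 h2] := boundary_small (t i) (m i) a0 S0 ua e0.
exists (maxn N1 N2) => N; rewrite geq_max => /andP[n1 n2] j; rewrite in_cons => /orP[/eqP ->|jr] s sS.
  exact: h2.
exact: h1.
Qed.

Lemma pairing_speed_le u F N e S s : 0 <= e -> (forall i, i \in fam -> `|t i| <= S) ->
  (forall i, i \in fam -> forall s, `|s| <= S -> nc (boundary u (t i) (m i) s N) <= e) ->
  \sum_(i <- fam) chi (t i) s * complex.Re (al i * ('i%C *
     (wsum N (fun n => F s n * kern (t i - s) (n - m i)) + boundary u (t i) (m i) s N)))
  <= wsum N (fun n => nc (F s n) * nc (test_wave s n)) +
     e * (\sum_(i <- fam) nc (al i)) * \1_(`[- S, S]%classic) s.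
Proof.
move=> e0 tS hb.
rewrite (eq_bigr (fun i => complex.Re ((chi (t i) s)%:C%C * (al i * ('i%C *
     wsum N (fun n => F s n * kern (t i - s) (n - m i))))) +
   chi (t i) s * complex.Re (al i * ('i%C * boundary u (t i) (m i) s N)))); last first.
  move=> i _; rewrite !mulrDr ReD [complex.Re (_%:C%C * _)]ReM /= mul0r subr0; ring.
rewrite big_split /=; apply: lerD.
  rewrite -Re_sum; apply: le_trans (ler_norm _) _; apply: le_trans (le_Re_nc _) _.
  have -> : \sum_(i <- fam) (chi (t i) s)%:C%C * (al i * ('i%C *
      wsum N (fun n => F s n * kern (t i - s) (n - m i)))) =
      'i%C * wsum N (fun n => F s n * test_wave s n).
    rewrite -wsumZ.
    rewrite (_ : (fun n => _) = fun n => \sum_(i <- fam) (chi (t i) s)%:C%C * (al i * ('i%C * (F s n * kern (t i - s) (n - m i))))); last first.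
      apply/funext => n; rewrite /test_wave !mulr_sumr; apply: eq_bigr => i _; ring.
    by rewrite wsum_sum; apply: eq_bigr => i _; rewrite !wsumZ.
  rewrite ncM nci mul1r; apply: le_trans (wsum_norm_le _ _) _.
  by apply: ler_wsum => n; rewrite ncM.
rewrite mulrAC mulr_sumr big_seq [leRHS]big_seq; apply: ler_sum => i ifam.
have [sS|sS] := leP `|s| S; last first.
  by rewrite (chi_out (tS i ifam) sS) mul0r mulr_ge0 ?nc_ge0// mulr_ge0.
rewrite indicE mem_set ?mulr1 /=; last by rewrite in_itv /= -ler_norml.
apply: le_trans (ler_norm _) _; rewrite normrM -[leRHS]mul1r ler_pM ?chi_le1//.
apply: le_trans (le_Re_nc _) _; rewrite !ncM nci mul1r mulrC ler_wpM2r ?nc_ge0//.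
exact: hb.
Qed.

Lemma drv_sum_seq (T : eqType) (r : seq T) (f : T -> R -> R) (f' : T -> R) s :
  (forall k, k \in r -> is_derive s 1 (f k) (f' k)) ->
  is_derive s 1 (fun y : R => \sum_(k <- r) f k y) (\sum_(k <- r) f' k).
Proof.
elim: r => [|k r IH] h; first by under eq_fun do rewrite big_nil; rewrite big_nil; exact: drvC.
under eq_fun do rewrite big_cons; rewrite big_cons; apply: drvD.
  by apply: h; rewrite mem_head.
by apply: IH => j jr; apply: h; rewrite in_cons jr orbT.
Qed.

Lemma duality_bound u F X Y : bischrodinger_solution u F ->
  (forall N, exists g : R -> R, [/\ measurable_fun [set: measurableTypeR R] g,
     forall s, 0 <= g s, (\int[mu]_s (g s)%:E <= X%:E)%E &
     forall s, wsum N (fun n => nc (F s n) * nc (test_wave s n)) <= g s]) ->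
  (forall N, complex.Re (\sum_(i <- fam) al i * pairing u (t i) (m i) N 0) <= Y) ->
  complex.Re (\sum_(i <- fam) al i * u (t i) (m i)) <= Y + X.
Proof.
move=> su hg hY; apply/ler_addgt0Pr => e e0.
pose S : R := \sum_(i <- fam) `|t i|.
have S0 : 0 <= S by apply: sumr_ge0.
have tS i : i \in fam -> `|t i| <= S by exact: (@le_sum_mem _ _ _ (fun i => `|t i|)).
pose L := \sum_(i <- fam) nc (al i).
have L0 : 0 <= L by apply: sumr_ge0 => i _; exact: nc_ge0.
(* The boundary terms contribute at most [e' * L] at each time of [[-S, S]], hence
   [e' * L * (S + S)] after integration. *)
have [e' e'0 he'] : exists2 e' : R, 0 < e' & e' * L * (S + S) <= e.
  have d0 : 0 < L * (S + S) + 1 by rewrite ltr_wpDl// mulr_ge0// addr_ge0.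
  exists (e / (L * (S + S) + 1)); first by rewrite divr_gt0.
  by rewrite -mulrA mulrAC ler_pdivrMr// ler_wpM2l ?(ltW e0)// lerDl.
have [N0 hN0] := boundary_small_uniform su S0 e'0.
pose N := maxn N0 (\max_(i <- fam) absz (m i)).
have hb := hN0 N (leq_maxl _ _).
have mN i : i \in fam -> (absz (m i) <= N)%N.
  by move=> ifam; rewrite leq_max; apply/orP; right; exact: (leq_bigmax_seq (F := fun i => absz (m i))).
have [g [mg g0 ig gle]] := hg N.
pose f i s := complex.Re (al i * pairing u (t i) (m i) N s).
(* As [s] goes from [-S] to [S], every pairing moves between time 0 and its own [t i], so the
   increment of [W] is the combination of values minus the contribution of the data. *)
pose W s := \sum_(i <- fam) orient (t i) * f i (path (t i) s).
have Wends : W S - W (- S) = complex.Re (\sum_(i <- fam) al i * u (t i) (m i)) -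
    complex.Re (\sum_(i <- fam) al i * pairing u (t i) (m i) N 0).
  rewrite /W -sumrB !Re_sum -sumrB big_seq [RHS]big_seq; apply: eq_bigr => i ifam.
  by rewrite path_ends ?tS// /f pairing_end// mN.
have acW : AC W (- S) S.
  apply: (ac_sum _ (F := fun i s => orient (t i) * f i (path (t i) s))) => i.
  by apply: ac_path => c d _; exact: (ac_pairing _ _ _ _ _ _ su).
pose G s := g s + e' * L * \1_(`[- S, S]%classic) s.
have G0 s : 0 <= G s by rewrite addr_ge0// !mulr_ge0// (ltW e'0).
have mI : measurable_fun [set: measurableTypeR R] (fun s : R => e' * L * \1_(`[- S, S]%classic) s).
  by apply: measurable_funM => //; apply: measurable_indic; exact: measurable_itv.
have mG : measurable_fun [set: measurableTypeR R] G by apply: measurable_funD.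
have iG : (\int[mu]_s (G s)%:E <= (X + e)%:E)%E.
  under eq_integral do rewrite EFinD.
  rewrite ge0_integralD//; last 4 first.
  - by move=> s _; rewrite lee_fin.
  - exact/measurable_EFinP.
  - by move=> s _; rewrite lee_fin !mulr_ge0// (ltW e'0).
  - exact/measurable_EFinP.
  rewrite EFinD; apply: leeD => //.
  under eq_integral do rewrite EFinM.
  rewrite ge0_integralZl_EFin//; last 2 first.
  - by apply/measurable_EFinP; apply: measurable_indic; exact: measurable_itv.
  - by rewrite mulr_ge0// (ltW e'0).
  rewrite integral_indic; [rewrite setIT|by []|by []].
  rewrite [X in (_ * X)%E]lebesgue_measure_itv /= lte_fin.
  case: ifP => _; last by rewrite mule0 lee_fin ltW.
  by rewrite -EFinB -EFinM lee_fin opprK.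
have aeW : {ae mu, forall s : R, exists2 l : R, is_derive s 1 W l & l <= G s}.
  have fF : Filter (almost_everywhere mu) by exact: ae_filter_ringOfSetsType.
  (* The corners of the paths are finitely many and are discarded as a null set. *)
  apply: filterS2 (solution_drv su) (ae_notin (0 :: map t fam)) => s ds.
  rewrite in_cons negb_or => /andP[s0 st].
  have := @pairing_speed_le u F N e' S s (ltW e'0) tS hb.
  set l := (X in X <= _) => hl; exists l; last by apply: le_trans hl _; rewrite lerD2r.
  rewrite /W /l; apply: drv_sum_seq => i ifam.
  have sti : s != t i by apply: contra st => /eqP ->; exact: map_f.
  exact: path_drv s0 sti (drv_pairing (t i) (m i) N (al i) ds).
have intG : mu.-integrable setT (EFin \o G).
  apply/integrableP; split; first exact/measurable_EFinP.
  under eq_integral do rewrite /= ger0_norm//.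
  exact: le_lt_trans iG (ltry _).
have SS : - S <= S by lra.
have := le_trans (ac_increment_le SS acW G0 intG aeW) iG.
by rewrite lee_fin Wends; have := hY N; lra.
Qed.

End Duality.

(** * Test combinations and the estimate they give *)

Section DualFamilies.
Context {R : realType}.
Local Notation C := R[i].
Local Notation mu := (@lebesgue_measure R).
Implicit Types (s x y A : R) (n k : int) (N : nat) (q r : \bar R) (rr : seq int).

Lemma cauchy_schwarz_fin (I : eqType) (l : seq I) (a b : I -> R) x y :
  (forall i, 0 <= a i) -> (forall i, 0 <= b i) -> 0 <= x -> 0 <= y ->
  \sum_(i <- l) a i ^+ 2 <= x ^+ 2 -> \sum_(i <- l) b i ^+ 2 <= y ^+ 2 ->
  \sum_(i <- l) a i * b i <= x * y.
Proof.
move=> a0 b0 x0 y0 ha hb; apply: (@hoelder_fin _ _ _ _ _ 2 2) => //; first lra.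
  by rewrite powR_mulrn//; under eq_bigr do rewrite powR_mulrn//.
by rewrite powR_mulrn//; under eq_bigr do rewrite powR_mulrn//.
Qed.

Lemma dual2 (I : Type) (l : seq I) (z : I -> R) x : (forall i, 0 <= z i) -> 0 <= x ->
  (forall c : I -> R, (forall i, 0 <= c i) -> \sum_(i <- l) c i ^+ 2 <= 1 ->
     \sum_(i <- l) c i * z i <= x) ->
  \sum_(i <- l) z i ^+ 2 <= x ^+ 2.
Proof.
move=> z0 x0 h; set S := \sum_(i <- l) z i ^+ 2.
have S0 : 0 <= S by apply: sumr_ge0 => i _; exact: sqr_ge0.
move: (S0); rewrite le_eqVlt => /predU1P[<-|Sp]; first exact: sqr_ge0.
pose w := Num.sqrt S; have w0 : 0 < w by rewrite sqrtr_gt0.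
have wS : w ^+ 2 = S by rewrite sqr_sqrtr.
have := h (fun i => z i / w) (fun i => divr_ge0 (z0 i) (ltW w0)).
under eq_bigr do rewrite exprMn exprVn.
rewrite -mulr_suml -/S wS divff ?gt_eqF// => /(_ (lexx _)).
under eq_bigr do rewrite mulrAC -expr2.
rewrite -mulr_suml -/S -wS expr2 mulfK ?gt_eqF// => wx.
by rewrite -expr2 ler_pXn2r// nnegrE ltW.
Qed.

Lemma nc1 : nc (1 : C) = 1.
Proof. by have := nc_real (1 : R); rewrite normr1. Qed.

(** The value 1 at 0 keeps the modulus equal to 1 everywhere. *)
Definition conj_phase (z : C) : C := if z == 0 then 1 else (z^*)%C / ((nc z)%:C)%C.

Lemma conj_phase_mul z : conj_phase z * z = ((nc z)%:C)%C.
Proof.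
rewrite /conj_phase; case: eqVneq => [->|z0]; first by rewrite mulr0 nc0.
have n0 : ((nc z)%:C)%C != 0 :> C.
  by apply: contra z0 => /eqP/(congr1 (@complex.Re R)) /= /nc_eq0 ->.
have e : (z^*)%C * z = ((nc z)%:C)%C * ((nc z)%:C)%C.
  apply: eqC; first by rewrite mulrC -nc_sqr_conj ReM /= mul0r subr0.
  by rewrite !ImM /= mulr0 mul0r addr0; case: (z) => a b /=; ring.
by rewrite mulrAC e mulfK.
Qed.

Lemma nc_conj_phase z : nc (conj_phase z) = 1.
Proof.
have [->|z0] := eqVneq z 0; first by rewrite /conj_phase eqxx nc1.
have n0 : nc z != 0 by apply: contra z0 => /eqP/nc_eq0 ->.
have := congr1 (@ComplexField.Normc.normc R) (conj_phase_mul z); rewrite ncM nc_real ger0_norm ?nc_ge0//.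
by rewrite -[X in _ = X]mul1r => /(mulIf n0).
Qed.

(** Confines a test wave to the finitely many cells of a symmetric window. *)
Lemma chi_floor (t s : R) : chi t s != 0 -> (absz (Num.floor s) <= absz (Num.floor t))%N.
Proof.
rewrite /chi; case: ifP => [/andP[s0 st] _|_].
  have h1 : 0 <= Num.floor s by rewrite floor_ge0 ltW.
  have h2 : Num.floor s <= Num.floor t by rewrite le_floor// ltW.
  lia.
case: ifP => [/andP[ts s0] _|]; last by rewrite eqxx.
have h1 : Num.floor t <= Num.floor s by rewrite le_floor// ltW.
have h2 : Num.floor s <= 0 by rewrite -(floor0 R) le_floor// ltW.
lia.
Qed.

(** Once the test wave lies in the class with constant [A], the source contributes [A * y] by
    Hoelder's inequality. The data meet the free wave at time 0 and contribute [A * x] by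
    Cauchy-Schwarz. *)
Lemma duality_estimate (I : eqType) (fam : seq I) (al : I -> C) (t : I -> R) (m : I -> int)
    A (beta : int -> R) rr q r x y (u F : R -> int -> C) :
  strichartz_pair q r -> 0 < A -> (forall k, 0 <= beta k <= A) -> uniq rr ->
  \sum_(k <- rr) beta k ^+ 8 <= A ^+ 8 -> measurable_source F -> bischrodinger_solution u F ->
  0 <= x -> 0 <= y -> (lnorm 2%:E (u 0%R) <= x%:E)%E ->
  (mixed_norm (hoelder_conjugate q) (hoelder_conjugate r) F <= y%:E)%E ->
  sumle (fun n => nc (\sum_(i <- fam) al i * kern (t i) (n - m i)) ^+ 2) (A ^+ 2) ->
  (forall s, sumle (fun n => nc (test_wave fam al t m s n) ^+ 2) (A ^+ 2)) ->
  (forall s n, nc (test_wave fam al t m s n) <= beta (Num.floor s)) ->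
  (forall s n, Num.floor s \notin rr -> test_wave fam al t m s n = 0) ->
  complex.Re (\sum_(i <- fam) al i * u (t i) (m i)) <= A * (x + y).
Proof.
move=> hp A0 bA ur b8 mF su x0 y0 ux Fy h0 w2 wb wz.
rewrite mulrDr; apply: (duality_bound (fam := fam) (F := F)) => // N.
  have [g [mg g0 ig gle]] := source_dominant N hp A0 bA ur b8 mF.
  exists g; split => //.
    by apply: le_trans ig _; rewrite EFinM; apply: lee_wpmul2l => //; rewrite lee_fin (ltW A0).
  move=> s; have [sr|sr] := boolP (Num.floor s \in rr); first exact: (gle _ s _ sr erefl (w2 s) (wb s)).
  apply: le_trans (g0 s); rewrite /wsum big1// => k _.
  by rewrite wz// nc0 mulr0.
rewrite /pairing; under eq_bigr => i _.
  rewrite -wsumZ; under eq_fun do rewrite subr0 mulrCA.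
  over.
rewrite -wsum_sum; under eq_fun do rewrite -mulr_sumr.
apply: le_trans (ler_norm _) _; apply: le_trans (le_Re_nc _) _.
apply: le_trans (wsum_norm_le _ _) _; rewrite wsum_seq mulrC.
under eq_bigr do rewrite ncM.
have uw := uniq_window N.
apply: cauchy_schwarz_fin => //; rewrite ?(ltW A0)//; try by move=> i; exact: nc_ge0.
  by apply: lnorm2_sumle.
exact: h0.
Qed.

End DualFamilies.

(** * Cell suprema, and free waves issued from one time *)

Section Strichartz.
Context {R : realType}.
Local Notation C := R[i].
Implicit Types (s x y A B D T : R) (n k : int) (N : nat) (q r : \bar R) (rr : seq int) (u F : R -> int -> C).

(** In each cell pick a space-time point where the modulus is at least half the supremum; this half
    is the factor in [2 * D]. *)
Lemma cell_sup (w : R -> int -> C) B D : 0 <= D -> (forall s n, nc (w s n) <= B) ->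
  (forall (s : int -> R) (m : int -> int) rr, (forall k, Num.floor (s k) = k) -> uniq rr ->
     \sum_(k <- rr) nc (w (s k) (m k)) ^+ 8 <= D ^+ 8) ->
  exists beta : int -> R, [/\ forall k, 0 <= beta k <= B,
    forall s n, nc (w s n) <= beta (Num.floor s) & sumle (fun k => beta k ^+ 8) ((2 * D) ^+ 8)].
Proof.
move=> D0 wB wD.
pose E k := [set x | exists s n, Num.floor s = k /\ x = nc (w s n)].
have fl k : Num.floor (k%:~R : R) = k by exact: intrKfloor.
have E0 k : E k !=set0 by exists (nc (w k%:~R 0)), k%:~R, 0.
have Eub k : has_ubound (E k) by exists B => _ [s [n [_ ->]]].
have bw s n : nc (w s n) <= sup (E (Num.floor s)) by apply: ub_le_sup => //; exists s, n.
have b0 k : 0 <= sup (E k) by rewrite -(fl k); apply: le_trans (nc_ge0 _) (bw _ 0).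
have near k : exists p : R * int, Num.floor p.1 = k /\ sup (E k) <= 2 * nc (w p.1 p.2).
  have := b0 k; rewrite le_eqVlt => /predU1P[<-|bp].
    by exists (k%:~R, 0); split => //=; rewrite mulr_ge0 ?nc_ge0.
  have bp2 : 0 < sup (E k) / 2 by rewrite divr_gt0.
  have [_ [s [n [sk ->]]] h] := sup_adherent bp2 (conj (E0 k) (Eub k)).
  by exists (s, n); split => //=; lra.
have [p hp] := choice near.
exists (fun k => sup (E k)); split => //.
  by move=> k; rewrite b0 /=; apply: ge_sup => // _ [s [n [_ ->]]].
move=> rr ur.
have := wD (fun k => (p k).1) (fun k => (p k).2) rr (fun k => (hp k).1) ur => h.
rewrite exprMn; apply: le_trans (ler_wpM2l _ h); last by rewrite exprn_ge0.
rewrite mulr_sumr; apply: ler_sum => k _; rewrite -exprMn lerXn2r ?nnegrE ?mulr_ge0 ?nc_ge0//.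
exact: (hp k).2.
Qed.

Lemma floor_cell (s : int -> R) : (forall k, Num.floor (s k) = k) ->
  forall k, k%:~R <= s k < (k + 1)%:~R.
Proof. by move=> hs k; have := floor_itv (s k); rewrite hs. Qed.

Lemma cell_gap (s : int -> R) j k : (forall k, Num.floor (s k) = k) ->
  `|(s j - s k) - (j - k)%:~R| <= 1.
Proof.
move=> hs; have := floor_cell hs j; have := floor_cell hs k.
rewrite !rmorphD /= => /andP[? ?] /andP[? ?]; rewrite ler_norml rmorphN /=; apply/andP; split; lra.
Qed.

Lemma kern_conj T s n k : kern (T - s) (n - k) = ((kern (s - T) (k - n))^*)%C.
Proof. by rewrite -kernN opprB -ker_oppn opprB. Qed.

Section FixedTime.
Variables (T : R) (fam : seq int) (al : int -> C).
Hypotheses (ufam : uniq fam) (hal : \sum_(i <- fam) nc (al i) ^+ 2 <= 1).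

Let w s n : C := \sum_(i <- fam) al i * kern (T - s) (n - i).

(** Unitarity: at equal times the Gram matrix is the identity. *)
Lemma fixed_time_energy s : sumle (fun n => nc (w s n) ^+ 2) 1.
Proof.
have h1 i i' : i \in fam -> i' \in fam -> nc (kern (T - s - (T - s)) (i' - i)) <= (i' == i)%:R.
  move=> _ _; rewrite subrr kern0 subr_eq0; by case: eqP => _; rewrite ?mulr1n ?mulr0n ?nc1 ?nc0.
move=> rr ur; apply: le_trans (@gram_bound _ _ fam al (fun=> T - s) id (fun i i' => (i' == i)%:R) h1 rr ur) _; apply: le_trans hal.
rewrite big_seq [leRHS]big_seq; apply: ler_sum => i ifam.
rewrite (bigD1_seq i)//= eqxx mulr1 big1 ?addr0// => j /negbTE ->.
by rewrite mulr0.
Qed.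

(** The free estimate at the pair (8, oo), dual to [family_energy]: exchanging the two sums moves
    the weights [c ^+ 7] onto a family with one point per cell, which is then paired with [al] by
    Cauchy-Schwarz. *)
Lemma fixed_time_cells (s : int -> R) (m : int -> int) rr : (forall k, Num.floor (s k) = k) ->
  uniq rr -> \sum_(k <- rr) nc (w (s k) (m k)) ^+ 8 <= (84 * 22) ^+ 8.
Proof.
move=> hs ur; apply: dual8; [by move=> k; exact: nc_ge0|by rewrite mulr_ge0|].
move=> c c0 hc.
pose ga k := (c k ^+ 7)%:C%C * conj_phase (w (s k) (m k)).
have gac k : nc (ga k) <= c k ^+ 7 by rewrite ncM nc_conj_phase mulr1 nc_real ger0_norm ?exprn_ge0.
pose Phi i := \sum_(k <- rr) ga k * kern (T - s k) (m k - i).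
have PhiE i : nc (Phi i) = nc (\sum_(k <- rr) (ga k)^*%C * kern (s k - T) (i - m k)).
  rewrite -nc_conj conj_sum; congr (nc _); apply: eq_bigr => k _.
  by rewrite rmorphM; congr (_ * _); rewrite kern_conj; exact: conjcK.
have Phi2 : sumle (fun i => nc (Phi i) ^+ 2) ((84 * 22) ^+ 2).
  under eq_fun do rewrite PhiE.
  move=> l ul; apply: le_trans (@family_energy _ rr c (fun k => (ga k)^*%C) (fun k => s k - T) m ur c0 hc _ _ l ul) _.
  - by move=> k; rewrite nc_conj.
  - move=> j k _ _; rewrite (_ : s j - T - (s k - T) = s j - s k); last by ring.
    exact: cell_gap.
  (* The energy bound [84 * 22] is relaxed to its square, so that no root appears in the
     constant. *)
  - by rewrite expr2 ler_peMr//; lra.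
have e : \sum_(k <- rr) c k ^+ 7 * nc (w (s k) (m k)) = complex.Re (\sum_(i <- fam) al i * Phi i).
  have -> : \sum_(i <- fam) al i * Phi i = \sum_(k <- rr) ga k * w (s k) (m k).
    rewrite /Phi /w; under eq_bigr do rewrite mulr_sumr.
    rewrite exchange_big; apply: eq_bigr => k _; rewrite mulr_sumr; apply: eq_bigr => i _.
    by rewrite mulrCA.
  rewrite Re_sum; apply: eq_bigr => k _.
  by rewrite /ga -mulrA conj_phase_mul ReM /= mulr0 subr0.
rewrite e; apply: le_trans (ler_norm _) _; apply: le_trans (le_Re_nc _) _.
apply: le_trans (nc_sum _ _) _; under eq_bigr do rewrite ncM.
rewrite -[leRHS]mul1r; apply: cauchy_schwarz_fin => //; try by move=> i; exact: nc_ge0.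
  by rewrite expr1n.
exact: Phi2.
Qed.

End FixedTime.

End Strichartz.

(** * The solution itself belongs to the class *)

Section Inhomogeneous.
Context {R : realType}.
Local Notation C := R[i].
Variables (q r : \bar R) (u F : R -> int -> C) (x y : R).
Hypotheses (hp : strichartz_pair q r) (mF : measurable_source F)
  (su : bischrodinger_solution u F) (x0 : 0 <= x) (y0 : 0 <= y)
  (ux : (lnorm 2%:E (u 0%R) <= x%:E)%E)
  (Fy : (mixed_norm (hoelder_conjugate q) (hoelder_conjugate r) F <= y%:E)%E).
Implicit Types (s T : R) (n k : int) (rr : seq int).

(** Duality with a single time, the coefficients being aligned with the phases of [u T]. The
    constant [84 * 22] comes from [fixed_time_cells] and the 2 from [cell_sup]. *)
Lemma energy_bound T : sumle (fun n => nc (u T n) ^+ 2) ((2 * (84 * 22) * (x + y)) ^+ 2).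
Proof.
move=> fam ufam; apply: dual2; [by move=> n; exact: nc_ge0|by rewrite mulr_ge0// addr_ge0|].
move=> c c0 hc.
pose al n := (c n)%:C%C * conj_phase (u T n).
have nal n : nc (al n) = c n by rewrite ncM nc_conj_phase mulr1 nc_real ger0_norm.
have hal : \sum_(i <- fam) nc (al i) ^+ 2 <= 1 by under eq_bigr do rewrite nal.
have -> : \sum_(i <- fam) c i * nc (u T i) = complex.Re (\sum_(i <- fam) al i * u T i).
  by rewrite Re_sum; apply: eq_bigr => k _; rewrite /al -mulrA conj_phase_mul ReM /= mulr0 subr0.
pose w s n := \sum_(i <- fam) al i * kern (T - s) (n - i).
have w2 s : sumle (fun n => nc (w s n) ^+ 2) 1 by exact: fixed_time_energy.
have w1 s n : nc (w s n) <= 1 by apply: sumle_nc_le; rewrite ?expr1n.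
have D0 : 0 <= 84 * 22 :> R by rewrite mulr_ge0.
have [beta [b1 bw b8]] := cell_sup D0 w1 (fixed_time_cells T ufam hal).
have tw s n : test_wave fam al (fun=> T) id s n = (chi T s)%:C%C * w s n.
  by rewrite /test_wave mulr_sumr.
have twle s n : nc (test_wave fam al (fun=> T) id s n) <= nc (w s n).
  by rewrite tw ncM nc_real ler_piMl ?nc_ge0// chi_le1.
have A2 : 1 <= (2 * (84 * 22)) ^+ 2 :> R by lra.
apply: (@duality_estimate _ _ fam al (fun=> T) id _ beta (window (absz (Num.floor T))) q r x y u F) => //.
- by move=> k; have /andP[-> h] /= := b1 k; lra.
- exact: uniq_window.
- by apply: b8; exact: uniq_window.
- move=> l ul; apply: le_trans A2; have := w2 0 l ul; rewrite /w.
  by under eq_bigr do rewrite subr0.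
- move=> s l ul; apply: le_trans A2; apply: le_trans (w2 s l ul).
  by apply: ler_sum => n _; rewrite lerXn2r ?nnegrE ?nc_ge0.
- by move=> s n; apply: le_trans (twle s n) (bw s n).
- move=> s n; rewrite mem_window => h; rewrite tw.
  by have [->|/chi_floor h'] := eqVneq (chi T s) 0; [rewrite mul0r|rewrite h' in h].
Qed.

(** Duality with one point per cell. The cell bounds [beta] of the test wave are the potentials
    estimated by [hls_potential], and [chi] is absorbed into the coefficients, whose size it can
    only reduce. *)
Lemma spacetime_bound (s : int -> R) (m : int -> int) rr : (forall k, Num.floor (s k) = k) ->
  uniq rr -> \sum_(k <- rr) nc (u (s k) (m k)) ^+ 8 <= (84 * (22 * 2 ^+ 14) * (x + y)) ^+ 8.
Proof.
move=> hs; move: rr; apply: sumle_of_wsum; first by move=> k; rewrite exprn_ge0 ?nc_ge0.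
move=> N; exists N => //; rewrite wsum_seq.
set fam := [seq _ | _ <- _]; have ufam : uniq fam by exact: uniq_window.
pose A : R := 84 * (22 * 2 ^+ 14); have A0 : 0 < A by rewrite !mulr_gt0// exprn_gt0.
apply: dual8; [by move=> k; exact: nc_ge0|by rewrite mulr_ge0 ?(ltW A0)// addr_ge0|].
move=> c c0 hc.
pose al k := (c k ^+ 7)%:C%C * conj_phase (u (s k) (m k)).
have nal k : nc (al k) = c k ^+ 7 by rewrite ncM nc_conj_phase mulr1 nc_real ger0_norm ?exprn_ge0.
have -> : \sum_(k <- fam) c k ^+ 7 * nc (u (s k) (m k)) =
    complex.Re (\sum_(k <- fam) al k * u (s k) (m k)).
  by rewrite Re_sum; apply: eq_bigr => k _; rewrite /al -mulrA conj_phase_mul ReM /= mulr0 subr0.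
pose v k := 84 * \sum_(j <- fam) c j ^+ 7 * kap (j - k)%:~R.
pose beta k := if k \in fam then v k else 0.
have v0 k : 0 <= v k.
  by rewrite mulr_ge0// sumr_ge0// => j _; rewrite mulr_ge0 ?kap_ge0 ?exprn_ge0.
have b8 : \sum_(k <- fam) beta k ^+ 8 <= A ^+ 8.
  rewrite big_seq (eq_bigr (fun k => 84 ^+ 8 * (\sum_(j <- fam) c j ^+ 7 * kap (j - k)%:~R) ^+ 8)); last first.
    by move=> k kf; rewrite /beta kf exprMn.
  by rewrite -big_seq -mulr_sumr exprMn ler_wpM2l ?exprn_ge0// hls_potential.
have bA k : 0 <= beta k <= A.
  rewrite /beta; case: ifPn => kf; last by rewrite lexx (ltW A0).
  rewrite v0 /= -(ler_pXn2r (n := 8)) ?nnegrE ?v0 ?(ltW A0)//; apply: le_trans b8.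
  have := @le_sum_mem _ _ fam (fun k => beta k ^+ 8) k; rewrite /beta kf; apply=> //.
  by move=> j; rewrite exprn_ge0//; case: ifP.
have tw z n : test_wave fam al s m z n = \sum_(k <- fam) ((chi (s k) z)%:C%C * al k) * kern (s k - z) (n - m k).
  by apply: eq_bigr => k _; rewrite mulrA.
have nchi z k : nc ((chi (s k) z)%:C%C * al k) <= c k ^+ 7.
  by rewrite ncM nc_real nal ler_piMl ?exprn_ge0// chi_le1.
have twz z n : Num.floor z \notin fam -> test_wave fam al s m z n = 0.
  move=> zf; rewrite tw big_seq big1// => k kf.
  have [->|/chi_floor] := eqVneq (chi (s k) z) 0; first by rewrite !mul0r.
  rewrite hs => h; move: zf kf; rewrite /fam !mem_window => /negP zf kN.
  by case: zf; exact: leq_trans h kN.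
have AA : 84 * 22 <= A ^+ 2 by rewrite /A; lra.
apply: (@duality_estimate _ _ fam al s m A beta fam q r x y u F) => //.
- move=> l ul; apply: le_trans AA; apply: (family_energy (b := c)) => //.
    by move=> k; rewrite nal.
  by move=> j k _ _; exact: cell_gap.
- move=> z l ul; apply: le_trans AA; under eq_bigr do rewrite tw.
  apply: (family_energy (b := c) (sg := fun k => s k - z)) => //.
  by move=> j k _ _; rewrite (_ : s j - z - (s k - z) = s j - s k); [exact: cell_gap|ring].
- move=> z n; have [zf|zf] := boolP (Num.floor z \in fam); last first.
    by rewrite twz// nc0; have /andP[] := bA (Num.floor z).
  rewrite /beta zf tw; apply: family_sup => //.
    by move=> j _; have /andP[-> /ltW ->] := floor_cell hs j.
  by have /andP[-> /ltW ->] := floor_itv z.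
Qed.

End Inhomogeneous.

Lemma strichartz_estimate (R : realType) (q r qt rt : \bar R) (u F : R -> int -> R[i]) (x y : R) :
  strichartz_pair q r -> strichartz_pair qt rt -> measurable_source F -> bischrodinger_solution u F ->
  0 <= x -> 0 < x + y -> 0 <= y -> (lnorm 2%:E (u 0%R) <= x%:E)%E ->
  (mixed_norm (hoelder_conjugate qt) (hoelder_conjugate rt) F <= y%:E)%E ->
  (mixed_norm q r u <= (2 * (84 * (22 * 2 ^+ 14)) * (x + y))%:E)%E.
Proof.
move=> hp hpt mF su x0 xy y0 ux Fy.
have e2 := energy_bound hpt mF su x0 y0 ux Fy.
have u1 s n : nc (u s n) <= 2 * (84 * 22) * (x + y).
  by apply: sumle_nc_le (e2 s); rewrite !mulr_ge0// ltW.
have D0 : 0 <= 84 * (22 * 2 ^+ 14) * (x + y) by rewrite mulr_ge0 ?(ltW xy)//; lra.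
have [beta [b1 bu b8]] := cell_sup D0 u1 (spacetime_bound hpt mF su x0 y0 ux Fy).
rewrite mulrA in b8.
have le : 2 * (84 * 22) * (x + y) <= 2 * (84 * (22 * 2 ^+ 14)) * (x + y).
  by rewrite ler_wpM2r ?(ltW xy)//; lra.
have A0 : 0 < 2 * (84 * (22 * 2 ^+ 14)) * (x + y) by rewrite mulr_gt0//; lra.
apply: (@mixed_norm_le _ _ beta) => //.
- by move=> k; have /andP[-> h] /= := b1 k; exact: le_trans h le.
- move=> t l ul; apply: le_trans (e2 t l ul) _.
  by rewrite lerXn2r// nnegrE ?(ltW A0)// mulr_ge0 ?(ltW xy)//; lra.
Qed.

Theorem theorem3p5 (R : realType) :
  (forall q r qt rt : \bar R, strichartz_pair q r -> strichartz_pair qt rt ->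
    exists2 C : R, 0 < C &
    forall u F : R -> int -> R[i],
      measurable_source F -> bischrodinger_solution u F ->
      (mixed_norm q r u <=
        C%:E * (lnorm 2%:E (u 0%R) +
                mixed_norm (hoelder_conjugate qt) (hoelder_conjugate rt) F))%E)
  /\
  ((exists C : R, forall t : R, t != 0 ->
      (opnorm_l1_linfty (propagator t) <= (C * `|t| `^ (- 4^-1))%:E)%E) /\
   has_sup [set alpha : R | decay_rate alpha] /\
   sup [set alpha : R | decay_rate alpha] = 4^-1).
Proof.
split; last first.
  split; last exact: decay_rate_sup.
  by exists 42 => t; exact: opnorm_decay.
move=> q r qt rt hp hpt; pose A : R := 2 * (84 * (22 * 2 ^+ 14)).
have A0 : 0 < A by rewrite /A; lra.
exists A => // u F mF su.
have := solution_l2 su 0; have := lnorm_ge0 2%:E (u 0).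
case ex : (lnorm 2%:E (u 0)) => [x| |] // x0 _; rewrite lee_fin in x0.
have : (0 <= mixed_norm (hoelder_conjugate qt) (hoelder_conjugate rt) F)%E by exact: Lnorm_ge0.
case ey : (mixed_norm _ _ F) => [y| |] // y0; last first.
  by rewrite addey// gt0_muley ?leey ?lte_fin.
rewrite lee_fin in y0; apply/lee_addgt0Pr => e e0.
(* The class needs a positive constant, so for zero data and source the bound on the data is raised
   by [e / A], which costs [e] in the conclusion. *)
have eA : 0 < e / A by rewrite divr_gt0.
have := @strichartz_estimate R q r qt rt u F (x + e / A) y hp hpt mF su.
rewrite ex ey !lee_fin lerDl => /(_ (addr_ge0 x0 (ltW eA)) _ y0 (ltW eA) (lexx _)) h.
apply: le_trans (h _) _; first by rewrite ltr_wpDr// ltr_wpDl.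
by rewrite -EFinD lee_fin -/A addrAC mulrDr (mulrC A (e / A)) divfK// gt_eqF.
Qed.
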